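(* Let $d\ge1$. There exist a constant $C_d>0$ depending only on $d$ and, for each $\Delta\in(0,\infty)$, a constant $c(\Delta)>0$ depending only on $d$ and $\Delta$, such that the following holds. Let $Q$ and $S$ be compact sets in $\mathbb{R}^d$ of positive Lebesgue measure, and let $\Delta=\mathrm{diam}_\infty(Q)\cdot\mathrm{diam}_\infty(S)\in(0,\infty)$. Then $$\lambda_k(Q,S)\le C_d\exp\bigl(-c(\Delta)\,k^{1/d}\bigr)\qquad\text{for all }k\ge1.$$
   Context: $\mathrm{diam}_\infty(A)$ is the diameter of $A\subset\mathbb{R}^d$ with respect to the $\ell^\infty$ metric on $\mathbb{R}^d$. The Fourier transform is $\mathcal{F}[f](\xi)=\widehat f(\xi)=\int_{\mathbb{R}^d}f(x)e^{-ix\cdot\xi}\,dx$ and its inverse is $\mathcal{F}^{-1}[g](x)=(2\pi)^{-d}\int_{\mathbb{R}^d}g(\xi)e^{ix\cdot\xi}\,d\xi$. For measurable $Q,S\subset\mathbb{R}^d$ of finite positive Lebesgue measure, define the orthogonal projections on $L^2(\mathbb{R}^d)$: $P_Q[f]=\chi_Qf$ and $B_S[f]=\mathcal{F}^{-1}[\chi_S\widehat f\,]$. The operator $B_SP_QB_S$ on $L^2(\mathbb{R}^d)$ is compact and positive semidefinite, and $\{\lambda_k(Q,S)\}_{k\ge0}\subset(0,1]$ denotes the sequence of its positive eigenvalues, counted with multiplicity and arranged in non-increasing order. (These are also the positive eigenvalues of $P_QB_SP_Q$.) *)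

(* Defs.v *)
From HB Require Import structures.
From mathcomp Require Import all_boot all_order all_algebra.
From mathcomp Require Import complex.
From mathcomp Require Import all_classical all_reals all_analysis.

Set Implicit Arguments.
Unset Strict Implicit.
Unset Printing Implicit Defensive.

Import Order.TTheory GRing.Theory Num.Theory.
Import numFieldNormedType.Exports.

Local Open Scope classical_set_scope.
Local Open Scope ring_scope.
Local Open Scope complex_scope.

(* Product sigma-algebra on row vectors: the one generated by the coordinate
   maps, as mathcomp-analysis does for tuples. For T = R it is the Borel
   sigma-algebra. *)
Definition measure_rV_display : measure_display -> measure_display.
Proof. exact. Qed.

Section measurable_rV.
Context {d} {T : sigmaRingType d} (n : nat).

Let coors : 'I_n -> 'rV[T]_n -> T := fun i x => x ord0 i.

Let rV_set0 : g_sigma_preimage coors set0.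
Proof. exact: sigma_algebra0. Qed.

Let rV_setC A : g_sigma_preimage coors A -> g_sigma_preimage coors (~` A).
Proof. exact: sigma_algebraC. Qed.

Let rV_bigcup (F : _^nat) : (forall i, g_sigma_preimage coors (F i)) ->
  g_sigma_preimage coors (\bigcup_i (F i)).
Proof. exact: sigma_algebra_bigcup. Qed.

HB.instance Definition _ := @isMeasurable.Build (measure_rV_display d)
  'rV[T]_n (g_sigma_preimage coors) rV_set0 rV_setC rV_bigcup.

End measurable_rV.

Section measurable_rV_lemmas.
Context d1 d2 (T1 : measurableType d1) (T2 : measurableType d2).

Lemma measurable_coord n (i : 'I_n) :
  measurable_fun [set: 'rV[T2]_n] (fun x : 'rV[T2]_n => x ord0 i).
Proof.
move=> _ Y mY; rewrite setTI; apply: sub_sigma_algebra => /=.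
rewrite -bigcup_seq/=; exists i => /=; first by rewrite mem_index_enum.
by exists Y => //; rewrite setTI.
Qed.

Lemma measurable_fun_rVP n (f : T1 -> 'rV[T2]_n) :
  measurable_fun [set: T1] f <->
  forall i, measurable_fun [set: T1] (fun x => f x ord0 i).
Proof.
split=> [mf i|mf].
  exact: (measurableT_comp (measurable_coord i) mf).
move=> _ A mA; rewrite setTI.
suff: preimage_set_system [set: T1] f measurable `<=` measurable.
  by apply; exists A => //; rewrite setTI.
have -> : (@measurable _ 'rV[T2]_n) =
    g_sigma_preimage (fun (i : 'I_n) (x : 'rV[T2]_n) => x ord0 i) by [].
rewrite /g_sigma_preimage => _ [B sB <-]; rewrite setTI.
move: B sB; apply: smallest_sub.
  split; first by rewrite /= preimage_set0.
    by move=> B /= mB; rewrite setTD preimage_setC; exact: measurableC.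
  by move=> F mF /=; rewrite preimage_bigcup; exact: bigcup_measurable.
rewrite -bigcup_seq/=; apply: bigcup_sub => i _ B [D mD <-].
rewrite setTI /=.
by have := mf i measurableT D mD; rewrite setTI.
Qed.

End measurable_rV_lemmas.

Section lebesgue_rV.
Variable R : realType.
Local Open Scope ereal_scope.

Definition rV_cons d (p : measurableTypeR R * 'rV[R]_d) : 'rV[R]_d.+1 :=
  row_mx (p.1)%:M p.2.

Lemma rV_cons0 d p : @rV_cons d p ord0 ord0 = p.1.
Proof.
rewrite /rV_cons mxE; case: splitP => [j _|j /eqP]; last by [].
by rewrite mxE (ord1 j) mulr1n.
Qed.

Lemma rV_consS d p i : @rV_cons d p ord0 (lift ord0 i) = p.2 ord0 i.
Proof.
rewrite /rV_cons mxE; case: splitP => [j|j /eqP]; first by rewrite ord1.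
by rewrite eqSS => /eqP ij; congr (_ _ _); apply: val_inj; rewrite /= ij.
Qed.

Lemma measurable_rV_cons d : measurable_fun setT (@rV_cons d).
Proof.
apply/measurable_fun_rVP => i; have [j ->|->] := unliftP ord0 i.
  under eq_fun do rewrite rV_consS.
  exact: (measurableT_comp (measurable_coord j) measurable_snd).
under eq_fun do rewrite rV_cons0.
exact: measurable_fst.
Qed.

(* the library proves this too, but the canonical instance that carries it is
   overridden by the one for subprobabilities *)
Let sigma_finite_product d1 d2 (T1 : measurableType d1) (T2 : measurableType d2)
    (m1 : {sigma_finite_measure set T1 -> \bar R})
    (m2 : {sigma_finite_measure set T2 -> \bar R}) :
  sigma_finite setT (m1 \x m2).
Proof.
have /sigma_finiteP[F [TF ndF Foo]] := sigma_finiteT m1.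
have /sigma_finiteP[G [TG ndG Goo]] := sigma_finiteT m2.
exists (fun n => F n `*` G n).
  rewrite -setXTT TF TG predeqE => -[x y]; split.
    move=> [/= [n _ Fnx] [k _ Gky]]; exists (maxn n k) => //; split.
    - by move: x Fnx; exact/subsetPset/ndF/leq_maxl.
    - by move: y Gky; exact/subsetPset/ndG/leq_maxr.
  by move=> [n _ []/= ? ?]; split; exists n.
move=> k; have [? ?] := Foo k; have [? ?] := Goo k.
split; first exact: measurableX.
by rewrite product_measure1E// lte_mul_pinfty// ge0_fin_numE.
Qed.

Let sigma_finite_measure_pack d (T : measurableType d) (m : set T -> \bar R) :
  m set0 = 0 -> (forall A, 0 <= m A) -> semi_sigma_additive m ->
  sigma_finite setT m -> {mu : {sigma_finite_measure set T -> \bar R} | m = mu}.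
Proof.
move=> m0 mge0 msigma msf.
pose mM := isMeasure.Build _ _ _ m m0 mge0 msigma.
pose m' : {measure set _ -> \bar R} := HB.pack m mM.
pose mS := Measure_isSigmaFinite.Build _ _ _ m' msf.
pose m2 : {sigma_finite_measure set _ -> \bar R} := HB.pack m m' mS.
by exists m2.
Qed.

(* d-dimensional Lebesgue measure: image of the product of the one-dimensional
   one with the (d-1)-dimensional one under (t, x) |-> (t, x_0, ..., x_{d-2}) *)
Fixpoint lebesgue_rV d : set 'rV[R]_d -> \bar R :=
  match d with
  | 0 => \d_(0%R : 'rV[R]_0)
  | d'.+1 => pushforward (@lebesgue_measure R \x @lebesgue_rV d') (@rV_cons d')
  end.

Arguments lebesgue_rV : clear implicits.

Lemma lebesgue_rV_ex d :
  {mu : {sigma_finite_measure set 'rV[R]_d -> \bar R} | lebesgue_rV d = mu}.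
Proof.
elim: d => [|d [mu muE]]; first by exists \d_(0%R : 'rV[R]_0).
have mc := @measurable_rV_cons d.
pose m := pushforward (@lebesgue_measure R \x mu) (@rV_cons d).
have m0 : m set0 = 0 by rewrite /m /pushforward preimage_set0 measure0.
have mge0 A : 0 <= m A by rewrite /m /pushforward measure_ge0.
have msigma : semi_sigma_additive m.
  move=> F mF tF mUF; rewrite /m /pushforward preimage_bigcup.
  apply: measure_semi_sigma_additive.
  - by move=> n; rewrite -[X in measurable X]setTI; exact: mc.
  - apply/trivIsetP => /= i j _ _ ij; rewrite -preimage_setI.
    by move/trivIsetP : tF => /(_ _ _ _ _ ij) ->//; rewrite preimage_set0.
  - by rewrite -preimage_bigcup -[X in measurable X]setTI; exact: mc.
have msf : sigma_finite setT m.
  have [F TF Foo] := sigma_finite_product (@lebesgue_measure R) mu.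
  have mtl : measurable_fun setT (fun x : 'rV[R]_d.+1 =>
      (x ord0 ord0 : measurableTypeR R, \row_i x ord0 (lift ord0 i))).
    apply/measurable_fun_pairP; split; first exact: measurable_coord.
    apply/measurable_fun_rVP => i /=; under eq_fun do rewrite mxE.
    exact: measurable_coord.
  pose tl (x : 'rV[R]_d.+1) : measurableTypeR R * 'rV[R]_d :=
    (x ord0 ord0, \row_i x ord0 (lift ord0 i)).
  have tlK : cancel (@rV_cons d) tl.
    move=> [t x]; rewrite /tl rV_cons0; congr pair.
    by apply/rowP => i; rewrite mxE rV_consS.
  exists (fun n => tl @^-1` (F n)).
    by rewrite -preimage_bigcup -TF preimage_setT.
  move=> n; have [mFn Fnoo] := Foo n; split.
    by rewrite -[X in measurable X]setTI; exact: mtl.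
  rewrite /= /m /pushforward -comp_preimage.
  by rewrite (_ : tl \o @rV_cons d = id) //; apply/funext => x /=; rewrite tlK.
have [m' mE] := sigma_finite_measure_pack m0 mge0 msigma msf.
by exists m'; rewrite -mE /= muE.
Qed.

Let lebesgue_rV0 d : lebesgue_rV d set0 = 0.
Proof. by have [mu ->] := lebesgue_rV_ex d; exact: measure0. Qed.

Let lebesgue_rV_ge0 d A : 0 <= lebesgue_rV d A.
Proof. by have [mu ->] := lebesgue_rV_ex d; exact: measure_ge0. Qed.

Let lebesgue_rV_sigma_additive d : semi_sigma_additive (lebesgue_rV d).
Proof.
by have [mu ->] := lebesgue_rV_ex d; exact: measure_semi_sigma_additive.
Qed.

HB.instance Definition _ d := isMeasure.Build _ _ _ (lebesgue_rV d)
  (lebesgue_rV0 d) (@lebesgue_rV_ge0 d) (@lebesgue_rV_sigma_additive d).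

Let lebesgue_rV_sigma_finite d : sigma_finite setT (lebesgue_rV d).
Proof. by have [mu ->] := lebesgue_rV_ex d; exact: sigma_finiteT. Qed.

HB.instance Definition _ d := Measure_isSigmaFinite.Build _ _ _
  (lebesgue_rV d) (@lebesgue_rV_sigma_finite d).

Lemma lebesgue_rV_box d (A : 'I_d -> set (measurableTypeR R)) :
  (forall i, measurable (A i)) ->
  lebesgue_rV d [set x | forall i, A i (x ord0 i)] =
  \prod_(i < d) lebesgue_measure (A i).
Proof.
elim: d A => [|d IH] A mA.
  rewrite big_ord0 /= diracE mem_set //; by case.
have mB : measurable [set x : 'rV[R]_d | forall i, A (lift ord0 i) (x ord0 i)].
  rewrite [X in measurable X](_ : _ = \bigcap_(i in [set: 'I_d])
      ((fun x : 'rV[R]_d => x ord0 i) @^-1` A (lift ord0 i))); last first.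
    by apply/seteqP; split => [x /= Ax i _|x /= Ax i]; [exact: Ax|exact: (Ax i)].
  apply: fin_bigcap_measurable => // i _; rewrite -[X in measurable X]setTI.
  by apply: (@measurable_coord _ (measurableTypeR R) d i) => //; exact: mA.
rewrite big_ord_recl -IH // /= /pushforward.
have -> : lebesgue_rV d = sval (lebesgue_rV_ex d).
  by case: lebesgue_rV_ex.
rewrite -product_measure1E //.
  congr product_measure1; apply/seteqP; split => -[t x] /=.
    move=> Atx; split=> [|i]; first by have := Atx ord0; rewrite rV_cons0.
    by have := Atx (lift ord0 i); rewrite rV_consS.
  move=> [At Ax] i; have [j ->|->] := unliftP ord0 i.
    by rewrite rV_consS.
  by rewrite rV_cons0.
Qed.

End lebesgue_rV.
Arguments lebesgue_rV {R} d _.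

Section band_time_limiting.
Context {R : realType} {d : nat}.
Notation V := 'rV[R]_d.
Notation mu := (@lebesgue_rV R d).
Implicit Types (f g h u : V -> R[i]) (Q S : set V) (x y xi : V).

(* the norm of 'rV[R]_d is the sup norm *)
Definition diam_oo Q : R := sup [set `|x - y| | x in Q & y in Q].

Definition dotp x y : R := \sum_(i < d) x ord0 i * y ord0 i.

Definition expi (t : R) : R[i] := cos t +i* sin t.

Definition cintegral f : R[i] :=
  (\int[mu]_x complex.Re (f x)) +i* (\int[mu]_x complex.Im (f x)).

Definition sqnormL2 f : \bar R := (\int[mu]_x (Normc.normc (f x) ^+ 2)%:E)%E.

(* Elements of L^2(R^d; C) are represented by functions; all the notions below
   are invariant under almost everywhere equality. *)
Definition L2 : set (V -> R[i]) := [set f |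
  [/\ measurable_fun setT (fun x => complex.Re (f x)),
      measurable_fun setT (fun x => complex.Im (f x)) &
      (sqnormL2 f < +oo)%E]].

Definition cvgL2 (u_ : nat -> V -> R[i]) g : Prop :=
  (fun n => sqnormL2 (fun x => u_ n x - g x)) @ \oo --> 0%E.

Definition fourier f : V -> R[i] :=
  fun xi => cintegral (fun x => f x * expi (- dotp x xi)).

Definition inv_fourier g : V -> R[i] :=
  fun x => ((2 * pi) ^- d)%:C * cintegral (fun xi => g xi * expi (dotp x xi)).

Definition chi_mul Q f : V -> R[i] := fun x => (\1_Q x)%:C * f x.

Definition cutoff f (n : nat) : V -> R[i] := chi_mul [set x | `|x| <= n%:R] f.

(* The integrals above make sense on L^1 only; on L^2 the Fourier transform and
   its inverse are the L^2 limits of the integrals of the truncations. They,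
   and the operators built from them, are given by their graphs, as values are
   determined up to almost everywhere equality only. *)
Definition fourierL2 f g : Prop :=
  [/\ L2 f, L2 g & cvgL2 (fun n => fourier (cutoff f n)) g].

Definition inv_fourierL2 g f : Prop :=
  [/\ L2 g, L2 f & cvgL2 (fun n => inv_fourier (cutoff g n)) f].

Definition opP Q f h : Prop :=
  [/\ L2 f, L2 h & {ae mu, forall x, h x = chi_mul Q f x}].

Definition opB S f h : Prop :=
  exists g, fourierL2 f g /\ inv_fourierL2 (chi_mul S g) h.

Definition opBPB Q S f h : Prop :=
  exists u v, [/\ opB S f u, opP Q u v & opB S v h].

Definition eigenspace_BPB Q S (t : R) : set (V -> R[i]) :=
  [set f | opBPB Q S f (fun x => t%:C * f x)].

(* [E], seen as a subspace of L^2, has complex dimension [n] *)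
Definition has_dim (E : set (V -> R[i])) (n : nat) : Prop :=
  exists e : 'I_n -> V -> R[i],
  [/\ forall i, E (e i),
      forall c : 'I_n -> R[i],
        {ae mu, forall x, \sum_(i < n) c i * e i x = 0} -> forall i, c i = 0 &
      forall f, E f -> exists c : 'I_n -> R[i],
        {ae mu, forall x, f x = \sum_(i < n) c i * e i x}].

(* [lam] lists the positive eigenvalues of B_S P_Q B_S in non-increasing order,
   each one as many times as the dimension of its eigenspace; should there be
   finitely many of them, the list is continued by zeros. *)
Definition eigenvalues_BPB Q S (lam : nat -> R) : Prop :=
  [/\ forall k, 0 <= lam k,
      nonincreasing_seq lam &
      forall t, 0 < t -> exists n,
        has_dim (eigenspace_BPB Q S t) n /\ ([set k | lam k = t] #= `I_n)%card].

End band_time_limiting.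

(* Main.v *)
(* An eigenfunction of [B_S P_Q B_S] is, on [Q], the restriction of the entire
   function x |-> (2 pi)^-d * \int_S g(xi) e^(i x.xi) dxi. With x, xi measured
   from points of [Q] and [S], this kernel is a product of one-variable
   exponentials e^(i t) with |t| <= Delta, hence is approximated up to
   O(Delta^N / N!) by a sum of N^d products of a function of x and a function of
   xi. If N^d <= k, some nontrivial combination f of the first k + 1
   eigenfunctions has all its N^d moments equal to zero, so
   lambda_k |f|^2 <= |P_Q B_S f|^2 <= A(Delta) exp (- 2 N) |f|^2.

   Two facts about the Fourier transform suffice. It is adjoint to its inverse,
   so eigenfunctions with distinct eigenvalues are orthogonal. It is also
   bounded from L^2(R^d) to L^2 of any cube, by a constant depending on d only
   (a T T^* argument with a product of tent functions as weight); this gives the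
   estimate above, and lambda_k <= M_d as a substitute for lambda_k <= 1.
   Neither Plancherel's theorem nor the inversion formula is used, which is why
   only [M_d] appears. Interpolating between M_d and A(Delta) exp (- k^(1/d))
   makes the constant in front independent of Delta. *)

Require Import Defs.
From mathcomp Require Import all_boot all_order all_algebra.
From mathcomp Require Import complex.
From mathcomp Require Import all_classical all_reals all_analysis.
From mathcomp Require Import measurable_realfun ring lra.

Import Order.TTheory GRing.Theory Num.Theory.
Import numFieldNormedType.Exports.

Local Open Scope classical_set_scope.
Local Open Scope ring_scope.
Local Open Scope complex_scope.

Set Implicit Arguments.
Unset Strict Implicit.
Unset Printing Implicit Defensive.

(** The definition supplies bases of the separate eigenspaces, neither normalised nor orthogonal
    inside one eigenspace. The inequality for combinations is therefore read off Gram matrices: with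
    [v = P_Q B_S e], the symmetry of [B_S] gives [lam_j <e_j, e_l> = <v_j, v_l>], from which the
    norms of all combinations can be compared.

    The transforms on [L^2] are mere limits of integrals of truncations. On the inverse side the
    boundedness of [S] removes the limit: [chi_S g] is integrable, so [B_S f] is almost everywhere
    an honest integral, in which the kernel can be expanded. On the forward side the estimates are
    proved for truncations and passed to the limit by [(p + q)^2 <= 2 p^2 + 2 q^2], at the cost of a
    factor 2.

    The Schur test asks for a weight with integrable transform. The indicator of a cube is not one,
    a product of tents is, and dilating a tent leaves unchanged the integral of the majorant of its
    transform. Hence [M_d = 2 * 64^d] is free of the sizes of [Q] and [S]. *)

Notation Re := complex.Re.
Notation Im := complex.Im.
Notation normc := Normc.normc.

(** * Modulus, conjugation and exponentials of imaginary numbers *)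

Section complex_modulus.
Context {R : realType}.
Implicit Types z w : R[i].

(* [conjc] is stated for any ring, and inferring that ring from [R[i]] gives
   instances which rewriting does not identify. *)
Definition cj z : R[i] := Re z -i* Im z.

Lemma normc_sq z : normc z ^+ 2 = Re z ^+ 2 + Im z ^+ 2.
Proof. by case: z => a b /=; rewrite sqr_sqrtr// addr_ge0// sqr_ge0. Qed.

Lemma normc_ge0 z : 0 <= normc z.
Proof. by case: z => a b /=; exact: sqrtr_ge0. Qed.

Lemma normcJ z : normc (cj z) = normc z.
Proof. by case: z => a b /=; rewrite sqrrN. Qed.

Lemma normcR (r : R) : normc r%:C = `|r|.
Proof. by rewrite /= expr0n/= addr0 sqrtr_sqr. Qed.

Lemma mulcJ z : z * cj z = (normc z ^+ 2)%:C.
Proof. by rewrite normc_sq; case: z => a b; rewrite /cj/=; simpc; congr (_ +i* _); ring. Qed.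

Lemma Re_le_normc z : `|Re z| <= normc z.
Proof.
rewrite -(@ler_pXn2r _ 2%N)// ?nnegrE ?normc_ge0// normc_sq real_normK ?num_real//.
by rewrite lerDl sqr_ge0.
Qed.

Lemma Im_le_normc z : `|Im z| <= normc z.
Proof.
rewrite -(@ler_pXn2r _ 2%N)// ?nnegrE ?normc_ge0// normc_sq real_normK ?num_real//.
by rewrite lerDr sqr_ge0.
Qed.

Lemma normc_le_ReIm z : normc z <= `|Re z| + `|Im z|.
Proof.
rewrite -(@ler_pXn2r _ 2%N)// ?nnegrE ?normc_ge0 ?addr_ge0// normc_sq.
rewrite -(real_normK (num_real (Re z))) -(real_normK (num_real (Im z))).
by rewrite sqrrD lerD2r lerDl mulrn_wge0// mulr_ge0.
Qed.

Lemma ReD z w : Re (z + w) = Re z + Re w. Proof. by case: z; case: w. Qed.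
Lemma ImD z w : Im (z + w) = Im z + Im w. Proof. by case: z; case: w. Qed.
Lemma ReM z w : Re (z * w) = Re z * Re w - Im z * Im w.
Proof. by case: z; case: w. Qed.
Lemma ImM z w : Im (z * w) = Re z * Im w + Im z * Re w.
Proof. by case: z; case: w. Qed.
Lemma cjM z w : cj (z * w) = cj z * cj w.
Proof. by case: z => a b; case: w => c e; rewrite /cj/=; simpc; congr (_ +i* _); ring. Qed.
Lemma cjD z w : cj (z + w) = cj z + cj w.
Proof. by case: z => a b; case: w => c e; rewrite /cj/=; simpc; congr (_ +i* _); ring. Qed.
Lemma cjK z : cj (cj z) = z.
Proof. by case: z => a b; rewrite /cj /= opprK. Qed.
Lemma cjR (r : R) : cj r%:C = r%:C. Proof. by rewrite /cj /= oppr0. Qed.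
Lemma cj_sum (I : Type) (r : seq I) (P : pred I) (F : I -> R[i]) :
  cj (\sum_(i <- r | P i) F i) = \sum_(i <- r | P i) cj (F i).
Proof. by apply: (big_morph _ cjD); rewrite /cj /= oppr0. Qed.
Lemma ReJ z : Re (cj z) = Re z. Proof. by case: z. Qed.
Lemma ImJ z : Im (cj z) = - Im z. Proof. by case: z. Qed.

Lemma complex_ext z w : Re z = Re w -> Im z = Im w -> z = w.
Proof. by case: z => a b; case: w => c d /= -> ->. Qed.

Lemma normc_expi (t : R) : normc (expi t) = 1.
Proof. by rewrite /expi /= cos2Dsin2 sqrtr1. Qed.

Lemma expiD (s t : R) : expi (s + t) = expi s * expi t.
Proof. by rewrite /expi; simpc; rewrite cosD sinD; congr (_ +i* _); ring. Qed.

Lemma expi0 : expi (0 : R) = 1.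
Proof. by rewrite /expi cos0 sin0. Qed.

Lemma expiJ (t : R) : cj (expi t) = expi (- t).
Proof. by rewrite /expi /= cosN sinN. Qed.

Lemma expi_sum (I : Type) (r : seq I) (P : pred I) (F : I -> R) :
  expi (\sum_(i <- r | P i) F i) = \prod_(i <- r | P i) expi (F i).
Proof. by apply: (big_morph _ expiD expi0). Qed.

End complex_modulus.

(** * Integration of complex-valued functions *)

Section complex_integral.
Context {R : realType} {d} {T : measurableType d}.
Variable mu : {measure set T -> \bar R}.
Implicit Types f g : T -> R[i].

Definition cmeasurable f :=
  measurable_fun setT (fun x => Re (f x)) /\
  measurable_fun setT (fun x => Im (f x)).

Lemma cmeasurable_cst (c : R[i]) : cmeasurable (fun _ => c).
Proof. by split; exact: measurable_cst. Qed.

Lemma cmeasurable_real (r : T -> R) : measurable_fun setT r ->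
  cmeasurable (fun x => (r x)%:C).
Proof. by move=> mr; split => //=; exact: measurable_cst. Qed.

Lemma cmeasurableD f g : cmeasurable f -> cmeasurable g ->
  cmeasurable (fun x => f x + g x).
Proof.
move=> [mf1 mf2] [mg1 mg2]; split.
  by under eq_fun do rewrite ReD; exact: measurable_funD.
by under eq_fun do rewrite ImD; exact: measurable_funD.
Qed.

Lemma cmeasurableM f g : cmeasurable f -> cmeasurable g ->
  cmeasurable (fun x => f x * g x).
Proof.
move=> [mf1 mf2] [mg1 mg2]; split.
  by under eq_fun do rewrite ReM; apply: measurable_funB; exact: measurable_funM.
by under eq_fun do rewrite ImM; apply: measurable_funD; exact: measurable_funM.
Qed.

Lemma cmeasurableB f g : cmeasurable f -> cmeasurable g ->
  cmeasurable (fun x => f x - g x).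
Proof.
move=> mf mg; under eq_fun do rewrite -mulN1r.
by apply: cmeasurableD => //; apply: cmeasurableM => //; exact: cmeasurable_cst.
Qed.

Lemma cmeasurableJ f : cmeasurable f -> cmeasurable (fun x => cj (f x)).
Proof.
move=> [mf1 mf2]; split; first by under eq_fun do rewrite ReJ.
by under eq_fun do rewrite ImJ; exact: measurable_funN.
Qed.

Lemma cmeasurable_sum n (F : 'I_n -> T -> R[i]) :
  (forall i, cmeasurable (F i)) -> cmeasurable (fun x => \sum_(i < n) F i x).
Proof.
elim: n F => [|n IH] F mF.
  by under eq_fun do rewrite big_ord0; exact: cmeasurable_cst.
by under eq_fun do rewrite big_ord_recl; apply: cmeasurableD => //; exact: IH.
Qed.

Lemma cmeasurable_prod n (F : 'I_n -> T -> R[i]) :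
  (forall i, cmeasurable (F i)) -> cmeasurable (fun x => \prod_(i < n) F i x).
Proof.
elim: n F => [|n IH] F mF.
  by under eq_fun do rewrite big_ord0; exact: cmeasurable_cst.
by under eq_fun do rewrite big_ord_recl; apply: cmeasurableM => //; exact: IH.
Qed.

Lemma cmeasurable_expi (r : T -> R) : measurable_fun setT r ->
  cmeasurable (fun x => expi (r x)).
Proof.
by move=> mr; split; apply: measurableT_comp => //;
  apply: continuous_measurable_fun; [exact: continuous_cos|exact: continuous_sin].
Qed.

Lemma measurable_normc f : cmeasurable f ->
  measurable_fun setT (fun x => normc (f x)).
Proof.
move=> [mf1 mf2].
rewrite (_ : (fun x => _) = (fun x => Num.sqrt (Re (f x) ^+ 2 + Im (f x) ^+ 2))).
  apply: measurableT_comp; first by apply: continuous_measurable_fun; exact: sqrt_continuous.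
  by apply: measurable_funD; exact: measurable_funX.
by apply/funext => x; case: (f x).
Qed.

Definition nint f : \bar R := (\int[mu]_x (normc (f x))%:E)%E.

Definition cintegrable f := cmeasurable f /\ (nint f < +oo)%E.

(** This is [cintegral] over an arbitrary measure; for [lebesgue_rV] the two are convertible, and
    [fourierE] relies on it. *)
Definition cint f : R[i] := (\int[mu]_x Re (f x)) +i* (\int[mu]_x Im (f x)).

Lemma nint_ge0 f : (0 <= nint f)%E.
Proof. by apply: integral_ge0 => x _; rewrite lee_fin normc_ge0. Qed.

Lemma cintegrable_le f (g : T -> \bar R) : cmeasurable f ->
  measurable_fun setT g -> (forall x, ((normc (f x))%:E <= g x)%E) ->
  (\int[mu]_x g x < +oo)%E -> cintegrable f.
Proof.
move=> mf mg fg ig; split => //; apply: le_lt_trans ig.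
apply: ge0_le_integral => //.
- by move=> x _; rewrite lee_fin normc_ge0.
- by apply/measurable_EFinP; exact: measurable_normc.
Qed.

Lemma cintegrable_Re f : cintegrable f ->
  mu.-integrable setT (EFin \o (fun x => Re (f x))).
Proof.
move=> [mf fi]; apply/integrableP; split; first by apply/measurable_EFinP; case: mf.
apply: le_lt_trans fi; apply: ge0_le_integral => //.
- by apply: measurableT_comp => //; apply/measurable_EFinP; case: mf.
- by apply/measurable_EFinP; exact: measurable_normc.
- by move=> x _ /=; rewrite lee_fin; exact: Re_le_normc.
Qed.

Lemma cintegrable_Im f : cintegrable f ->
  mu.-integrable setT (EFin \o (fun x => Im (f x))).
Proof.
move=> [mf fi]; apply/integrableP; split; first by apply/measurable_EFinP; case: mf.
apply: le_lt_trans fi; apply: ge0_le_integral => //.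
- by apply: measurableT_comp => //; apply/measurable_EFinP; case: mf.
- by apply/measurable_EFinP; exact: measurable_normc.
- by move=> x _ /=; rewrite lee_fin; exact: Im_le_normc.
Qed.

Lemma cintegrable_normc f : cintegrable f ->
  mu.-integrable setT (EFin \o (fun x => normc (f x))).
Proof.
move=> [mf fi]; apply/integrableP; split.
  by apply/measurable_EFinP; exact: measurable_normc.
by under eq_integral do rewrite /= ger0_norm ?normc_ge0//.
Qed.

Lemma nintD_le f g : cmeasurable f -> cmeasurable g ->
  (nint (fun x => (f x + g x)%R) <= nint f + nint g)%E.
Proof.
move=> mf mg; rewrite /nint -ge0_integralD//; last 4 first.
- by move=> x _; rewrite lee_fin normc_ge0.
- by apply/measurable_EFinP; exact: measurable_normc.
- by move=> x _; rewrite lee_fin normc_ge0.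
- by apply/measurable_EFinP; exact: measurable_normc.
apply: ge0_le_integral => //.
- by move=> x _; rewrite lee_fin normc_ge0.
- by apply/measurable_EFinP; apply: measurable_normc; exact: cmeasurableD.
- by apply: emeasurable_funD; apply/measurable_EFinP; exact: measurable_normc.
- by move=> x _; rewrite -EFinD lee_fin; exact: le_normcD.
Qed.

Lemma nintZ (c : R[i]) f : cmeasurable f ->
  nint (fun x => c * f x) = ((normc c)%:E * nint f)%E.
Proof.
move=> mf; rewrite /nint.
under eq_integral do rewrite Normc.normcM EFinM.
rewrite ge0_integralZl// ?lee_fin ?normc_ge0//.
- by apply/measurable_EFinP; exact: measurable_normc.
- by move=> x _; rewrite lee_fin normc_ge0.
Qed.

Lemma cintegrableD f g : cintegrable f -> cintegrable g ->
  cintegrable (fun x => f x + g x).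
Proof.
move=> [mf fi] [mg gi]; split; first exact: cmeasurableD.
by apply: le_lt_trans (nintD_le mf mg) _; rewrite lte_add_pinfty.
Qed.

Lemma cintegrableZ (c : R[i]) f : cintegrable f -> cintegrable (fun x => c * f x).
Proof.
move=> [mf fi]; split; first by apply: cmeasurableM => //; exact: cmeasurable_cst.
by rewrite nintZ// lte_mul_pinfty// lee_fin normc_ge0.
Qed.

Lemma cintegrable_bounded_mul (M : R) f g : cintegrable f -> cmeasurable g ->
  (forall x, normc (g x) <= M) -> cintegrable (fun x => f x * g x).
Proof.
move=> [mf fi] mg gM.
apply: (@cintegrable_le _ (fun x => M%:E * (normc (f x))%:E)%E).
- exact: cmeasurableM.
- by apply: measurable_funeM; apply/measurable_EFinP; exact: measurable_normc.
- move=> x; rewrite Normc.normcM -EFinM lee_fin mulrC.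
  by apply: ler_wpM2r; rewrite ?normc_ge0.
- have M0 : 0 <= M by exact: le_trans (normc_ge0 _) (gM point).
  rewrite ge0_integralZl// ?lte_mul_pinfty//.
  + by apply/measurable_EFinP; exact: measurable_normc.
  + by move=> x _; rewrite lee_fin normc_ge0.
Qed.

Lemma cintegrableJ f : cintegrable f -> cintegrable (fun x => cj (f x)).
Proof.
move=> [mf fi]; split; first exact: cmeasurableJ.
by rewrite /nint; under eq_integral do rewrite normcJ.
Qed.

Lemma cintegrable_sum n (F : 'I_n -> T -> R[i]) :
  (forall i, cintegrable (F i)) -> cintegrable (fun x => \sum_(i < n) F i x).
Proof.
elim: n F => [|n IH] F mF.
  under eq_fun do rewrite big_ord0; split; first exact: cmeasurable_cst.
  by rewrite /nint Normc.normc0 integral0 ltry.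
by under eq_fun do rewrite big_ord_recl; apply: cintegrableD => //; exact: IH.
Qed.

Lemma cintD f g : cintegrable f -> cintegrable g ->
  cint (fun x => f x + g x) = cint f + cint g.
Proof.
move=> fi gi; rewrite /cint.
under eq_Rintegral do rewrite ReD.
under [X in _ +i* X]eq_Rintegral do rewrite ImD.
rewrite RintegralD//; [|exact: cintegrable_Re..].
by rewrite RintegralD//; exact: cintegrable_Im.
Qed.

Lemma cintZ (c : R[i]) f : cintegrable f -> cint (fun x => c * f x) = c * cint f.
Proof.
move=> fi; have rf := cintegrable_Re fi; have If := cintegrable_Im fi.
have Z (r : R) (h : T -> R) : mu.-integrable setT (EFin \o h) ->
    mu.-integrable setT (EFin \o (fun x => r * h x)).
  by move=> ih; have := integrableZl measurableT r ih.
rewrite /cint.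
under eq_Rintegral do rewrite ReM.
under [X in _ +i* X]eq_Rintegral do rewrite ImM.
rewrite RintegralB//; [|exact: Z..].
rewrite RintegralD//; [|exact: Z..].
rewrite !RintegralZl//; case: c => a b; simpc => /=.
by congr (_ +i* _); ring.
Qed.

Lemma cint_sum n (F : 'I_n -> T -> R[i]) : (forall i, cintegrable (F i)) ->
  cint (fun x => \sum_(i < n) F i x) = \sum_(i < n) cint (F i).
Proof.
elim: n F => [|n IH] F mF.
  rewrite big_ord0 /cint; under eq_Rintegral do rewrite big_ord0.
  under [X in _ +i* X]eq_Rintegral do rewrite big_ord0.
  by rewrite /= Rintegral_cst// mul0r.
rewrite big_ord_recl -IH// -cintD//; last exact: cintegrable_sum.
by congr cint; apply/funext => x; rewrite big_ord_recl.
Qed.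

Lemma cintB f g : cintegrable f -> cintegrable g ->
  cint (fun x => f x - g x) = cint f - cint g.
Proof.
move=> fi gi; rewrite -(mulN1r (cint g)) -cintZ// -cintD//; last exact: cintegrableZ.
by congr cint; apply/funext => x; rewrite mulN1r.
Qed.

Lemma cintJ f : cintegrable f -> cint (fun x => cj (f x)) = cj (cint f).
Proof.
move=> fi; rewrite /cint /cj /=; congr (_ +i* _).
rewrite -mulN1r -RintegralZl//; last exact: cintegrable_Im.
by apply: eq_Rintegral => x _; rewrite mulN1r.
Qed.

Lemma eq_cint f g : f =1 g -> cint f = cint g.
Proof. by move=> fg; congr cint; exact/funext. Qed.

Lemma ae_eq_cint f g : cmeasurable f -> cmeasurable g ->
  {ae mu, forall x, f x = g x} -> cint f = cint g.
Proof.
move=> [mf1 mf2] [mg1 mg2] fg; rewrite /cint /Rintegral; congr (fine _ +i* fine _);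
  apply: ae_eq_integral => //; try exact/measurable_EFinP;
  by apply: filterS fg => x + _; rewrite /= => ->.
Qed.

(* Rotating [f] so that its integral becomes a nonnegative real reduces this to
   the monotonicity of the integral of the real part. *)
Lemma normc_cint_le f : cintegrable f -> ((normc (cint f))%:E <= nint f)%E.
Proof.
move=> fi; set z := cint f.
have nf : nint f \is a fin_num by rewrite ge0_fin_numE ?nint_ge0//; case: fi.
have [->|z0] := eqVneq z 0; first by rewrite Normc.normc0 nint_ge0.
have nz : 0 < normc z.
  rewrite lt_neqAle normc_ge0 andbT eq_sym; apply: contra z0 => /eqP.
  by move/Normc.eq0_normc => ->.
rewrite -[leRHS]fineK// lee_fin -(ler_pM2l nz).
have -> : normc z * normc z = Re (cint (fun x => cj z * f x)).
  by rewrite cintZ// -/z (mulrC (cj z)) mulcJ /= expr2.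
rewrite [X in X <= _]/=.
have -> : normc z * fine (nint f) = \int[mu]_x (normc z * normc (f x)).
  by rewrite RintegralZl//; exact: cintegrable_normc.
apply: le_Rintegral => //.
- by apply: cintegrable_Re; exact: cintegrableZ.
- by have := integrableZl measurableT (normc z) (cintegrable_normc fi).
- move=> x _; apply: le_trans (ler_norm _) _; apply: le_trans (Re_le_normc _) _.
  by rewrite Normc.normcM normcJ.
Qed.

End complex_integral.

Lemma cmeasurable_comp {R : realType} {d1 d2} {T1 : measurableType d1}
    {T2 : measurableType d2} (phi : T1 -> T2) (f : T2 -> R[i]) :
  measurable_fun setT phi -> cmeasurable f -> cmeasurable (fun x => f (phi x)).
Proof.
by move=> mphi [mf1 mf2]; split;
  [exact: (measurableT_comp mf1)|exact: (measurableT_comp mf2)].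
Qed.

(** * Exchange of integrals over a product *)

Section complex_fubini.
Context {R : realType} {d1 d2} {T1 : measurableType d1} {T2 : measurableType d2}.

Variable m1 : {sigma_finite_measure set T1 -> \bar R}.
Variable m2 : {sigma_finite_measure set T2 -> \bar R}.
Implicit Types F e : T1 * T2 -> R[i].

(** The extended integral is by definition a difference of integrals of positive and negative parts,
    so the measurability part of Tonelli's theorem reaches every measurable integrand, integrable or
    not. *)
Lemma measurable_fun_integral2 (h : T1 * T2 -> \bar R) : measurable_fun setT h ->
  measurable_fun setT (fun x => \int[m2]_y h (x, y))%E.
Proof.
move=> mh.
rewrite (_ : (fun x => _) =
    (fun x => \int[m2]_y (h^\+ (x, y)) - \int[m2]_y (h^\- (x, y)))%E).
  apply: emeasurable_funB; apply: measurable_fun_fubini_tonelli_F => //.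
    exact: measurable_funepos.
  exact: measurable_funeneg.
apply/funext=> x; rewrite [LHS]integralE.
under eq_integral do rewrite funepos_comp/=.
by under [X in (_ - X)%E = _]eq_integral do rewrite funeneg_comp/=.
Qed.

Lemma cmeasurable_cint2 F : cmeasurable F ->
  cmeasurable (fun x => cint m2 (fun y => F (x, y))).
Proof.
move=> [mF1 mF2]; split; rewrite /= /Rintegral.
  apply: (measurableT_comp (fine_measurable measurableT)) => //.
  apply: (@measurable_fun_integral2 (fun z => (Re (F z))%:E)).
  exact/measurable_EFinP.
apply: (measurableT_comp (fine_measurable measurableT)) => //.
apply: (@measurable_fun_integral2 (fun z => (Im (F z))%:E)).
exact/measurable_EFinP.
Qed.

Lemma cintegrable12 F : cmeasurable F ->
  (\int[m1]_x \int[m2]_y (normc (F (x, y)))%:E < +oo)%E ->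
  cintegrable (m1 \x m2)%E F.
Proof.
move=> mF Foo; split => //; rewrite /nint fubini_tonelli1//.
  by apply/measurable_EFinP; exact: measurable_normc.
by move=> x; rewrite lee_fin normc_ge0.
Qed.

(** The real inner integral is [fine] of the extended one. The two agree where the section is
    integrable, that is for almost every [x]. *)
Let Rintegral12 (h : T1 * T2 -> R) :
  (m1 \x m2)%E.-integrable setT (EFin \o h) ->
  \int[m1]_x \int[m2]_y h (x, y) = \int[(m1 \x m2)%E]_z h z.
Proof.
move=> ih; rewrite /Rintegral -integral12_prod_meas1//; congr fine.
have mh := measurable_int _ ih.
apply: ae_eq_integral => //.
- apply/measurable_EFinP; apply: (measurableT_comp (fine_measurable measurableT)) => //.
  exact: (measurable_fun_integral2 mh).
- exact: (measurable_fun_integral2 mh).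
- apply: filterS (ae_integrable1 ih) => x ix _ /=; rewrite fineK//.
  exact: integrable_fin_num.
Qed.

Let Rintegral21 (h : T1 * T2 -> R) :
  (m1 \x m2)%E.-integrable setT (EFin \o h) ->
  \int[m2]_y \int[m1]_x h (x, y) = \int[(m1 \x m2)%E]_z h z.
Proof.
move=> ih; rewrite /Rintegral -integral21_prod_meas1//; congr fine.
have mG := measurable_fubini_G ih.
apply: ae_eq_integral => //.
  by apply/measurable_EFinP; apply: (measurableT_comp (fine_measurable measurableT)).
apply: filterS (ae_integrable2 ih) => x ix _ /=; rewrite fineK//.
exact: integrable_fin_num.
Qed.

Lemma cint12 F : cintegrable (m1 \x m2)%E F ->
  cint m1 (fun x => cint m2 (fun y => F (x, y))) = cint (m1 \x m2)%E F.
Proof.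
move=> iF; rewrite /cint /=; congr (_ +i* _).
  by rewrite -(Rintegral12 (cintegrable_Re iF)).
by rewrite -(Rintegral12 (cintegrable_Im iF)).
Qed.

Lemma cint21 F : cintegrable (m1 \x m2)%E F ->
  cint m2 (fun y => cint m1 (fun x => F (x, y))) = cint (m1 \x m2)%E F.
Proof.
move=> iF; rewrite /cint /=; congr (_ +i* _).
  by rewrite -(Rintegral21 (cintegrable_Re iF)).
by rewrite -(Rintegral21 (cintegrable_Im iF)).
Qed.

Lemma cintegrable_prod f g : cintegrable m1 f -> cintegrable m2 g ->
  cintegrable (m1 \x m2)%E (fun z => f z.1 * g z.2).
Proof.
move=> [mf fi] [mg gi]; apply: cintegrable12.
  by apply: cmeasurableM; apply: cmeasurable_comp.
under eq_integral => x _ do rewrite /= -/(nint m2 (fun y => f x * g y)) nintZ//.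
rewrite ge0_integralZr//; last 3 first.
- by apply/measurable_EFinP; exact: measurable_normc.
- by move=> x _; rewrite lee_fin normc_ge0.
- exact: nint_ge0.
rewrite -[X in (X * _)%E]fineK; last by rewrite ge0_fin_numE ?nint_ge0.
by rewrite lte_mul_pinfty// lee_fin fine_ge0// nint_ge0.
Qed.

(** A product of integrable functions of separate variables is integrable, and a bounded kernel such
    as an exponential keeps it so. Both the [T T^*] argument and adjointness are instances. *)
Lemma cint_swap (M : R) f g e : cintegrable m1 f -> cintegrable m2 g ->
  cmeasurable e -> (forall z, normc (e z) <= M) ->
  cint m1 (fun x => f x * cint m2 (fun y => g y * e (x, y))) =
  cint m2 (fun y => g y * cint m1 (fun x => f x * e (x, y))).
Proof.
move=> fi gi me eM.
have iF : cintegrable (m1 \x m2)%E (fun z => f z.1 * g z.2 * e z).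
  exact: (@cintegrable_bounded_mul _ _ _ _ M) (cintegrable_prod fi gi) me eM.
have me1 x : cmeasurable (fun y => e (x, y)).
  exact: (cmeasurable_comp (pair1_measurable x)).
rewrite [LHS](_ : _ = cint m1 (fun x => cint m2 (fun y => f x * g y * e (x, y)))).
  rewrite (cint12 iF) -(cint21 iF); apply: eq_cint => y.
  rewrite -cintZ; first by apply: eq_cint => x /=; rewrite mulrA (mulrC (g y)).
  by apply: (@cintegrable_bounded_mul _ _ _ _ M) => //;
    exact: (cmeasurable_comp (pair2_measurable y)).
apply: eq_cint => x; rewrite -cintZ; first by apply: eq_cint => y; rewrite mulrA.
exact: (@cintegrable_bounded_mul _ _ _ _ M).
Qed.

End complex_fubini.

(** * Product functions on R^d *)

Section integration_rV.
Context {R : realType}.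
Notation leb := (@lebesgue_measure R).

Lemma measurable_coord_rV d (i : 'I_d) :
  measurable_fun [set: 'rV[R]_d] (fun x : 'rV[R]_d => x ord0 i).
Proof. exact: (@measurable_coord _ (measurableTypeR R)). Qed.

Lemma ge0_integral_rV d (F : 'rV[R]_d.+1 -> \bar R) :
  measurable_fun setT F -> (forall x, 0 <= F x)%E ->
  (\int[lebesgue_rV d.+1]_x F x =
   \int[leb]_t \int[lebesgue_rV d]_x F (rV_cons (t, x)))%E.
Proof.
move=> mF F0.
have mc := @measurable_rV_cons R d.
rewrite -(@fubini_tonelli1 _ _ _ _ _ leb (lebesgue_rV d) (fun z => F (rV_cons z)))//.
  have := ge0_integral_pushforward mc (leb \x lebesgue_rV d)%E measurableT mF (fun x _ => F0 x).
  by rewrite preimage_setT.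
exact: measurableT_comp.
Qed.

Lemma ge0_integral_prod_rV_le (B : R) d (a : 'I_d -> R -> R) : 0 <= B ->
  (forall i, measurable_fun setT (a i)) -> (forall i t, 0 <= a i t) ->
  (forall i, \int[leb]_t (a i t)%:E <= B%:E)%E ->
  (\int[lebesgue_rV d]_x (\prod_(i < d) a i (x ord0 i))%:E <= (B ^+ d)%:E)%E.
Proof.
move=> B0; elim: d a => [|d IH] a ma a0 aB.
  rewrite integral_dirac//; last by under eq_fun do rewrite big_ord0; exact: measurable_cst.
  by rewrite diracT mul1e big_ord0 expr0.
have mp n (b : 'I_n -> R -> R) : (forall i, measurable_fun setT (b i)) ->
    measurable_fun setT (fun x : 'rV[R]_n => (\prod_(i < n) b i (x ord0 i))%:E).
  move=> mb; apply/measurable_EFinP; apply: measurable_prod => i _.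
  by apply: measurableT_comp => //; exact: measurable_coord_rV.
rewrite ge0_integral_rV; [|exact: mp|by move=> x; rewrite lee_fin prodr_ge0].
under eq_integral => t _.
  under eq_integral => x _.
    rewrite big_ord_recl rV_cons0/= EFinM.
    under eq_bigr do rewrite rV_consS/=.
    over.
  rewrite ge0_integralZl//; last 3 first.
  - exact: (@mp _ (fun i => a (lift ord0 i))).
  - by move=> x _; rewrite lee_fin prodr_ge0.
  - by rewrite lee_fin; exact: a0.
  over.
rewrite ge0_integralZr//; last 3 first.
- by apply/measurable_EFinP; exact: ma.
- by move=> x _; rewrite lee_fin; exact: a0.
- by apply: integral_ge0 => x _; rewrite lee_fin prodr_ge0.
rewrite exprS EFinM; apply: lee_pmul => //.
- by apply: integral_ge0 => x _; rewrite lee_fin; exact: a0.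
- by apply: integral_ge0 => x _; rewrite lee_fin prodr_ge0.
- exact: (IH (fun i => a (lift ord0 i))).
Qed.

Lemma cint_rV d (F : 'rV[R]_d.+1 -> R[i]) : cmeasurable F ->
  cintegrable (leb \x lebesgue_rV d)%E (fun z => F (rV_cons z)) ->
  cintegrable (lebesgue_rV d.+1) F /\
  cint (lebesgue_rV d.+1) F = cint (leb \x lebesgue_rV d)%E (fun z => F (rV_cons z)).
Proof.
move=> mF iF; have mc := @measurable_rV_cons R d; split.
  split => //; case: iF => _; apply: le_lt_trans.
  have mN : measurable_fun setT (fun x => (normc (F x))%:E).
    by apply/measurable_EFinP; exact: measurable_normc.
  have N0 x : x \in setT -> (0 <= (normc (F x))%:E)%E.
    by rewrite lee_fin normc_ge0.
  have := ge0_integral_pushforward mc (leb \x lebesgue_rV d)%E measurableT mN N0.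
  by rewrite preimage_setT /nint => <-.
have [mF1 mF2] := mF.
rewrite /cint /Rintegral; congr (fine _ +i* fine _).
  have := @integral_pushforward _ _ _ _ _ _ mc (leb \x lebesgue_rV d)%E setT
    (fun x => (Re (F x))%:E).
  rewrite preimage_setT; apply => //; last exact: (cintegrable_Re iF).
  exact/measurable_EFinP.
have := @integral_pushforward _ _ _ _ _ _ mc (leb \x lebesgue_rV d)%E setT
    (fun x => (Im (F x))%:E).
rewrite preimage_setT; apply => //; last exact: (cintegrable_Im iF).
exact/measurable_EFinP.
Qed.

Lemma cint_prod_rV d (b : 'I_d -> R -> R[i]) :
  (forall i, cintegrable leb (b i)) ->
  cintegrable (lebesgue_rV d) (fun x => \prod_(i < d) b i (x ord0 i)) /\
  cint (lebesgue_rV d) (fun x => \prod_(i < d) b i (x ord0 i)) =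
  \prod_(i < d) cint leb (b i).
Proof.
elim: d b => [|d IH] b ib.
  rewrite big_ord0.
  rewrite (_ : (fun x => _) = (fun _ => 1)); last by apply/funext => x; rewrite big_ord0.
  split; first split.
  - exact: cmeasurable_cst.
  - by rewrite /nint integral_dirac// Normc.normc1 mule1 diracT ltry.
  - by rewrite /cint /Rintegral !integral_dirac// !diracT !mul1e.
have [IH1 IH2] := IH (fun i => b (lift ord0 i)) (fun i => ib (lift ord0 i)).
have E z : \prod_(i < d.+1) b i ((rV_cons z : 'rV[R]_d.+1) ord0 i) =
    b ord0 z.1 * \prod_(i < d) b (lift ord0 i) (z.2 ord0 i).
  by rewrite big_ord_recl rV_cons0; under eq_bigr do rewrite rV_consS.
have iP := cintegrable_prod (ib ord0) IH1.
have := @cint_rV d (fun x => \prod_(i < d.+1) b i (x ord0 i)).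
have -> : (fun z : R * 'rV[R]_d => \prod_(i < d.+1) b i ((rV_cons z : 'rV[R]_d.+1) ord0 i)) =
    (fun z => b ord0 z.1 * \prod_(i < d) b (lift ord0 i) (z.2 ord0 i)).
  by apply/funext => z.
move=> /(_ _ iP)[].
  apply: cmeasurable_prod => i.
  by apply: cmeasurable_comp; [exact: measurable_coord_rV|case: (ib i)].
move=> h1 h2; split => //; rewrite h2 -cint12// big_ord_recl -IH2.
rewrite -[RHS]mulrC -cintZ//.
by apply: eq_cint => t /=; rewrite cintZ// mulrC.
Qed.

End integration_rV.

(** * The tent function and its Fourier transform *)

Section tent_cauchy.
Context {R : realType}.
Notation leb := (@lebesgue_measure R).

Lemma Rintegral_segment_FTC (f F : R -> R) (a b : R) : a <= b ->
  (forall x : R, is_derive x (1 : R) F (f x)) -> continuous f ->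
  \int[leb]_(x in `[a, b]) f x = F b - F a.
Proof.
rewrite le_eqVlt => /predU1P[<- _ _|ab dF cf].
  by rewrite subrr set_itv1 Rintegral_set1.
have cF : continuous F.
  by move=> x; apply: differentiable_continuous; apply/derivable1_diffP; exact: ex_derive.
rewrite /Rintegral (continuous_FTC2 ab (F := F)) ?EFinN//.
- exact: continuous_subspaceT.
- by split; [move=> x _; exact: ex_derive|apply: cvg_at_right_filter; exact: cF|
    apply: cvg_at_left_filter; exact: cF].
- by move=> x _; rewrite derive1E derive_val.
Qed.

(** A multiple of a Cauchy density. Its integral [8 * pi] depends neither on [r] nor on [b], and the
    factor 8 lets it dominate the transform of a tent at low and at high frequencies alike. *)
Definition cauchy (r b t : R) := 8 * r / (1 + (r * (t - b)) ^+ 2).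

Lemma cauchy_ge0 (r b t : R) : 0 <= r -> 0 <= cauchy r b t.
Proof. by move=> r0; rewrite divr_ge0 ?mulr_ge0// addr_ge0// sqr_ge0. Qed.

Lemma continuous_cauchy (r b : R) : continuous (cauchy r b).
Proof.
move=> t; apply: cvgM; first exact: cvg_cst.
apply: cvgV; first by rewrite gt_eqF// ltr_pwDl// sqr_ge0.
apply: cvgD; first exact: cvg_cst.
rewrite expr2; under eq_fun do rewrite expr2.
by apply: cvgM; apply: cvgM; (try exact: cvg_cst); apply: cvgB; (try exact: cvg_cst); exact: cvg_id.
Qed.

Lemma measurable_cauchy (r b : R) : measurable_fun setT (cauchy r b).
Proof. by apply: continuous_measurable_fun; exact: continuous_cauchy. Qed.

Lemma integral_cauchy_half (r b : R) : 0 < r ->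
  (\int[leb]_(t in `[b, +oo[) (cauchy r b t)%:E = (4 * pi)%:E)%E.
Proof.
move=> r0; pose F t := 8 * atan (r * (t - b)).
have dF (t : R) : is_derive t (1 : R) F (cauchy r b t).
  rewrite /F /cauchy.
  apply: is_derive_eq; rewrite /GRing.scale/=; field.
  by rewrite gt_eqF// ltr_pwDl// sqr_ge0.
have cF : continuous F.
  by move=> x; apply: differentiable_continuous; apply/derivable1_diffP; exact: ex_derive.
rewrite (@ge0_continuous_FTC2y _ _ F b (4 * pi)).
- by rewrite /F subrr mulr0 atan0 mulr0 sube0.
- by move=> x _; apply: cauchy_ge0; exact: ltW.
- by apply: continuous_subspaceT; exact: continuous_cauchy.
- rewrite (_ : 4 * pi = 8 * (pi / 2)); last by field.
  apply: cvgM; first exact: cvg_cst.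
  apply: (@cvg_comp _ _ _ (fun t => r * (t - b)) atan _ (pinfty_nbhs R)); last exact: cvgy_atan.
  apply: (gt0_cvgMry r0).
  by under eq_fun do rewrite addrC; exact: cvg_addrl.
- by move=> x _; exact: ex_derive.
- by apply: cvg_at_right_filter; exact: cF.
- by move=> x _; rewrite derive1E derive_val.
Qed.

Lemma integral_cauchy (r b : R) : 0 < r ->
  (\int[leb]_t (cauchy r b t)%:E = (8 * pi)%:E)%E.
Proof.
move=> r0.
have mc : measurable_fun setT (fun t => (cauchy r b t)%:E).
  by apply/measurable_EFinP; exact: measurable_cauchy.
rewrite -(setUv `]-oo, b]%classic) ge0_integral_setU//=; last 4 first.
- exact: measurableC.
- by rewrite setUv.
- by move=> t _; rewrite lee_fin cauchy_ge0// ltW.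
- exact/disj_setPCl.
rewrite setCitvl integral_itv_obnd_cbnd; last exact: measurable_funTS.
rewrite integral_cauchy_half//.
(* The left half-line at [b] is the mirror image of the right half-line at [- b]. *)
rewrite -[X in `]-oo, X]](opprK b) ge0_integration_by_substitutionNy.
- under eq_integral => t _.
    rewrite /= (_ : cauchy r b (- t) = cauchy r (- b) t); last first.
      by rewrite /cauchy; congr (_ / (_ + _)); ring.
    over.
  by rewrite integral_cauchy_half// -EFinD; congr EFin; ring.
- by apply: continuous_subspaceT; exact: continuous_cauchy.
- by move=> x _; apply: cauchy_ge0; exact: ltW.
Qed.

(** The slope is such that the tent is at least 1/2 at distance [r] from [a] and vanishes from
    distance [2 * r] on. Being continuous and piecewise linear, it has a transform with quadratic
    decay. *)
Definition tent (a r t : R) := Num.max 0 (1 - `|t - a| / (2 * r)).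

Lemma tent_ge0 (a r t : R) : 0 <= tent a r t.
Proof. by rewrite le_max lexx. Qed.

Lemma tent_le1 (a r t : R) : 0 < r -> tent a r t <= 1.
Proof. by move=> r0; rewrite ge_max ler01/= gerBl divr_ge0// mulr_ge0// ltW. Qed.

Lemma tent_ge_half (a r t : R) : 0 < r -> `|t - a| <= r -> 2^-1 <= tent a r t.
Proof.
move=> r0 tar; rewrite le_max; apply/orP; right.
rewrite lerBrDr -lerBrDl ler_pdivrMr ?mulr_gt0//.
by apply: le_trans tar _; lra.
Qed.

Lemma tent_out (a r t : R) : 0 < r -> 2 * r <= `|t - a| -> tent a r t = 0.
Proof.
by move=> r0 tar; apply/max_idPl; rewrite subr_le0 ler_pdivlMr ?mul1r// mulr_gt0.
Qed.

Lemma continuous_tent (a r : R) : continuous (tent a r).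
Proof.
move=> t; apply: (@continuous_max _ _ (fun=> 0) (fun t => 1 - `|t - a| / (2 * r))).
  exact: cvg_cst.
apply: cvgB; first exact: cvg_cst.
apply: cvgM; last exact: cvg_cst.
by apply: cvg_norm; apply: cvgB; [exact: cvg_id|exact: cvg_cst].
Qed.

Lemma measurable_tent (a r : R) : measurable_fun setT (tent a r).
Proof. by apply: continuous_measurable_fun; exact: continuous_tent. Qed.

Lemma integral_tent_le (a r : R) : 0 < r ->
  (\int[leb]_t (tent a r t)%:E <= (4 * r)%:E)%E.
Proof.
move=> r0; have m : measurable `[a - 2 * r, a + 2 * r]%classic by [].
have -> : (4 * r)%:E = (\int[leb]_t (\1_`[(a - 2 * r)%R, (a + 2 * r)%R]%classic t)%:E)%E.
  rewrite integral_indic// setIT/= lebesgue_measure_itv/= lte_fin.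
  by rewrite ltrD2l gtrN ?mulr_gt0// -EFinB; congr EFin; ring.
apply: ge0_le_integral => //.
- by move=> t _; rewrite lee_fin tent_ge0.
- by apply/measurable_EFinP; exact: measurable_tent.
- by apply/measurable_EFinP; exact: measurable_indic.
move=> t _; rewrite lee_fin indicE.
have [tin|tin] := boolP (t \in _); first exact: tent_le1.
rewrite tent_out//; move: tin; rewrite mem_setE in_itv/= -ler_distlC -ltNge distrC.
exact: ltW.
Qed.

Lemma cintegrable_tent (a r : R) : 0 < r -> cintegrable leb (fun t => (tent a r t)%:C).
Proof.
move=> r0; split; first by apply: cmeasurable_real; exact: measurable_tent.
rewrite /nint; under eq_integral do rewrite normcR ger0_norm ?tent_ge0//.
by apply: le_lt_trans (integral_tent_le a r0) _; rewrite ltry.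
Qed.

(* Two integrations by parts: the boundary terms of first order cancel at the
   top of the tent. *)
Lemma Rintegral_tent_cos_le (a r z p : R) : 0 < r -> z != 0 ->
  `|\int[leb]_t (tent a r t * cos (z * t + p))| <= 2 / (r * z ^+ 2).
Proof.
move=> r0 z0; set f := fun t => tent a r t * cos (z * t + p).
have cc : continuous (fun t => cos (z * t + p)).
  move=> t; apply: (@continuous_comp _ _ _ (fun t => z * t + p) cos); last exact: continuous_cos.
  by apply: cvgD; [apply: cvgM; [exact: cvg_cst|exact: cvg_id]|exact: cvg_cst].
have cf : continuous f.
  by move=> t; apply: cvgM; [exact: continuous_tent|exact: cc].
have intf (u v : R) : leb.-integrable `[u, v] (EFin \o f).
  apply: continuous_compact_integrable; first exact: segment_compact.
  exact: continuous_subspaceT.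
set al := a - 2 * r; set be := a + 2 * r.
have alea : al <= a by rewrite gerBl mulr_ge0// ltW.
have abe : a <= be by rewrite lerDl mulr_ge0// ltW.
have fE : \int[leb]_t f t = \int[leb]_(t in `[al, be]) f t.
  rewrite [RHS]Rintegral_mkcond; apply: eq_Rintegral => t _; rewrite patchE.
  have [//|tin] := boolP (t \in _).
  rewrite /f tent_out ?mul0r//; move: tin.
  by rewrite mem_setE in_itv/= -ler_distlC -ltNge distrC => /ltW.
have fs : \int[leb]_t f t =
    \int[leb]_(t in `[al, a]) f t + \int[leb]_(t in `[a, be]) f t.
  rewrite fE.
  have := @Rintegral_itvB _ f (BLeft al) (BRight be) a (intf al be).
  rewrite !bnd_simp => /(_ alea abe).
  rewrite Rintegral_itv_obnd_cbnd; first by move=> <-; ring.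
  by apply: integrableS (intf a be) => //; apply: subset_itvr; rewrite bnd_simp.
have rn0 : r != 0 by rewrite gt_eqF.
have i1 : \int[leb]_(t in `[al, a]) f t =
    sin (z * a + p) / z + (cos (z * a + p) - cos (z * al + p)) / (2 * r * z ^+ 2).
  pose F t := ((t - al) * (sin (z * t + p) / z) + cos (z * t + p) / z ^+ 2) / (2 * r).
  rewrite (_ : \int[leb]_(t in `[al, a]) f t =
      \int[leb]_(t in `[al, a]) ((t - al) / (2 * r) * cos (z * t + p))).
    have dF (t : R) : is_derive t (1 : R) F ((t - al) / (2 * r) * cos (z * t + p)).
      rewrite /F; apply: is_derive_eq; rewrite /GRing.scale/=; field.
      by rewrite z0 rn0.
    rewrite (Rintegral_segment_FTC alea dF).
    - by rewrite /F /al; field; rewrite z0 rn0.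
    - move=> t; apply: cvgM; last exact: cc.
      by apply: cvgM; [apply: cvgB; [exact: cvg_id|exact: cvg_cst]|exact: cvg_cst].
  apply: eq_Rintegral => t; rewrite inE/= in_itv/= => /andP[alt ta]; congr (_ * _).
  rewrite /tent ler0_norm ?subr_le0// /al.
  rewrite (_ : 1 - _ / _ = (t - (a - 2 * r)) / (2 * r)); last by field.
  by apply/max_idPr; rewrite divr_ge0 ?subr_ge0// mulr_ge0// ltW.
have i2 : \int[leb]_(t in `[a, be]) f t =
    - (sin (z * a + p) / z) + (cos (z * a + p) - cos (z * be + p)) / (2 * r * z ^+ 2).
  pose F t := ((be - t) * (sin (z * t + p) / z) - cos (z * t + p) / z ^+ 2) / (2 * r).
  rewrite (_ : \int[leb]_(t in `[a, be]) f t =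
      \int[leb]_(t in `[a, be]) ((be - t) / (2 * r) * cos (z * t + p))).
    have dF (t : R) : is_derive t (1 : R) F ((be - t) / (2 * r) * cos (z * t + p)).
      rewrite /F; apply: is_derive_eq; rewrite /GRing.scale/=; field.
      by rewrite z0 rn0.
    rewrite (Rintegral_segment_FTC abe dF).
    - by rewrite /F /be; field; rewrite z0 rn0.
    - move=> t; apply: cvgM; last exact: cc.
      by apply: cvgM; [apply: cvgB; [exact: cvg_cst|exact: cvg_id]|exact: cvg_cst].
  apply: eq_Rintegral => t; rewrite inE/= in_itv/= => /andP[alt ta]; congr (_ * _).
  have -> : (be - t) / (2 * r) = 1 - (t - a) / (2 * r) by rewrite /be; field.
  rewrite /tent ger0_norm ?subr_ge0//.
  apply/max_idPr; rewrite subr_ge0 ler_pdivrMr ?mulr_gt0// mul1r lerBlDl.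
  exact: ta.
rewrite fs i1 i2 addrACA subrr add0r -mulrDl.
have z20 : 0 < z ^+ 2 by rewrite exprn_even_gt0.
have q0 : 0 < 2 * r * z ^+ 2 by rewrite mulr_gt0// mulr_gt0.
rewrite normrM normfV (gtr0_norm q0).
have -> : 2 / (r * z ^+ 2) = 4 / (2 * r * z ^+ 2) by field; rewrite z0 rn0.
rewrite ler_pM2r ?invr_gt0//.
have c1 (x : R) : - 1 <= cos x <= 1 by rewrite cos_geN1 cos_le1.
have /andP[h1 h2] := c1 (z * a + p); have /andP[h3 h4] := c1 (z * al + p).
have /andP[h5 h6] := c1 (z * be + p).
by rewrite ler_norml; apply/andP; split; lra.
Qed.

(** The transform is at most the integral [4 * r] of the tent. It is also at most
    [4 / (r * z ^+ 2)], from the real and imaginary parts, the sine being a cosine with phase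
    [- (pi / 2)]. Below [|r z| = 1] the first bound lies under [cauchy r 0 z], above it the second
    does. *)
Lemma normc_cint_tent_expi_le (a r z : R) : 0 < r ->
  normc (cint leb (fun t => (tent a r t)%:C * expi (z * t))) <= cauchy r 0 z.
Proof.
move=> r0; set I := cint _ _.
have mt := measurable_tent a r.
have h1 : normc I <= 4 * r.
  have im : cintegrable leb (fun t => (tent a r t)%:C * expi (z * t)).
    apply: (@cintegrable_bounded_mul _ _ _ _ 1); first exact: cintegrable_tent.
      by apply: cmeasurable_expi; exact: measurable_funM.
    by move=> t; rewrite normc_expi.
  rewrite -lee_fin; apply: le_trans (normc_cint_le im) _.
  apply: le_trans (integral_tent_le a r0); rewrite /nint.
  by under eq_integral do rewrite Normc.normcM normc_expi mulr1 normcR ger0_norm ?tent_ge0//.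
have h2 : z != 0 -> normc I <= 4 / (r * z ^+ 2).
  move=> z0; apply: le_trans (normc_le_ReIm _) _.
  have -> : 4 / (r * z ^+ 2) = 2 / (r * z ^+ 2) + 2 / (r * z ^+ 2).
    by field; rewrite z0 gt_eqF.
  apply: lerD.
    apply: le_trans (Rintegral_tent_cos_le a 0 r0 z0).
    rewrite le_eqVlt; apply/orP; left; apply/eqP; congr `|_|.
    by apply: eq_Rintegral => t _; rewrite ReM/= mul0r subr0 addr0.
  apply: le_trans (Rintegral_tent_cos_le a (- (pi / 2)) r0 z0).
  rewrite le_eqVlt; apply/orP; left; apply/eqP; congr `|_|.
  by apply: eq_Rintegral => t _; rewrite ImM/= mul0r addr0 cosBpihalf.
rewrite /cauchy subr0; have q0 : 0 < 1 + (r * z) ^+ 2 by rewrite ltr_pwDl// sqr_ge0.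
have [rz|rz] := leP ((r * z) ^+ 2) 1.
  apply: le_trans h1 _; rewrite ler_pdivlMr// (_ : 8 * r = 4 * r * 2); last by ring.
  by rewrite ler_pM2l ?mulr_gt0//; lra.
have z0 : z != 0.
  by apply: contraTneq rz => ->; rewrite mulr0 expr0n/= -leNgt ler01.
apply: le_trans (h2 z0) _.
have z20 : 0 < z ^+ 2 by rewrite exprn_even_gt0.
have rz0 : 0 < r * z ^+ 2 by rewrite mulr_gt0.
rewrite ler_pdivrMr// mulrAC ler_pdivlMr//.
by rewrite exprMn in rz *; nra.
Qed.

End tent_cauchy.

(** * A local Bessel inequality *)

Section schur_test.
Context {R : realType} {d} {T : measurableType d}.
Variable mu : {sigma_finite_measure set T -> \bar R}.

Lemma normc_cint_le_nint (f : T -> R[i]) : cmeasurable f ->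
  ((normc (cint mu f))%:E <= nint mu f)%E.
Proof.
move=> mf; have [foo|] := ltP (nint mu f) +oo%E; first exact: normc_cint_le.
by rewrite leye_eq => /eqP ->; rewrite leey.
Qed.

Lemma integral_cint_real (r : T -> R) : cintegrable mu (fun x => (r x)%:C) ->
  (\int[mu]_x (r x)%:E = (Re (cint mu (fun x => (r x)%:C)))%:E)%E.
Proof.
move=> ir; rewrite /cint /Rintegral [RHS]/= fineK//.
exact: (integrable_fin_num measurableT (cintegrable_Re ir)).
Qed.

(** By [u x * u y <= (u x ^+ 2 + u y ^+ 2) / 2] the double integral splits into two halves; in each
    of them one variable occurs in [k] only and is integrated out, at the price of [B]. *)
Lemma schur_test (B : R) (u : T -> R) (k : T * T -> R) :
  measurable_fun setT u -> measurable_fun setT k ->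
  (forall x, 0 <= u x) -> (forall z, 0 <= k z) ->
  (forall x, \int[mu]_y (k (x, y))%:E <= B%:E)%E ->
  (forall y, \int[mu]_x (k (x, y))%:E <= B%:E)%E ->
  (\int[mu]_x \int[mu]_y (u x * u y * k (x, y))%:E <=
   B%:E * \int[mu]_x (u x ^+ 2)%:E)%E.
Proof.
move=> mu_ mk u0 k0 kB1 kB2.
have mh : measurable_fun setT (fun x => (u x ^+ 2 / 2)%:E).
  by apply/measurable_EFinP; apply: measurable_funM => //; exact: measurable_funX.
have h0 x : (0 <= (u x ^+ 2 / 2)%:E)%E by rewrite lee_fin divr_ge0 ?sqr_ge0.
have mk1 x : measurable_fun setT (fun y => (k (x, y))%:E).
  by apply/measurable_EFinP; exact: measurableT_comp.
have mk2 y : measurable_fun setT (fun x => (k (x, y))%:E).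
  by apply/measurable_EFinP; exact: measurableT_comp.
have mF : measurable_fun setT
    (fun z : T * T => ((u z.1 ^+ 2 / 2)%:E * (k z)%:E)%E).
  apply: emeasurable_funM; last exact/measurable_EFinP.
  by apply: (measurableT_comp mh); exact: measurable_fst.
have mG : measurable_fun setT
    (fun z : T * T => ((u z.2 ^+ 2 / 2)%:E * (k z)%:E)%E).
  apply: emeasurable_funM; last exact/measurable_EFinP.
  by apply: (measurableT_comp mh); exact: measurable_snd.
have F0 (z : T * T) : (0 <= (u z.1 ^+ 2 / 2)%:E * (k z)%:E)%E.
  by rewrite mule_ge0// lee_fin.
have G0 (z : T * T) : (0 <= (u z.2 ^+ 2 / 2)%:E * (k z)%:E)%E.
  by rewrite mule_ge0// lee_fin.
have mU : measurable_fun setT (fun z : T * T => (u z.1 * u z.2 * k z)%:E).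
  apply/measurable_EFinP; apply: measurable_funM => //; apply: measurable_funM.
    by apply: (measurableT_comp mu_); exact: measurable_fst.
  by apply: (measurableT_comp mu_); exact: measurable_snd.
have mFG : measurable_fun setT (fun z : T * T =>
    ((u z.1 ^+ 2 / 2)%:E * (k z)%:E + (u z.2 ^+ 2 / 2)%:E * (k z)%:E)%E).
  exact: emeasurable_funD.
have step : (\int[mu]_x \int[mu]_y (u x * u y * k (x, y))%:E <=
    \int[mu \x mu]_z ((u z.1 ^+ 2 / 2)%:E * (k z)%:E + (u z.2 ^+ 2 / 2)%:E * (k z)%:E))%E.
  rewrite -(fubini_tonelli1 (fun z : T * T => (u z.1 * u z.2 * k z)%:E))//.
    apply: ge0_le_integral => //.
      by move=> z _; rewrite lee_fin !mulr_ge0.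
    move=> z _; rewrite -!EFinM -EFinD lee_fin -mulrDl; apply: ler_wpM2r => //.
    by have := sqr_ge0 (u z.1 - u z.2); nra.
  by move=> z; rewrite lee_fin !mulr_ge0.
apply: (le_trans step).
rewrite ge0_integralD//.
rewrite fubini_tonelli1// fubini_tonelli2//.
have bnd (q : T -> T -> R) : (forall x, measurable_fun setT (fun y => (q x y)%:E)) ->
    (forall x y, 0 <= q x y) ->
    (forall x, \int[mu]_y (q x y)%:E <= B%:E)%E ->
    measurable_fun setT (fun x => \int[mu]_y ((u x ^+ 2 / 2)%:E * (q x y)%:E))%E ->
    (\int[mu]_x \int[mu]_y ((u x ^+ 2 / 2)%:E * (q x y)%:E) <=
      B%:E * \int[mu]_x (u x ^+ 2 / 2)%:E)%E.
  move=> mq q0 qB mI.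
  have B0 : (0 <= B%:E)%E.
    by apply: le_trans (qB point); apply: integral_ge0 => y _; rewrite lee_fin.
  rewrite -ge0_integralZl//; apply: ge0_le_integral => //.
  - by move=> x _; apply: integral_ge0 => y _; rewrite mule_ge0// lee_fin.
  - exact: measurable_funeM.
  - move=> x _; rewrite ge0_integralZl//; last by move=> y _; rewrite lee_fin.
    by rewrite muleC; apply: lee_wpmul2r.
have E2 : (\int[mu]_x (u x ^+ 2)%:E =
    \int[mu]_x (u x ^+ 2 / 2)%:E + \int[mu]_x (u x ^+ 2 / 2)%:E)%E.
  rewrite -ge0_integralD//; apply: eq_integral => x _.
  by rewrite -EFinD -splitr.
rewrite E2 ge0_muleDr; [|by apply: integral_ge0..].
apply: leeD.
  apply: (bnd (fun x y => k (x, y))) => //.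
  exact: (measurable_fun_fubini_tonelli_F _ mF F0).
apply: (bnd (fun y x => k (x, y))) => //.
exact: (measurable_fun_fubini_tonelli_G _ mG G0).
Qed.

(** Moving the modulus inside the outer and then the inner integral reduces this to [schur_test] for
    [normc (f x)]. Both moves are legitimate before any integrability is known, since an infinite
    right-hand side is allowed. *)
Lemma schur_test_cint (B : R) (f : T -> R[i]) (K : T * T -> R[i]) (k : T * T -> R) :
  cmeasurable f -> cmeasurable K -> measurable_fun setT k ->
  (forall z, normc (K z) <= k z) ->
  (forall x, \int[mu]_y (k (x, y))%:E <= B%:E)%E ->
  (forall y, \int[mu]_x (k (x, y))%:E <= B%:E)%E ->
  ((normc (cint mu (fun x => f x * cint mu (fun y => cj (f y) * K (x, y)))))%:E <=
   B%:E * \int[mu]_x (normc (f x) ^+ 2)%:E)%E.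
Proof.
move=> mf mK mk Kk kB1 kB2.
have k0 z : 0 <= k z by apply: le_trans (Kk z); exact: normc_ge0.
have mN := measurable_normc mf.
have mc1 x : cmeasurable (fun y => cj (f y) * K (x, y)).
  apply: cmeasurableM; first exact: cmeasurableJ.
  exact: (cmeasurable_comp (pair1_measurable x)).
have mc2 : cmeasurable (fun x => f x * cint mu (fun y => cj (f y) * K (x, y))).
  apply: cmeasurableM; first exact: mf.
  apply: (@cmeasurable_cint2 _ _ _ _ _ mu (fun z => cj (f z.2) * K z)).
  apply: cmeasurableM; last exact: mK.
  by apply: cmeasurableJ; apply: cmeasurable_comp mf; exact: measurable_snd.
apply: (le_trans (normc_cint_le_nint mc2)).
apply: le_trans (schur_test mN mk (fun x => normc_ge0 (f x)) k0 kB1 kB2).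
have mU : measurable_fun setT (fun z : T * T => (normc (f z.1) * normc (f z.2) * k z)%:E).
  apply/measurable_EFinP; apply: measurable_funM; last exact: mk.
  apply: measurable_funM.
    by apply: (measurableT_comp mN); exact: measurable_fst.
  by apply: (measurableT_comp mN); exact: measurable_snd.
have mfk x : measurable_fun setT (fun y => (normc (f y) * k (x, y))%:E).
  apply/measurable_EFinP; apply: measurable_funM; first exact: mN.
  exact: (measurableT_comp mk (pair1_measurable x)).
rewrite /nint; apply: ge0_le_integral; first exact: measurableT.
- by move=> x _; rewrite lee_fin normc_ge0.
- by apply/measurable_EFinP; exact: measurable_normc.
- exact: (measurable_fun_integral2 mu mU).
move=> x _; rewrite Normc.normcM EFinM.
under [leRHS]eq_integral do rewrite -mulrA EFinM.
rewrite ge0_integralZl; last 4 first.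
- exact: measurableT.
- exact: mfk.
- by move=> y _; rewrite lee_fin mulr_ge0 ?normc_ge0.
- by rewrite lee_fin normc_ge0.
apply: lee_wpmul2l; first by rewrite lee_fin normc_ge0.
apply: le_trans (normc_cint_le_nint (mc1 x)) _.
apply: ge0_le_integral; first exact: measurableT.
- by move=> y _; rewrite lee_fin normc_ge0.
- by apply/measurable_EFinP; exact: measurable_normc.
- exact: mfk.
move=> y _; rewrite lee_fin Normc.normcM normcJ.
by apply: ler_wpM2l; [exact: normc_ge0|exact: Kk].
Qed.

End schur_test.

(** * Oscillatory integrals weighted by products of tents *)

Section fourier_kernel.
Context {R : realType} {d : nat}.
Notation V := 'rV[R]_d.
Notation leb := (@lebesgue_measure R).
Notation mu := (@lebesgue_rV R d).
Implicit Types (f g : V -> R[i]) (x y a : V) (s r : R).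

(* [osc (-1) f] is the Fourier transform of [f]; [osc 1 f] is, up to the
   constant, its inverse one. *)
Definition osc s f y : R[i] := cint mu (fun x => f x * expi (s * dotp x y)).

Lemma dotpC x y : dotp x y = dotp y x.
Proof. by apply: eq_bigr => i _; rewrite mulrC. Qed.

Lemma measurable_dotp : measurable_fun setT (fun z : V * V => dotp z.1 z.2).
Proof.
apply: measurable_sum => i; apply: measurable_funM.
  by apply: (measurableT_comp (measurable_coord_rV i)); exact: measurable_fst.
by apply: (measurableT_comp (measurable_coord_rV i)); exact: measurable_snd.
Qed.

Lemma cmeasurable_kernel s :
  cmeasurable (fun z : V * V => expi (s * dotp z.1 z.2)).
Proof.
apply: cmeasurable_expi; apply: measurable_funM => //; exact: measurable_dotp.
Qed.

Lemma cmeasurable_kernel1 s y : cmeasurable (fun x => expi (s * dotp x y)).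
Proof.
exact: (cmeasurable_comp (pair2_measurable y) (cmeasurable_kernel s)).
Qed.

Lemma cintegrable_osc s f y : cintegrable mu f ->
  cintegrable mu (fun x => f x * expi (s * dotp x y)).
Proof.
move=> fi; apply: (@cintegrable_bounded_mul _ _ _ _ 1) => //.
  exact: cmeasurable_kernel1.
by move=> x; rewrite normc_expi.
Qed.

Lemma cmeasurable_osc s f : cmeasurable f -> cmeasurable (osc s f).
Proof.
move=> mf.
have mF : cmeasurable (fun z : V * V => f z.2 * expi (s * dotp z.2 z.1)).
  apply: cmeasurableM.
    by apply: cmeasurable_comp mf; exact: measurable_snd.
  by under eq_fun do rewrite dotpC; exact: cmeasurable_kernel.
exact: (cmeasurable_cint2 mu mF).
Qed.

Lemma osc_le s f y : cintegrable mu f -> normc (osc s f y) <= fine (nint mu f).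
Proof.
move=> fi; have [mf foo] := fi.
rewrite -lee_fin fineK; last by rewrite ge0_fin_numE ?nint_ge0.
apply: le_trans (normc_cint_le (cintegrable_osc s y fi)) _.
rewrite /nint le_eqVlt; apply/orP; left; apply/eqP; apply: eq_integral => x _.
by rewrite Normc.normcM normc_expi mulr1.
Qed.

Definition box a r : set V := [set y | forall i, `|y ord0 i - a ord0 i| <= r].

Lemma boxE a r : box a r =
  [set x | forall i, `[a ord0 i - r, a ord0 i + r]%classic (x ord0 i)].
Proof.
apply/seteqP; split => y /= h i; have := h i.
  by rewrite in_itv/= distrC ler_distlC.
by rewrite in_itv/= -ler_distlC distrC.
Qed.

Lemma measurable_box a r : measurable (box a r).
Proof.
rewrite boxE [X in measurable X](_ : _ = \bigcap_(i in [set: 'I_d])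
    ((fun x : V => x ord0 i) @^-1` `[a ord0 i - r, a ord0 i + r]%classic)); last first.
  by apply/seteqP; split => [x /= Ax i _|x /= Ax i]; [exact: Ax|exact: (Ax i)].
apply: fin_bigcap_measurable => // i _; rewrite -[X in measurable X]setTI.
exact: measurable_coord_rV.
Qed.

Lemma box_measure a r : 0 <= r -> mu (box a r) = ((2 * r) ^+ d)%:E.
Proof.
move=> r0; rewrite boxE (@lebesgue_rV_box R d (fun i => `[a ord0 i - r, a ord0 i + r]%classic))//.
under eq_bigr do rewrite lebesgue_measure_itv/= lte_fin.
rewrite (eq_bigr (fun=> (2 * r)%:E)).
  by rewrite prodEFin prodr_const card_ord.
(* In the second branch the interval has nonpositive length, which forces [r = 0], and both sides
   vanish. *)
move=> i _; have [|] := ltP; first by rewrite -EFinB => _; congr EFin; ring.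
by move=> h; congr EFin; lra.
Qed.

Definition tents a r y : R := \prod_(i < d) tent (a ord0 i) r (y ord0 i).

Lemma tents_ge0 a r y : 0 <= tents a r y.
Proof. by apply: prodr_ge0 => i _; exact: tent_ge0. Qed.

Lemma measurable_tents a r : measurable_fun setT (tents a r).
Proof.
apply: measurable_prod => i _.
by apply: (measurableT_comp (measurable_tent _ _)); exact: measurable_coord_rV.
Qed.

Lemma tents_box a r y : 0 < r -> box a r y -> 2^-1 ^+ d <= tents a r y.
Proof.
move=> r0 ybox; rewrite /tents -[X in _ ^+ X]card_ord -prodr_const.
apply: ler_prod => i _; rewrite invr_ge0 ler0n/=; exact: tent_ge_half.
Qed.

Lemma cintegrable_tents a r : 0 < r -> cintegrable mu (fun y => (tents a r y)%:C).
Proof.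
move=> r0; have [h _] := cint_prod_rV (fun i => cintegrable_tent (a ord0 i) r0).
by under eq_fun do rewrite /tents rmorph_prod.
Qed.

(** The kernel of the quadratic form sending [f] to the weighted integral of
    [normc (osc s f y) ^+ 2]: the transform of the weight at a multiple of [z.1 - z.2], left in the
    form that Fubini's theorem produces. *)
Definition tents_kernel s a r (z : V * V) : R[i] :=
  cint mu (fun y => (tents a r y)%:C * (expi (s * dotp z.1 y) * cj (expi (s * dotp z.2 y)))).

Lemma cmeasurable_tents_kernel s a r : cmeasurable (tents_kernel s a r).
Proof.
apply: (@cmeasurable_cint2 _ _ _ _ _ mu (fun z : (V * V) * V => (tents a r z.2)%:C *
  (expi (s * dotp z.1.1 z.2) * cj (expi (s * dotp z.1.2 z.2))))).
apply: cmeasurableM.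
  apply: cmeasurable_real; apply: (measurableT_comp (measurable_tents a r)).
  exact: measurable_snd.
have mp (p : V * V -> V) : measurable_fun setT p ->
    cmeasurable (fun z : (V * V) * V => expi (s * dotp (p z.1) z.2)).
  move=> mp; apply: (cmeasurable_comp (phi := fun z : (V * V) * V => (p z.1, z.2))
    (f := fun z => expi (s * dotp z.1 z.2))).
    apply/measurable_fun_pairP; split => /=; last exact: measurable_snd.
    by apply: (measurableT_comp mp); exact: measurable_fst.
  exact: cmeasurable_kernel.
apply: cmeasurableM; first by apply: (mp fst); exact: measurable_fst.
by apply: cmeasurableJ; apply: (mp snd); exact: measurable_snd.
Qed.

(** Weight and exponentials factor over the coordinates, so the kernel is a product of transforms of
    one-variable tents. The sign [s] disappears because [cauchy] depends on the square of the
    frequency. *)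
Lemma tents_kernel_le s a r z : s ^+ 2 = 1 -> 0 < r ->
  normc (tents_kernel s a r z) <= \prod_(i < d) cauchy r (z.2 ord0 i) (z.1 ord0 i).
Proof.
move=> s1 r0; pose zeta i := s * (z.1 ord0 i - z.2 ord0 i).
have -> : tents_kernel s a r z = \prod_(i < d)
    cint leb (fun t => (tent (a ord0 i) r t)%:C * expi (zeta i * t)).
  have ib i : cintegrable leb (fun t => (tent (a ord0 i) r t)%:C * expi (zeta i * t)).
    apply: (@cintegrable_bounded_mul _ _ _ _ 1); first exact: cintegrable_tent.
      by apply: cmeasurable_expi; exact: measurable_funM.
    by move=> t; rewrite normc_expi.
  have [_ <-] := cint_prod_rV ib; apply: eq_cint => y.
  rewrite big_split/= /tents rmorph_prod; congr (_ * _).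
  rewrite expiJ -expiD -expi_sum; congr expi.
  rewrite /dotp !mulr_sumr -sumrN -big_split; apply: eq_bigr => i _ /=.
  by rewrite /zeta; ring.
rewrite (_ : normc _ = \prod_(i < d)
    normc (cint leb (fun t => (tent (a ord0 i) r t)%:C * expi (zeta i * t)))); last first.
  by apply: (big_morph _ (@Normc.normcM R) (@Normc.normc1 R)).
apply: ler_prod => i _; rewrite normc_ge0/=.
apply: le_trans (normc_cint_tent_expi_le _ _ r0) _.
rewrite /cauchy subr0 /zeta (_ : (r * (s * _)) ^+ 2 =
  s ^+ 2 * (r * (z.1 ord0 i - z.2 ord0 i)) ^+ 2); last by ring.
by rewrite s1 mul1r.
Qed.

Lemma cauchyC r (t u : R) : cauchy r t u = cauchy r u t.
Proof. by rewrite /cauchy; congr (_ / (_ + _)); ring. Qed.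

Lemma integral_cauchy_rV r x : 0 < r ->
  (\int[mu]_y (\prod_(i < d) cauchy r (x ord0 i) (y ord0 i))%:E <= ((8 * pi) ^+ d)%:E)%E.
Proof.
move=> r0; apply: (@ge0_integral_prod_rV_le R _ d (fun i => cauchy r (x ord0 i))).
- by rewrite mulr_ge0// pi_ge0.
- by move=> i; exact: measurable_cauchy.
- by move=> i t; rewrite cauchy_ge0// ltW.
- by move=> i; rewrite integral_cauchy.
Qed.

(* [T T^*] argument: the weight has an integrable Fourier transform, to which
   the Schur test applies. *)
Lemma weighted_bessel s a r f : s ^+ 2 = 1 -> 0 < r -> cintegrable mu f ->
  (\int[mu]_y (tents a r y * normc (osc s f y) ^+ 2)%:E <=
   ((8 * pi) ^+ d)%:E * sqnormL2 f)%E.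
Proof.
move=> s1 r0 fi; have [mf _] := fi.
have mo := cmeasurable_osc s mf.
have mt : cmeasurable (fun y => (tents a r y)%:C).
  by apply: cmeasurable_real; exact: measurable_tents.
pose g y := (tents a r y)%:C * cj (osc s f y).
have gi : cintegrable mu g.
  apply: (@cintegrable_bounded_mul _ _ _ _ (fine (nint mu f))).
  - exact: cintegrable_tents.
  - exact: cmeasurableJ.
  - by move=> y; rewrite normcJ osc_le.
have goi : cintegrable mu (fun y => g y * osc s f y).
  apply: (@cintegrable_bounded_mul _ _ _ _ (fine (nint mu f))) => //.
  by move=> y; rewrite osc_le.
have gE y : g y * osc s f y = (tents a r y * normc (osc s f y) ^+ 2)%:C.
  by rewrite /g -mulrA (mulrC (cj _)) mulcJ; simpc.
(* Two exchanges of integrals: the first expands the plain factor [osc s f y], the second its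
   conjugate hidden in [g]; the integral over [y] that remains is [tents_kernel]. *)
have J : cint mu (fun y => g y * osc s f y) =
    cint mu (fun x => f x * cint mu (fun x' => cj (f x') * tents_kernel s a r (x, x'))).
  rewrite (cint_swap (M := 1) (e := fun z => expi (s * dotp z.2 z.1)) gi fi); last 2 first.
  - by under eq_fun do rewrite dotpC; exact: cmeasurable_kernel.
  - by move=> z; rewrite normc_expi.
  apply: eq_cint => x; congr (_ * _).
  have ti : cintegrable mu (fun y => (tents a r y)%:C * expi (s * dotp x y)).
    under eq_fun do rewrite dotpC; apply: (@cintegrable_bounded_mul _ _ _ _ 1).
    - exact: cintegrable_tents.
    - exact: cmeasurable_kernel1.
    - by move=> y; rewrite normc_expi.
  transitivity (cint mu (fun y => (tents a r y)%:C * expi (s * dotp x y) *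
      cint mu (fun x' => cj (f x') * cj (expi (s * dotp x' y))))).
    apply: eq_cint => y; rewrite /g -mulrA -mulrA; congr (_ * _).
    rewrite mulrC; congr (_ * _); rewrite /osc -cintJ; last exact: cintegrable_osc.
    by apply: eq_cint => x'; rewrite cjM.
  rewrite (cint_swap (M := 1) (e := fun z => cj (expi (s * dotp z.2 z.1))) ti
      (cintegrableJ fi)); last 2 first.
  - by apply: cmeasurableJ; under eq_fun do rewrite dotpC; exact: cmeasurable_kernel.
  - by move=> z; rewrite normcJ normc_expi.
  by apply: eq_cint => x'; congr (_ * _); apply: eq_cint => y /=; rewrite mulrA.
pose k (z : V * V) := \prod_(i < d) cauchy r (z.2 ord0 i) (z.1 ord0 i).
have mk : measurable_fun setT k.
  apply: measurable_prod => i _.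
  rewrite (_ : (fun z : V * V => _) =
      (fun z : V * V => cauchy r 0 (z.1 ord0 i - z.2 ord0 i))); last first.
    by apply/funext => z; rewrite /cauchy subr0.
  apply: (measurableT_comp (measurable_cauchy r 0)); apply: measurable_funB.
    by apply: (measurableT_comp (measurable_coord_rV i)); exact: measurable_fst.
  by apply: (measurableT_comp (measurable_coord_rV i)); exact: measurable_snd.
apply: (@le_trans _ _ (normc (cint mu (fun y => g y * osc s f y)))%:E).
  have gF : (fun y => g y * osc s f y) =
      (fun y => (tents a r y * normc (osc s f y) ^+ 2)%:C).
    by apply/funext => y; exact: gE.
  rewrite gF integral_cint_real; last by rewrite -gF.
  by rewrite lee_fin; apply: le_trans (ler_norm _) _; exact: Re_le_normc.
rewrite J; apply: (schur_test_cint (k := k) mf (cmeasurable_tents_kernel s a r) mk).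
- by move=> z; exact: tents_kernel_le.
- move=> x; apply: le_trans (integral_cauchy_rV x r0).
  rewrite le_eqVlt; apply/orP; left; apply/eqP; apply: eq_integral => y _.
  by congr EFin; apply: eq_bigr => i _; exact: cauchyC.
- by move=> y; exact: integral_cauchy_rV.
Qed.

End fourier_kernel.

(** * Square-integrable functions *)

Section square_integrable.
Context {R : realType} {d : nat}.
Notation V := 'rV[R]_d.
Notation mu := (@lebesgue_rV R d).
Implicit Types (f g h : V -> R[i]) (x y a : V) (s r : R).

Lemma L2_cmeasurable f : L2 f -> cmeasurable f.
Proof. by case. Qed.

Lemma measurable_normc_sq f : cmeasurable f ->
  measurable_fun setT (fun x => (normc (f x) ^+ 2)%:E).
Proof.
by move=> mf; apply/measurable_EFinP; apply: measurable_funX; exact: measurable_normc.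
Qed.

Lemma sqnormL2_ge0 f : (0 <= sqnormL2 f)%E.
Proof. by apply: integral_ge0 => x _; rewrite lee_fin sqr_ge0. Qed.

Lemma sqnormL2_fin f : L2 f -> sqnormL2 f \is a fin_num.
Proof. by case=> _ _ foo; rewrite ge0_fin_numE// sqnormL2_ge0. Qed.

Lemma ae_le_sqnormL2 f g : cmeasurable f -> cmeasurable g ->
  {ae mu, forall x, normc (f x) <= normc (g x)} -> (sqnormL2 f <= sqnormL2 g)%E.
Proof.
move=> mf mg fg; apply: ae_ge0_le_integral.
- exact: measurableT.
- by move=> x _; rewrite lee_fin sqr_ge0.
- exact: measurable_normc_sq.
- by move=> x _; rewrite lee_fin sqr_ge0.
- exact: measurable_normc_sq.
- apply: filterS fg => x fgx _.
  by rewrite lee_fin ler_pXn2r ?nnegrE ?normc_ge0.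
Qed.

Lemma le_sqnormL2 f g : cmeasurable f -> cmeasurable g ->
  (forall x, normc (f x) <= normc (g x)) -> (sqnormL2 f <= sqnormL2 g)%E.
Proof. by move=> mf mg fg; apply: ae_le_sqnormL2 => //; exact: nearW. Qed.

Lemma sqnormL2_comb (a b : R) f g : 0 <= a -> 0 <= b ->
  cmeasurable f -> cmeasurable g ->
  (a%:E * sqnormL2 f + b%:E * sqnormL2 g =
   \int[mu]_x (a * normc (f x) ^+ 2 + b * normc (g x) ^+ 2)%:E)%E.
Proof.
move=> a0 b0 mf mg.
have mf2 := measurable_normc_sq mf; have mg2 := measurable_normc_sq mg.
have p0 h x : (0 <= (normc (h x) ^+ 2)%:E)%E by rewrite lee_fin sqr_ge0.
have Z (c : R) h : 0 <= c -> cmeasurable h -> (c%:E * sqnormL2 h =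
    \int[mu]_x (c%:E * (normc (h x) ^+ 2)%:E))%E.
  by move=> c0 mh; rewrite ge0_integralZl//; exact: measurable_normc_sq.
rewrite !Z// -ge0_integralD.
- by apply: eq_integral => x _.
- exact: measurableT.
- by move=> x _; rewrite mule_ge0// lee_fin.
- exact: measurable_funeM.
- by move=> x _; rewrite mule_ge0// lee_fin.
- exact: measurable_funeM.
Qed.

Lemma measurable_normc_sq_comb (a b : R) f g : cmeasurable f -> cmeasurable g ->
  measurable_fun setT (fun x => (a * normc (f x) ^+ 2 + b * normc (g x) ^+ 2)%:E).
Proof.
move=> mf mg; apply/measurable_EFinP.
by apply: measurable_funD; apply: measurable_funM => //;
  apply: measurable_funX; exact: measurable_normc.
Qed.

(** A replacement for the triangle inequality. Its factor 2 is the one found later in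
    [fourierL2_bessel] and in the uniform bound on the eigenvalues. *)
Lemma sqnormL2D f g : cmeasurable f -> cmeasurable g ->
  (sqnormL2 (fun x => (f x + g x)%R) <= 2%:E * sqnormL2 f + 2%:E * sqnormL2 g)%E.
Proof.
move=> mf mg; rewrite sqnormL2_comb//; apply: ge0_le_integral.
- exact: measurableT.
- by move=> x _; rewrite lee_fin sqr_ge0.
- by apply: measurable_normc_sq; exact: cmeasurableD.
- exact: measurable_normc_sq_comb.
move=> x _; rewrite lee_fin.
have h1 := le_normcD (f x) (g x); have h0 := normc_ge0 (f x + g x).
have h2 := sqr_ge0 (normc (f x) - normc (g x)).
apply: (@le_trans _ _ ((normc (f x) + normc (g x)) ^+ 2)); last by nra.
by rewrite ler_pXn2r ?nnegrE// addr_ge0 ?normc_ge0.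
Qed.

Lemma sqnormL2Z (c : R[i]) f : cmeasurable f ->
  sqnormL2 (fun x => c * f x) = ((normc c ^+ 2)%:E * sqnormL2 f)%E.
Proof.
move=> mf; rewrite /sqnormL2.
under eq_integral do rewrite Normc.normcM exprMn EFinM.
rewrite ge0_integralZl//.
- exact: measurable_normc_sq.
- by move=> x _; rewrite lee_fin sqr_ge0.
- by rewrite lee_fin sqr_ge0.
Qed.

Lemma L2_mk f : cmeasurable f -> (sqnormL2 f < +oo)%E -> L2 f.
Proof. by move=> [? ?] ?. Qed.

Lemma L2_lty f : L2 f -> (sqnormL2 f < +oo)%E.
Proof. by case. Qed.

Lemma L2D f g : L2 f -> L2 g -> L2 (fun x => f x + g x).
Proof.
move=> fL gL; have mf := L2_cmeasurable fL; have mg := L2_cmeasurable gL.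
apply: L2_mk; first exact: cmeasurableD.
apply: le_lt_trans (sqnormL2D mf mg) _.
by rewrite lte_add_pinfty// lte_mul_pinfty// L2_lty.
Qed.

Lemma L2Z (c : R[i]) f : L2 f -> L2 (fun x => c * f x).
Proof.
move=> fL; have mf := L2_cmeasurable fL; apply: L2_mk.
  by apply: cmeasurableM => //; exact: cmeasurable_cst.
by rewrite sqnormL2Z// lte_mul_pinfty ?lee_fin ?sqr_ge0// L2_lty.
Qed.

Lemma L2B f g : L2 f -> L2 g -> L2 (fun x => f x - g x).
Proof.
move=> fL gL; under eq_fun do rewrite -mulN1r.
by apply: L2D => //; exact: L2Z.
Qed.

Lemma L2_0 : L2 (fun _ : V => 0 : R[i]).
Proof.
apply: L2_mk; first exact: cmeasurable_cst.
rewrite /sqnormL2; under eq_integral do rewrite Normc.normc0 expr0n/=.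
by rewrite integral0 ltry.
Qed.

Lemma L2_sum n (F : 'I_n -> V -> R[i]) : (forall i, L2 (F i)) ->
  L2 (fun x => \sum_(i < n) F i x).
Proof.
elim: n F => [|n IH] F LF; first by under eq_fun do rewrite big_ord0; exact: L2_0.
by under eq_fun do rewrite big_ord_recl; apply: L2D => //; exact: IH.
Qed.

Lemma cmeasurable_chi_mul (Q : set V) f : measurable Q -> cmeasurable f ->
  cmeasurable (chi_mul Q f).
Proof.
move=> mQ mf; apply: cmeasurableM => //; apply: cmeasurable_real.
exact: measurable_indic.
Qed.

Lemma normc_chi_mul_le (Q : set V) f x : normc (chi_mul Q f x) <= normc (f x).
Proof.
rewrite /chi_mul Normc.normcM normcR ger0_norm ?indicE ?ler0n//.
by rewrite ler_piMl ?normc_ge0//; case: (_ \in _).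
Qed.

Lemma L2_chi_mul (Q : set V) f : measurable Q -> L2 f -> L2 (chi_mul Q f).
Proof.
move=> mQ fL; have mf := L2_cmeasurable fL.
apply: L2_mk; first exact: cmeasurable_chi_mul.
apply: le_lt_trans (L2_lty fL); apply: le_sqnormL2 => //.
  exact: cmeasurable_chi_mul.
by move=> x; exact: normc_chi_mul_le.
Qed.

(** The best choice is [e = c / a]. If [a = 0], then [e = (b + 1) / c] makes the right-hand side
    smaller than [c], which is absurd for positive [c]. *)
Let cs_real (a b c : R) : 0 <= a -> 0 <= b -> 0 <= c ->
  (forall e, 0 < e -> 2 * c <= e * a + b / e) -> c ^+ 2 <= a * b.
Proof.
move=> a0 b0 c0 h.
have [->|cn0] := eqVneq c 0; first by rewrite expr0n mulr_ge0.
have c1 : 0 < c by rewrite lt_neqAle eq_sym cn0.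
have [a1|an0] := eqVneq a 0.
  have e0 : 0 < (b + 1) / c by rewrite divr_gt0// ltr_wpDl.
  have := h _ e0; rewrite a1 mulr0 add0r invf_div mulrA ler_pdivlMr ?ltr_wpDl//.
  by move=> H; exfalso; nra.
have a1 : 0 < a by rewrite lt_neqAle eq_sym an0.
have := h _ (divr_gt0 c1 a1).
rewrite -mulrA mulVf// mulr1 invf_div mulrA => H.
have : c <= b * a / c by lra.
by rewrite ler_pdivlMr// => H2; rewrite expr2 mulrC (mulrC a).
Qed.

(** Integrating [2 * u * v <= e * u ^+ 2 + v ^+ 2 / e] handles everything: [e = 1] yields
    integrability, and optimising over [e] the inequality, without normalising [f] or [g]. *)
Lemma cauchy_schwarz f g : L2 f -> L2 g ->
  cintegrable mu (fun x => f x * g x) /\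
  fine (nint mu (fun x => f x * g x)) ^+ 2 <= fine (sqnormL2 f) * fine (sqnormL2 g).
Proof.
move=> fL gL; have mf := L2_cmeasurable fL; have mg := L2_cmeasurable gL.
have key (e : R) : 0 < e -> (2%:E * nint mu (fun x => (f x * g x)%R) <=
    e%:E * sqnormL2 f + e^-1%:E * sqnormL2 g)%E.
  move=> e0; have ei0 : 0 < e^-1 by rewrite invr_gt0.
  rewrite /nint -ge0_integralZl; last 4 first.
  - exact: measurableT.
  - by apply/measurable_EFinP; apply: measurable_normc; exact: cmeasurableM.
  - by move=> x _; rewrite lee_fin normc_ge0.
  - by rewrite lee_fin.
  rewrite (sqnormL2_comb (ltW e0) (ltW ei0) mf mg); apply: ge0_le_integral.
  - exact: measurableT.
  - by move=> x _; rewrite mule_ge0// lee_fin normc_ge0.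
  - apply: measurable_funeM; apply/measurable_EFinP; apply: measurable_normc.
    exact: cmeasurableM.
  - exact: measurable_normc_sq_comb.
  move=> x _; rewrite -EFinM lee_fin Normc.normcM.
  set u := normc _; set v := normc _.
  rewrite -subr_ge0 (_ : _ - _ = e * (u - e^-1 * v) ^+ 2).
    by rewrite mulr_ge0 ?sqr_ge0// ltW.
  by field; rewrite gt_eqF.
have fin : (nint mu (fun x => (f x * g x)%R) < +oo)%E.
  have := key 1 ltr01; rewrite invr1 !mul1e => h.
  have : (2%:E * nint mu (fun x => (f x * g x)%R) < +oo)%E.
    by apply: le_lt_trans h _; rewrite lte_add_pinfty// L2_lty.
  apply: le_lt_trans; rewrite -[leLHS]mul1e; apply: lee_wpmul2r; first exact: nint_ge0.
  by rewrite lee_fin ler1n.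
split; first by split => //; exact: cmeasurableM.
apply: cs_real; rewrite ?fine_ge0 ?sqnormL2_ge0 ?nint_ge0// => e e0.
rewrite -lee_fin; have := key e e0.
rewrite -[X in (_ * X <= _)%E]fineK; last by rewrite ge0_fin_numE ?nint_ge0.
by rewrite -(fineK (sqnormL2_fin fL)) -(fineK (sqnormL2_fin gL)) -!EFinM -EFinD mulrC (mulrC _^-1).
Qed.

Definition ip f g : R[i] := cint mu (fun x => f x * cj (g x)).

Lemma L2J f : L2 f -> L2 (fun x => cj (f x)).
Proof.
move=> fL; apply: L2_mk; first by apply: cmeasurableJ; exact: L2_cmeasurable.
by rewrite /sqnormL2; under eq_integral do rewrite normcJ; exact: L2_lty.
Qed.

Lemma cintegrable_ip f g : L2 f -> L2 g -> cintegrable mu (fun x => f x * cj (g x)).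
Proof. by move=> fL gL; have [] := cauchy_schwarz fL (L2J gL). Qed.

Lemma normc_ip_le f g : L2 f -> L2 g ->
  normc (ip f g) ^+ 2 <= fine (sqnormL2 f) * fine (sqnormL2 g).
Proof.
move=> fL gL; have [ifg] := cauchy_schwarz fL (L2J gL).
have -> : sqnormL2 (fun x => cj (g x)) = sqnormL2 g.
  by rewrite /sqnormL2; under eq_integral do rewrite normcJ.
apply: le_trans; rewrite ler_pXn2r ?nnegrE ?normc_ge0 ?fine_ge0 ?nint_ge0//.
rewrite -lee_fin fineK; last by rewrite ge0_fin_numE ?nint_ge0//; case: ifg.
exact: normc_cint_le.
Qed.

Lemma ipJ f g : L2 f -> L2 g -> ip g f = cj (ip f g).
Proof.
move=> fL gL; rewrite /ip -cintJ; last exact: cintegrable_ip.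
by apply: eq_cint => x; rewrite cjM cjK mulrC.
Qed.

Lemma ip_self f : L2 f -> ip f f = (fine (sqnormL2 f))%:C.
Proof.
move=> fL; rewrite /ip /sqnormL2.
rewrite (_ : (fun x => _) = (fun x => (normc (f x) ^+ 2)%:C)); last first.
  by apply/funext => x; rewrite mulcJ.
by rewrite /cint /= Rintegral_cst// mul0r.
Qed.

Lemma ipZl (c : R[i]) f g : L2 f -> L2 g -> ip (fun x => c * f x) g = c * ip f g.
Proof.
move=> fL gL; rewrite /ip -cintZ; last exact: cintegrable_ip.
by apply: eq_cint => x; rewrite mulrA.
Qed.

Lemma ip_sum n (F G : 'I_n -> V -> R[i]) : (forall i, L2 (F i)) ->
  (forall i, L2 (G i)) ->
  ip (fun x => \sum_(i < n) F i x) (fun x => \sum_(i < n) G i x) =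
  \sum_(i < n) \sum_(j < n) ip (F i) (G j).
Proof.
move=> FL GL; rewrite /ip.
under [RHS]eq_bigr => i _.
  rewrite -cint_sum; last by move=> j; exact: cintegrable_ip.
  over.
rewrite -cint_sum; last by move=> i; apply: cintegrable_sum => j; exact: cintegrable_ip.
apply: eq_cint => x; rewrite cj_sum mulr_suml; apply: eq_bigr => i _.
by rewrite mulr_sumr.
Qed.

Lemma sqnormL2_eq0 f : cmeasurable f -> sqnormL2 f = 0%E ->
  {ae mu, forall x, f x = 0}.
Proof.
move=> mf f0; have mf2 := measurable_normc_sq mf.
have /(ae_eq_integral_abs mu measurableT mf2) : (\int[mu]_x `|(normc (f x) ^+ 2)%:E| = 0)%E.
  by under eq_integral do rewrite gee0_abs ?lee_fin ?sqr_ge0//.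
apply: filterS => x /(_ I)[] /eqP; rewrite sqrf_eq0 => /eqP; exact: Normc.eq0_normc.
Qed.

End square_integrable.

(** * The local Bessel bound, truncations, and linearity of the Fourier transform *)

Section fourier_L2.
Context {R : realType} {d : nat}.
Notation V := 'rV[R]_d.
Notation mu := (@lebesgue_rV R d).
Implicit Types (f g h : V -> R[i]) (x y a : V) (s r : R).

(** In each coordinate [8 * pi] is the integral of [cauchy], and the remaining 2 is lost because the
    tent is only at least 1/2 on the box. *)
Definition bessel : R := (16 * pi) ^+ d.

Lemma bessel_gt0 : 0 < bessel.
Proof. by rewrite exprn_gt0// mulr_gt0// pi_gt0. Qed.

(** The weight of [weighted_bessel] is at least [2^-d] on the box. Neither the centre nor the radius
    enters the constant, which is how the final constant comes to depend on [d] alone. *)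
Lemma local_bessel s a r f : s ^+ 2 = 1 -> 0 < r -> cintegrable mu f ->
  (sqnormL2 (chi_mul (box a r) (osc s f)) <= bessel%:E * sqnormL2 f)%E.
Proof.
move=> s1 r0 fi; have [mf _] := fi; have mo := cmeasurable_osc s mf.
have mN := measurable_normc mo.
have -> : bessel = 2 ^+ d * (8 * pi) ^+ d by rewrite -exprMn mulrA -natrM.
rewrite EFinM -muleA.
apply: (@le_trans _ _ ((2 ^+ d)%:E *
    \int[mu]_y (tents a r y * normc (osc s f y) ^+ 2)%:E)%E); last first.
  by apply: lee_wpmul2l; [rewrite lee_fin exprn_ge0|exact: weighted_bessel].
have mw : measurable_fun setT (fun y => (tents a r y * normc (osc s f y) ^+ 2)%:E).
  apply/measurable_EFinP; apply: measurable_funM; first exact: measurable_tents.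
  exact: measurable_funX.
rewrite -ge0_integralZl; last 4 first.
- exact: measurableT.
- exact: mw.
- by move=> y _; rewrite lee_fin mulr_ge0 ?tents_ge0// sqr_ge0.
- by rewrite lee_fin exprn_ge0.
apply: ge0_le_integral.
- exact: measurableT.
- by move=> y _; rewrite lee_fin sqr_ge0.
- by apply: measurable_normc_sq; apply: cmeasurable_chi_mul => //; exact: measurable_box.
- exact: measurable_funeM.
move=> y _; rewrite -EFinM lee_fin /chi_mul Normc.normcM normcR indicE.
have [yb|_] := boolP (y \in box a r); last first.
  rewrite normr0 mul0r expr0n/= mulr_ge0 ?exprn_ge0//.
  by rewrite mulr_ge0 ?tents_ge0// sqr_ge0.
rewrite normr1 mul1r mulrA; apply: ler_peMl; first exact: sqr_ge0.
rewrite -ler_pdivrMl ?exprn_gt0// mulr1 -exprVn.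
by apply: tents_box => //; exact: set_mem.
Qed.

Lemma normr_rV_le x r : 0 <= r -> (`|x| <= r) = [forall i, `|x ord0 i| <= r].
Proof.
move=> r0; rewrite [X in X <= _]/Num.norm/= mx_normrE.
apply/bigmax_leP/forallP => [[_ h] i|h].
  exact: (h (ord0, i) isT).
by split => // -[i j] _ /=; rewrite (ord1 i).
Qed.

Lemma closed_ball_boxE (n : nat) : [set x : V | `|x| <= n%:R] = box 0 n%:R.
Proof.
apply/seteqP; split => x /=; rewrite normr_rV_le//.
  by move=> /forallP h i; have := h i; rewrite mxE subr0.
by move=> h; apply/forallP => i; have := h i; rewrite mxE subr0.
Qed.

Lemma cutoffE f n : cutoff f n = chi_mul (box 0 n%:R) f.
Proof. by rewrite /cutoff closed_ball_boxE. Qed.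

Lemma L2_cutoff f n : L2 f -> L2 (cutoff f n).
Proof. by move=> fL; rewrite cutoffE; apply: L2_chi_mul => //; exact: measurable_box. Qed.

(** Cauchy-Schwarz against the indicator of the box. Support in a set is expressed, here and below,
    by the equation [chi_mul A f = f]. *)
Lemma cintegrable_box a r f : 0 <= r -> L2 f -> chi_mul (box a r) f = f ->
  cintegrable mu f /\
  fine (nint mu f) ^+ 2 <= (2 * r) ^+ d * fine (sqnormL2 f).
Proof.
move=> r0 fL fE; have mf := L2_cmeasurable fL.
pose e (x : V) : R[i] := (\1_(box a r) x)%:C.
have me : cmeasurable e.
  by apply: cmeasurable_real; apply: measurable_indic; exact: measurable_box.
have sqe : sqnormL2 e = ((2 * r) ^+ d)%:E.
  rewrite -(box_measure a r0).
  have <- : (\int[mu]_x (\1_(box a r) x)%:E = mu (box a r))%E.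
    by rewrite integral_indic ?setIT//; exact: measurable_box.
  apply: eq_integral => x _; rewrite /e normcR indicE.
  by case: (_ \in _); rewrite ?normr1 ?normr0 ?expr1n ?expr0n.
have eL : L2 e by apply: L2_mk => //; rewrite sqe ltry.
have [h1 h2] := cauchy_schwarz eL fL.
have E : (fun x => e x * f x) = f by rewrite -[RHS]fE.
by rewrite E in h1 h2; rewrite sqe in h2.
Qed.

Lemma cintegrable_cutoff f n : L2 f -> cintegrable mu (cutoff f n).
Proof.
move=> fL; have := @cintegrable_box 0 n%:R (cutoff f n) (ler0n _ _) (L2_cutoff n fL).
case=> //; rewrite cutoffE; apply/funext => x; rewrite /chi_mul mulrA -rmorphM/=.
by rewrite indicE; case: (_ \in _); rewrite ?mulr1 ?mulr0.
Qed.

Lemma fourierE f : fourier f = osc (-1) f.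
Proof. by apply/funext => y; apply: eq_cint => x; rewrite mulN1r. Qed.

Definition invk : R := (2 * pi) ^- d.

Lemma invk_gt0 : 0 < invk.
Proof. by rewrite invr_gt0 exprn_gt0// mulr_gt0// pi_gt0. Qed.

Lemma inv_fourierE f : inv_fourier f = (fun x => invk%:C * osc 1 f x).
Proof.
apply/funext => x; rewrite /inv_fourier; congr (_ * _).
by apply: eq_cint => y; rewrite mul1r dotpC.
Qed.

Lemma cvgL2P (u_ : nat -> V -> R[i]) g : cvgL2 u_ g <->
  (forall e : R, 0 < e -> exists N, forall n, (N <= n)%N ->
    (sqnormL2 (fun x => (u_ n x - g x)%R) < e%:E)%E).
Proof.
split=> [|h].
  move=> /fine_cvgP[fin /cvgrPdist_lt cv] e e0; have := cv _ e0.
  move=> {}cv; have [N _ H] : \forall n \near \oo,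
      (sqnormL2 (fun x => (u_ n x - g x)%R) < e%:E)%E.
    near=> n; have fn : sqnormL2 (fun x => u_ n x - g x) \is a fin_num by near: n.
    rewrite -(fineK fn) lte_fin.
    have : `|0 - fine (sqnormL2 (fun x => u_ n x - g x))| < e by near: n.
    by rewrite sub0r normrN ger0_norm// fine_ge0// sqnormL2_ge0.
  by exists N => n Nn; exact: H.
apply/fine_cvgP; split.
  have [N H] := h 1 ltr01; exists N => // n /= /H {}H.
  by rewrite ge0_fin_numE ?sqnormL2_ge0//; apply: lt_trans H _; rewrite ltry.
apply/cvgrPdist_lt => e e0; have [N H] := h e e0; exists N => // n /= /H {}H.
rewrite sub0r normrN ger0_norm; last by rewrite fine_ge0// sqnormL2_ge0.
rewrite -lte_fin fineK// ge0_fin_numE ?sqnormL2_ge0//.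
by apply: lt_trans H _; rewrite ltry.
Unshelve. all: by end_near. Qed.

(** At each point the difference is [0] or [- f x], and it is eventually [0]; dominated convergence
    applies with [normc (f x) ^+ 2] as dominating function. *)
Lemma cvgL2_cutoff f : L2 f -> cvgL2 (cutoff f) f.
Proof.
move=> fL; have mf := L2_cmeasurable fL.
have mc n : cmeasurable (fun x => cutoff f n x - f x).
  by apply: cmeasurableB => //; exact: L2_cmeasurable (L2_cutoff n fL).
rewrite /cvgL2 (_ : 0%E = \int[mu]_x (cst 0%E x))%E; last by rewrite integral0.
have [] // := @dominated_convergence _ _ _ mu setT measurableT
  (fun n x => (normc (cutoff f n x - f x) ^+ 2)%:E) (cst 0%E)
  (fun x => (normc (f x) ^+ 2)%:E) _ _ _ _ _.
- by move=> n; exact: measurable_normc_sq.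
- apply: nearW => x _; apply: cvg_near_cst; near=> n.
  have xn : `|x| <= n%:R by near: n; exact: nbhs_infty_ger.
  rewrite /cutoff /chi_mul indicE mem_set// mul1r subrr Normc.normc0 expr0n//.
- apply/integrableP; split; first exact: measurable_normc_sq.
  under eq_integral do rewrite gee0_abs ?lee_fin ?sqr_ge0//.
  exact: L2_lty.
- apply: nearW => x n _; rewrite gee0_abs ?lee_fin ?sqr_ge0//.
  rewrite ler_pXn2r ?nnegrE ?normc_ge0// /cutoff /chi_mul indicE.
  case: (_ \in _); first by rewrite mul1r subrr Normc.normc0 normc_ge0.
  by rewrite mul0r sub0r normcN.
Unshelve. all: by end_near. Qed.

Lemma fourierL2D f f' g g' : fourierL2 f g -> fourierL2 f' g' ->
  fourierL2 (fun x => f x + f' x) (fun x => g x + g' x).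
Proof.
move=> [fL gL /cvgL2P cv] [fL' gL' /cvgL2P cv']; split; [exact: L2D..|].
have mF n h : L2 h -> cmeasurable (fourier (cutoff h n)).
  by move=> hL; rewrite fourierE; apply: cmeasurable_osc; case: (cintegrable_cutoff n hL).
apply/cvgL2P => e e0; have e4 : 0 < e / 4 by rewrite divr_gt0.
have [N HN] := cv _ e4; have [N' HN'] := cv' _ e4.
exists (maxn N N') => n; rewrite geq_max => /andP[/HN H /HN' H'].
rewrite (_ : (fun x => _) = (fun x => (fourier (cutoff f n) x - g x) +
    (fourier (cutoff f' n) x - g' x))); last first.
  apply/funext => x; rewrite addrACA -opprD; congr (_ - _).
  rewrite !fourierE /osc -cintD; [|exact: cintegrable_osc (cintegrable_cutoff _ _)..].
  by apply: eq_cint => y; rewrite /cutoff /chi_mul; ring.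
have mB h k : L2 h -> L2 k -> cmeasurable (fun x => fourier (cutoff h n) x - k x).
  by move=> hL kL; apply: cmeasurableB; [exact: mF|exact: L2_cmeasurable].
apply: le_lt_trans (sqnormL2D (mB _ _ fL gL) (mB _ _ fL' gL')) _.
have -> : e%:E = (2%:E * (e / 4)%:E + 2%:E * (e / 4)%:E)%E.
  by rewrite -!EFinM -EFinD; congr EFin; field.
by rewrite lteD// lte_pmul2l// lte_fin.
Qed.

Lemma fourierL2Z (c : R[i]) f g : fourierL2 f g ->
  fourierL2 (fun x => c * f x) (fun x => c * g x).
Proof.
move=> [fL gL /cvgL2P cv]; split; [exact: L2Z..|].
have mF n h : L2 h -> cmeasurable (fourier (cutoff h n)).
  by move=> hL; rewrite fourierE; apply: cmeasurable_osc; case: (cintegrable_cutoff n hL).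
(* The added 1 covers the case [c = 0] in the quotient below. *)
have c0 : 0 < normc c ^+ 2 + 1 by rewrite ltr_wpDl// sqr_ge0.
apply/cvgL2P => e e0; have e4 : 0 < e / (normc c ^+ 2 + 1) by rewrite divr_gt0.
have [N HN] := cv _ e4; exists N => n /HN H.
rewrite (_ : (fun x => _) = (fun x => c * (fourier (cutoff f n) x - g x))); last first.
  apply/funext => x; rewrite mulrBr; congr (_ - _).
  rewrite !fourierE /osc -cintZ; last exact: cintegrable_osc (cintegrable_cutoff _ _).
  by apply: eq_cint => y; rewrite /cutoff /chi_mul; ring.
rewrite sqnormL2Z; last by apply: cmeasurableB; [exact: mF|exact: L2_cmeasurable].
have fin : sqnormL2 (fun x => fourier (cutoff f n) x - g x) \is a fin_num.
  by rewrite ge0_fin_numE ?sqnormL2_ge0//; apply: lt_trans H _; rewrite ltry.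
move: H; rewrite -(fineK fin) -EFinM !lte_fin ltr_pdivlMr// => H.
apply: le_lt_trans H; rewrite mulrC; apply: ler_wpM2l.
  by rewrite fine_ge0 ?sqnormL2_ge0.
by rewrite lerDl.
Qed.

Lemma fourierL2_0 : fourierL2 (fun _ : V => 0) (fun _ => 0).
Proof.
split; [exact: L2_0..|]; apply/cvgL2P => e e0; exists 0%N => n _.
rewrite (_ : (fun x => _) = (fun _ : V => 0)).
  by rewrite /sqnormL2; under eq_integral do rewrite Normc.normc0 expr0n/=;
    rewrite integral0 lte_fin.
apply/funext => x; rewrite subr0 fourierE /osc.
rewrite (_ : (fun y => _) = (fun _ : V => 0)); last first.
  by apply/funext => y; rewrite /cutoff /chi_mul mulr0 mul0r.
by rewrite /cint /= Rintegral_cst// mul0r.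
Qed.

Lemma fourierL2_sum n (c : 'I_n -> R[i]) (F G : 'I_n -> V -> R[i]) :
  (forall i, fourierL2 (F i) (G i)) ->
  fourierL2 (fun x => \sum_(i < n) c i * F i x) (fun x => \sum_(i < n) c i * G i x).
Proof.
elim: n c F G => [|n IH] c F G FG.
  under eq_fun do rewrite big_ord0; under [X in fourierL2 _ X]eq_fun do rewrite big_ord0.
  exact: fourierL2_0.
under eq_fun do rewrite big_ord_recl.
under [X in fourierL2 _ X]eq_fun do rewrite big_ord_recl.
by apply: fourierL2D; [exact: fourierL2Z|exact: IH].
Qed.

End fourier_L2.

(** * Adjointness *)

Section adjoint.
Context {R : realType} {d : nat}.
Notation V := 'rV[R]_d.
Notation mu := (@lebesgue_rV R d).
Notation invk := (@invk R d).
Implicit Types (f g h G u w : V -> R[i]) (x y a : V) (r : R).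

Lemma chi_mul_box_box a r (S : set V) g : S `<=` box a r ->
  chi_mul (box a r) (chi_mul S g) = chi_mul S g.
Proof.
move=> SB; apply/funext => x; rewrite /chi_mul !indicE.
have [xS|_] := boolP (x \in S); last by rewrite mul0r mulr0.
by rewrite (mem_set (SB _ (set_mem xS))) mul1r.
Qed.

(** The truncations of a function supported in a box are eventually the function itself, so the
    sequence defining the inverse transform is eventually constant and its limit is an integral. *)
Lemma inv_fourierL2_box a r G h : inv_fourierL2 G h -> chi_mul (box a r) G = G ->
  0 <= r -> {ae mu, forall x, h x = invk%:C * osc 1 G x}.
Proof.
move=> [GL hL /cvgL2P cv] GE r0.
have [iG _] := cintegrable_box r0 GL GE.
have [N HN] : exists N : nat, forall n, (N <= n)%N -> cutoff G n = G.
  have [N0 N0P] : exists N : nat, `|a| + r <= N%:R.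
    exists (Num.bound (`|a| + r)).
    by apply: ltW; apply: archi_boundP; rewrite addr_ge0.
  exists N0 => n N0n; rewrite cutoffE -[in LHS]GE chi_mul_box_box// => x /= xB i.
  rewrite mxE subr0; apply: le_trans (_ : `|x ord0 i - a ord0 i| + `|a ord0 i| <= _).
    by rewrite -[X in `|X| <= _](subrK (a ord0 i)); exact: ler_normD.
  have an : `|a ord0 i| <= `|a| by have := normr_rV_le a (normr_ge0 a); rewrite lexx => /esym/forallP; exact.
  have Nn : N0%:R <= n%:R :> R by rewrite ler_nat.
  by have := xB i; lra.
have mo : cmeasurable (inv_fourier G).
  rewrite inv_fourierE; apply: cmeasurableM; first exact: cmeasurable_cst.
  by apply: cmeasurable_osc; case: iG.
have sq0 : sqnormL2 (fun x => inv_fourier G x - h x) = 0%E.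
  apply/eqP; rewrite eq_le sqnormL2_ge0 andbT; apply/lee_addgt0Pr => e e0.
  have [M HM] := cv _ e0; rewrite add0e; apply: ltW.
  by have := HM (maxn M N) (leq_maxl _ _); rewrite HN// leq_maxr.
have mB : cmeasurable (fun x => inv_fourier G x - h x).
  by apply: cmeasurableB => //; exact: L2_cmeasurable.
apply: filterS (sqnormL2_eq0 mB sq0) => x.
by rewrite inv_fourierE => /eqP; rewrite subr_eq0 => /eqP ->.
Qed.

(** For truncations of [f] this is Fubini's theorem, as [cutoff f n] and [G] are integrable. Both
    sides are continuous for the [L^2] norm by Cauchy-Schwarz, which gives the general case. *)
Lemma fourier_adjoint a r f g G h : fourierL2 f g -> inv_fourierL2 G h ->
  chi_mul (box a r) G = G -> 0 <= r -> ip f h = invk%:C * ip g G.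
Proof.
move=> [fL gL /cvgL2P cv] iGh GE r0.
have [GL hL _] := iGh; have hE := inv_fourierL2_box iGh GE r0.
have [iG _] := cintegrable_box r0 GL GE.
have mG := L2_cmeasurable GL.
have step n : ip (cutoff f n) h = invk%:C * cint mu (fun y => fourier (cutoff f n) y * cj (G y)).
  have fnL := L2_cutoff n fL; have ifn := cintegrable_cutoff n fL.
  transitivity (cint mu (fun x => invk%:C * (cutoff f n x *
      cint mu (fun y => cj (G y) * expi (- dotp x y))))).
    have [mp _] := cintegrable_ip fnL hL.
    apply: ae_eq_cint => //.
      apply: cmeasurableM; first exact: cmeasurable_cst.
      apply: cmeasurableM; first exact: L2_cmeasurable fnL.
      have := cmeasurable_osc (-1) (cmeasurableJ mG); rewrite /osc.
      by under eq_fun => y do under eq_fun => x do rewrite mulN1r dotpC.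
    apply: filterS hE => x ->; rewrite cjM cjR mulrCA; congr (_ * (_ * _)).
    rewrite /osc -cintJ; last exact: cintegrable_osc.
    by apply: eq_cint => y; rewrite cjM expiJ mul1r dotpC.
  rewrite cintZ; last first.
    apply: (@cintegrable_bounded_mul _ _ _ _ (fine (nint mu (fun y => cj (G y))))).
    - exact: ifn.
    - have := cmeasurable_osc (-1) (cmeasurableJ mG); rewrite /osc.
      by under eq_fun => y do under eq_fun => x do rewrite mulN1r dotpC.
    - move=> x; have := osc_le (-1) x (cintegrableJ iG); rewrite /osc.
      by under eq_cint => y do rewrite mulN1r dotpC.
  congr (_ * _).
  rewrite (cint_swap (M := 1) (e := fun z => expi (- dotp z.1 z.2)) ifn (cintegrableJ iG)).
  - by apply: eq_cint => y; rewrite mulrC.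
  - have := @cmeasurable_kernel R d (-1).
    by congr cmeasurable; apply/funext => z; rewrite mulN1r.
  - by move=> z; rewrite normc_expi.
set Z := ip f h - invk%:C * ip g G.
suff Z0 : Z = 0 by apply/eqP; rewrite -subr_eq0 -/Z Z0.
(* [Z] splits into inner products of [h] and [G] with two truncation errors of squared norm at most
   [e]; hence its squared modulus is at most [e * K] for every positive [e]. *)
set K := 2 * fine (sqnormL2 h) + 2 * (invk ^+ 2 * fine (sqnormL2 G)).
have K0 : 0 <= K.
  apply: addr_ge0; apply: mulr_ge0 => //; first by rewrite fine_ge0// sqnormL2_ge0.
  by apply: mulr_ge0; [exact: sqr_ge0|rewrite fine_ge0// sqnormL2_ge0].
have bound e : 0 < e -> normc Z ^+ 2 <= e * K.
  move=> e0; have [N HN] := cv e e0.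
  have [N' HN'] := (cvgL2P (cutoff f) f).1 (cvgL2_cutoff fL) e e0.
  pose n := maxn N N'; have H := HN n (leq_maxl _ _); have H' := HN' n (leq_maxr _ _).
  have fnL := L2_cutoff n fL; have ifn := cintegrable_cutoff n fL.
  have mF : cmeasurable (fourier (cutoff f n)).
    by rewrite fourierE; apply: cmeasurable_osc; case: ifn.
  have dL : L2 (fun x => fourier (cutoff f n) x - g x).
    apply: L2_mk; first by apply: cmeasurableB => //; exact: L2_cmeasurable.
    by apply: lt_trans H _; rewrite ltry.
  have FL : L2 (fourier (cutoff f n)).
    rewrite (_ : fourier (cutoff f n) =
        (fun x => (fourier (cutoff f n) x - g x) + g x)); first exact: L2D.
    by apply/funext => x; rewrite subrK.
  have ZE : Z = - ip (fun x => cutoff f n x - f x) h +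
      invk%:C * ip (fun x => fourier (cutoff f n) x - g x) G.
    have ipB u w v : L2 u -> L2 w -> L2 v -> ip (fun x => u x - w x) v = ip u v - ip w v.
      move=> uL wL vL; rewrite /ip -cintB; [|exact: cintegrable_ip..].
      by apply: eq_cint => x; rewrite mulrBl.
    by rewrite !ipB// step /Z; rewrite -/(ip (fourier (cutoff f n)) G); ring.
  have c1 := normc_ip_le (L2B fnL fL) hL; have c2 := normc_ip_le dL GL.
  have s1 : fine (sqnormL2 (fun x => cutoff f n x - f x)) <= e.
    by rewrite -lee_fin (fineK (sqnormL2_fin (L2B fnL fL))) ltW.
  have s2 : fine (sqnormL2 (fun x => fourier (cutoff f n) x - g x)) <= e.
    by rewrite -lee_fin (fineK (sqnormL2_fin dL)) ltW.
  have t1 := le_trans c1 (ler_wpM2r (fine_ge0 (sqnormL2_ge0 h)) s1).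
  have t2 := le_trans c2 (ler_wpM2r (fine_ge0 (sqnormL2_ge0 G)) s2).
  have hZ : normc Z <= normc (ip (fun x => cutoff f n x - f x) h) +
      invk * normc (ip (fun x => fourier (cutoff f n) x - g x) G).
    rewrite ZE; apply: le_trans (le_normcD _ _) _.
    by rewrite normcN Normc.normcM normcR gtr0_norm ?invk_gt0.
  set p := normc _ in t1 hZ; set q := normc _ in t2 hZ; rewrite -/q in hZ.
  have p0 : 0 <= p := normc_ge0 _; have q0 : 0 <= q := normc_ge0 _.
  have k0 : 0 <= invk := ltW (@invk_gt0 R d).
  have h1 : normc Z ^+ 2 <= (p + invk * q) ^+ 2.
    have pq0 : 0 <= p + invk * q by apply: addr_ge0 => //; exact: mulr_ge0.
    by rewrite ler_pXn2r ?nnegrE ?normc_ge0.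
  apply: le_trans h1 _.
  have h2 : (p + invk * q) ^+ 2 <= 2 * p ^+ 2 + 2 * (invk ^+ 2 * q ^+ 2).
    rewrite -subr_ge0 (_ : _ - _ = (p - invk * q) ^+ 2) ?sqr_ge0//.
    by ring.
  apply: le_trans h2 _.
  have h3 : invk ^+ 2 * q ^+ 2 <= invk ^+ 2 * (e * fine (sqnormL2 G)).
    by apply: ler_wpM2l => //; exact: sqr_ge0.
  rewrite (_ : e * K = 2 * (e * fine (sqnormL2 h)) +
    2 * (invk ^+ 2 * (e * fine (sqnormL2 G)))); last by rewrite /K; ring.
  apply: lerD; apply: ler_wpM2l => //.
apply: Normc.eq0_normc; apply/eqP; rewrite -sqrf_eq0 eq_le sqr_ge0 andbT.
apply/ler_addgt0Pr => e e0; rewrite add0r.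
have K1 : 0 < K + 1 by rewrite ltr_wpDl.
apply: le_trans (bound (e / (K + 1)) (divr_gt0 e0 K1)) _.
by rewrite mulrAC ler_pdivrMr// ler_wpM2l ?lerDl// ltW.
Qed.

(** By adjointness both sides are [invk] times the inner product of the two transforms over [S]: the
    indicator is real and may be moved from one factor to the other. *)
Lemma opB_sym a r (S : set V) f u h w : S `<=` box a r -> 0 <= r ->
  opB S f u -> opB S h w -> ip u h = ip f w.
Proof.
move=> SB r0 [gf [Ff If]] [gh [Fh Ih]].
have Ef := chi_mul_box_box gf SB; have Eh := chi_mul_box_box gh SB.
rewrite (fourier_adjoint Ff Ih Eh r0).
have [hL ghL _] := Fh; have [fL gfL _] := Ff.
have [cfL uL _] := If; have [chL wL _] := Ih.
rewrite (ipJ hL uL) (fourier_adjoint Fh If Ef r0) cjM cjR; congr (_ * _).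
rewrite -ipJ//; apply: eq_cint => x.
by rewrite /chi_mul cjM cjR; ring.
Qed.

End adjoint.

(** * Approximation of the exponential *)

Section taylor.
Context {R : realType}.

(** Normalised so that differentiation just lowers the index. *)
Definition fact_pow (n : nat) (t : R) : R := t ^+ n / n`!%:R.

Lemma fact_powS0 n : fact_pow n.+1 0 = 0.
Proof. by rewrite /fact_pow expr0n mul0r. Qed.

Lemma is_derive_fact_pow n (t : R) : is_derive t (1 : R) (fact_pow n.+1) (fact_pow n t).
Proof.
have DX : is_derive t (1 : R) (@GRing.exp R ^~ n.+1) (n.+1%:R * t ^+ n).
  apply: (DeriveDef (@exprn_derivable R n.+1 t 1)).
  by rewrite exp_derive /GRing.scale/= mulr1.
have D : is_derive t (1 : R) ((n.+1)`!%:R^-1 *: (@GRing.exp R ^~ n.+1))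
    ((n.+1)`!%:R^-1 *: (n.+1%:R * t ^+ n)) by exact: is_deriveZ.
have -> : fact_pow n.+1 = (n.+1)`!%:R^-1 *: (@GRing.exp R ^~ n.+1).
  by apply/funext => u; rewrite /fact_pow mulrC.
apply: (is_derive_eq D); rewrite /fact_pow /GRing.scale/= factS natrM.
have n0 : (n.+1%:R : R) != 0 by rewrite pnatr_eq0.
have f0 : (n`!%:R : R) != 0 by rewrite pnatr_eq0 -lt0n fact_gt0.
by rewrite invfM (mulrC _^-1 n`!%:R^-1) -mulrA mulKf// mulrC.
Qed.

Definition taylor (a : nat -> R) (N : nat) (t : R) : R :=
  \sum_(n < N) a n * fact_pow n t.

Lemma is_derive_taylor a N (t : R) :
  is_derive t (1 : R) (taylor a N.+1) (taylor (fun n => a n.+1) N t).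
Proof.
elim: N => [|N IH].
  rewrite /taylor big_ord0 (_ : (fun t => _) = cst (a 0%N)); first exact: is_derive_cst.
  by apply/funext => u; rewrite big_ord1 /fact_pow expr0 fact0 divr1 mulr1.
rewrite (_ : taylor a N.+2 = (fun u => taylor a N.+1 u + a N.+1 * fact_pow N.+1 u)); last first.
  by apply/funext => u; rewrite /taylor big_ord_recr.
have := is_derive_fact_pow N t => D.
rewrite [X in is_derive _ _ _ X](_ : _ =
  taylor (fun n => a n.+1) N t + a N.+1 * fact_pow N t); last first.
  by rewrite /taylor big_ord_recr.
rewrite -[X in is_derive _ _ _ (_ + X)]/(a N.+1 *: fact_pow N t).
by apply: is_deriveD.
Qed.

(** For [s = 1] and [s = -1] the function [fact_pow N.+1 - s * f] vanishes at 0 and has a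
    nonnegative derivative on the right of 0. *)
Lemma le_integrate_fact_pow (f f' : R -> R) N :
  (forall t : R, is_derive t (1 : R) f (f' t)) -> f 0 = 0 ->
  (forall t, 0 <= t -> `|f' t| <= fact_pow N t) ->
  forall t, 0 <= t -> `|f t| <= fact_pow N.+1 t.
Proof.
move=> df f0 f'le t t0.
have key (s : R) : `|s| = 1 -> s * f t <= fact_pow N.+1 t.
  move=> s1; pose g u := fact_pow N.+1 u - s * f u.
  have dg (u : R) : is_derive u (1 : R) g (fact_pow N u - s * f' u).
    have D1 := is_derive_fact_pow N u; have D2 := df u.
    rewrite -[X in is_derive _ _ _ (_ - X)]/(s *: f' u).
    by apply: is_deriveB.
  have : g 0 <= g t.
    apply: (@ger0_derive1_ndecr _ g 0 t) => //.
    - move=> u /[!in_itv]/= /andP[u0 _]; have D := dg u; rewrite derive1E (derive_val (is_derive := D)) subr_ge0.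
      apply: le_trans (ler_norm _) _; rewrite normrM s1 mul1r; apply: f'le.
      exact: ltW.
    - by apply: derivable_within_continuous => u _; have D := dg u; apply: ex_derive.
  by rewrite /g f0 mulr0 subr0 fact_powS0 subr_ge0.
have h1 := key 1 (normr1 _); have h2 := key (-1) (normrN1 _).
by rewrite ler_norml; apply/andP; split; lra.
Qed.

(** Induction for all phases at once: differentiating [cos (t + p)] adds [pi / 2] to the phase and
    shifts the coefficients, so one statement serves both cosine and sine. *)
Lemma cos_taylor_ge0 N (p t : R) : 0 <= t ->
  `|cos (t + p) - taylor (fun n => cos (p + n%:R * (pi / 2))) N t| <= fact_pow N t.
Proof.
elim: N p t => [|N IH] p t t0.
  rewrite /taylor big_ord0 subr0 /fact_pow expr0 fact0 divr1 ler_norml.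
  by rewrite cos_geN1 cos_le1.
pose a n : R := cos (p + n%:R * (pi / 2)).
apply: (@le_integrate_fact_pow (fun u => cos (u + p) - taylor a N.+1 u)
  (fun u => cos (u + (p + pi / 2)) - taylor (fun n => a n.+1) N u)) => //.
- move=> u; have D := is_derive_taylor a N u.
  apply: is_deriveB; apply: is_derive_eq.
  by rewrite /GRing.scale/= addrA cosDpihalf; ring.
- rewrite add0r /taylor big_ord_recl big1; last by move=> i _; rewrite fact_powS0 mulr0.
  by rewrite /a mul0r addr0 /fact_pow expr0 fact0 divr1 mulr1 addr0 subrr.
- move=> u u0; have := IH (p + pi / 2) u u0.
  congr (`|_ - _| <= _); apply: eq_bigr => i _; congr (_ * _); rewrite /a; congr cos.
  by rewrite -natr1; ring.
Qed.

Lemma cosDnpi (x : R) n : cos (x + n%:R * pi) = (-1) ^+ n * cos x.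
Proof.
elim: n => [|n IH]; first by rewrite mul0r addr0 expr0 mul1r.
by rewrite -natr1 mulrDl mul1r addrA cosDpi IH exprS mulN1r mulNr.
Qed.

(** For negative [t], cosine being even, the signs of [t] and [p] are both reversed. The coefficient
    of order [n] and the power of [t] each change by [(-1) ^+ n], and the two changes cancel. *)
Lemma cos_taylor N (p t : R) :
  `|cos (t + p) - taylor (fun n => cos (p + n%:R * (pi / 2))) N t| <= fact_pow N `|t|.
Proof.
have [t0|t0] := leP 0 t; first by rewrite (ger0_norm t0); exact: cos_taylor_ge0.
rewrite (ltr0_norm t0); have Nt : 0 <= - t by rewrite oppr_ge0 ltW.
have := cos_taylor_ge0 N (- p) Nt.
congr (`|_ - _| <= _); first by rewrite -opprD cosN.
apply: eq_bigr => n _.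
have -> : cos (p + n%:R * (pi / 2)) = (-1) ^+ n * cos (- p + n%:R * (pi / 2)).
  by rewrite -[cos (- p + _)]cosN -cosDnpi; congr cos; field.
have -> : fact_pow n (- t) = (-1) ^+ n * fact_pow n t.
  by rewrite /fact_pow (exprNn t) [RHS]mulrA.
by rewrite mulrCA mulrA.
Qed.

(** The Taylor polynomial of [expi] with [N] terms: [expi (n%:R * (pi / 2))] is the [n]-th power of
    the imaginary unit. *)
Definition expi_taylor (N : nat) (t : R) : R[i] :=
  \sum_(n < N) expi (n%:R * (pi / 2)) * (n`!%:R^-1)%:C * t%:C ^+ n.

Lemma expi_taylor_le N (t : R) :
  normc (expi t - expi_taylor N t) <= 2 * fact_pow N `|t|.
Proof.
have E : expi_taylor N t = taylor (fun n => cos (0 + n%:R * (pi / 2))) N t +i*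
    taylor (fun n => cos (- (pi / 2) + n%:R * (pi / 2))) N t.
  have Et n : expi (n%:R * (pi / 2)) * (n`!%:R^-1)%:C * t%:C ^+ n =
      (cos (0 + n%:R * (pi / 2)) * fact_pow n t) +i*
      (cos (- (pi / 2) + n%:R * (pi / 2)) * fact_pow n t).
    have -> : t%:C ^+ n = (t ^+ n)%:C by rewrite rmorphXn.
    rewrite add0r (addrC (- _)) cosBpihalf /fact_pow /expi.
    by apply: complex_ext; rewrite ?ReM ?ImM /= ?ReM ?ImM /=; ring.
  rewrite /expi_taylor /taylor.
  elim: N => [|N IH]; first by rewrite !big_ord0.
  by rewrite !big_ord_recr/= IH Et.
apply: le_trans (normc_le_ReIm _) _; rewrite E /=.
have -> : 2 * fact_pow N `|t| = fact_pow N `|t| + fact_pow N `|t| by ring.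
have h1 := cos_taylor N 0 t; have h2 := cos_taylor N (- (pi / 2)) t.
rewrite addr0 in h1; rewrite cosBpihalf in h2.
exact: lerD.
Qed.

(** The factors are exchanged one at a time. Each [w i] has modulus at most [1 + a], so a step
    multiplies the error by at most [1 + a] and adds [eps]; bounding that [eps] by
    [eps * (2 + a) ^+ d] yields the base [2 + a]. *)
Lemma prod_approx_le (eps a : R) d (z w : 'I_d -> R[i]) : 0 <= eps -> eps <= a ->
  (forall i, normc (z i) = 1) -> (forall i, normc (z i - w i) <= eps) ->
  normc (\prod_(i < d) z i - \prod_(i < d) w i) <= eps * (2 + a) ^+ d.
Proof.
move=> e0 ea z1 zw; have a0 : 0 <= a by exact: le_trans ea.
elim: d z w z1 zw => [|d IH] z w z1 zw.
  by rewrite !big_ord0 subrr Normc.normc0 mulr_ge0.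
rewrite !big_ord_recl.
set P := \prod_(i < d) z _; set P' := \prod_(i < d) w _.
have nP : normc P = 1.
  rewrite /P (big_morph _ (@Normc.normcM R) (@Normc.normc1 R)).
  by rewrite big1// => i _; exact: z1.
have H : normc (P - P') <= eps * (2 + a) ^+ d by exact: IH.
rewrite (_ : _ - _ = (z ord0 - w ord0) * P + w ord0 * (P - P')); last by ring.
apply: le_trans (le_normcD _ _) _; rewrite !Normc.normcM nP mulr1.
have nw : normc (w ord0) <= 1 + a.
  rewrite -[w ord0](subrK (z ord0)) addrC; apply: le_trans (le_normcD _ _) _.
  by rewrite z1 lerD2l -normcN opprB; exact: le_trans (zw _) ea.
have p1 : 1 <= (2 + a) ^+ d by apply: exprn_ege1; lra.
have h : normc (w ord0) * normc (P - P') <= (1 + a) * (eps * (2 + a) ^+ d).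
  by apply: ler_pM => //; exact: normc_ge0.
have e1 : eps <= eps * (2 + a) ^+ d by rewrite ler_peMr.
apply: le_trans (lerD (le_trans (zw _) e1) h) _.
by rewrite exprS le_eqVlt; apply/orP; left; apply/eqP; ring.
Qed.

End taylor.

Section bounded_multiplier.
Context {R : realType} {d} {T : measurableType d}.
Variable mu : {measure set T -> \bar R}.

(** The multiplier is controlled only where [f] does not vanish: polynomials are unbounded on the
    whole space but bounded on the support of [f]. *)
Lemma nint_mul_le (M : R) (f g : T -> R[i]) : cmeasurable f -> cmeasurable g ->
  (forall x, f x = 0 \/ normc (g x) <= M) -> 0 <= M ->
  (nint mu (fun x => (f x * g x)%R) <= M%:E * nint mu f)%E.
Proof.
move=> mf mg fgM M0.
have mN : measurable_fun setT (fun x => (normc (f x))%:E).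
  by apply/measurable_EFinP; exact: measurable_normc.
rewrite /nint -ge0_integralZl; last 4 first.
- exact: measurableT.
- exact: mN.
- by move=> x _; rewrite lee_fin normc_ge0.
- by rewrite lee_fin.
apply: ge0_le_integral.
- exact: measurableT.
- by move=> x _; rewrite lee_fin normc_ge0.
- by apply/measurable_EFinP; apply: measurable_normc; exact: cmeasurableM.
- exact: measurable_funeM.
move=> x _; rewrite -EFinM lee_fin Normc.normcM mulrC.
have [->|h] := fgM x; first by rewrite Normc.normc0 !mulr0.
by apply: ler_wpM2r; first exact: normc_ge0.
Qed.

Lemma cintegrable_mul (M : R) (f g : T -> R[i]) : cintegrable mu f -> cmeasurable g ->
  (forall x, f x = 0 \/ normc (g x) <= M) -> 0 <= M ->
  cintegrable mu (fun x => f x * g x).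
Proof.
move=> [mf fi] mg fgM M0; split; first exact: cmeasurableM.
apply: le_lt_trans (nint_mul_le mf mg fgM M0) _.
by rewrite lte_mul_pinfty// lee_fin.
Qed.

End bounded_multiplier.

Lemma real_complexM {R : realType} (x y : R) : x%:C * y%:C = (x * y)%:C.
Proof. by simpc. Qed.

Lemma real_complexX {R : realType} (x : R) n : x%:C ^+ n = (x ^+ n)%:C.
Proof. by elim: n => // n IH; rewrite !exprS IH real_complexM. Qed.

(** * Vanishing moments, and the Bessel bound for the transform on [L^2] *)

Section moments.
Context {R : realType} {d : nat}.
Notation V := 'rV[R]_d.
Notation mu := (@lebesgue_rV R d).
Notation invk := (@invk R d).
Notation bessel := (@bessel R d).
Implicit Types (f g h G u v w : V -> R[i]) (x y xi : V) (r rho : R).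

(** The functions of [xi] in the separated form of [expi (dotp x xi)], which is why a phase at [x0]
    is included. There are [N ^ d] of them. *)
Definition monomial N (x0 xi0 : V) (al : {ffun 'I_d -> 'I_N}) xi : R[i] :=
  expi (dotp x0 xi) * \prod_(j < d) ((xi ord0 j - xi0 ord0 j) ^+ al j)%:C.

Lemma cmeasurable_monomial N x0 xi0 (al : {ffun 'I_d -> 'I_N}) :
  cmeasurable (monomial x0 xi0 al).
Proof.
apply: cmeasurableM.
  have := @cmeasurable_kernel1 R d 1 x0.
  by congr cmeasurable; apply/funext => xi; rewrite mul1r dotpC.
apply: cmeasurable_prod => j; apply: cmeasurable_real; apply: measurable_funX.
by apply: measurable_funB => //; exact: measurable_coord_rV.
Qed.

Lemma chi_mul_box_eq0 (A : set V) G xi : chi_mul A G = G -> G xi = 0 \/ A xi.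
Proof.
move=> GE; have [xA|xA] := boolP (xi \in A); [right; exact: set_mem|left].
by rewrite -GE /chi_mul indicE (negbTE xA) mul0r.
Qed.

Lemma normc_prod n (F : 'I_n -> R[i]) :
  normc (\prod_(i < n) F i) = \prod_(i < n) normc (F i).
Proof. by apply: (big_morph _ (@Normc.normcM R) (@Normc.normc1 R)). Qed.

Lemma cintegrable_monomial N x0 xi0 r (al : {ffun 'I_d -> 'I_N}) G :
  0 <= r -> cintegrable mu G -> chi_mul (box xi0 r) G = G ->
  cintegrable mu (fun xi => G xi * monomial x0 xi0 al xi).
Proof.
(* The base is [1 + r] rather than [r] so that its powers increase with the exponent. *)
move=> r0 iG GE; apply: (@cintegrable_mul _ _ _ _ (\prod_(j < d) (1 + r) ^+ N)) => //.
- exact: cmeasurable_monomial.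
- move=> xi; have [->|xb] := chi_mul_box_eq0 xi GE; [by left|right].
  rewrite /monomial Normc.normcM normc_expi mul1r normc_prod.
  apply: ler_prod => j _; rewrite normc_ge0 andTb normcR normrX.
  apply: (@le_trans _ _ ((1 + r) ^+ al j)).
    apply: lerXn2r; rewrite ?nnegrE ?addr_ge0//.
    by apply: le_trans (xb j) _; rewrite lerDr.
  by rewrite ler_weXn2l ?lerDl// ltnW.
- by apply: prodr_ge0 => j _; rewrite exprn_ge0// addr_ge0.
Qed.

(* Once the moments of [G] of degree less than [N] in each variable vanish,
   each factor of [e^(i x.xi)] may be replaced by its Taylor remainder. *)
Lemma osc_moments_le N (x0 xi0 : V) rho r (a : R) G x :
  0 <= rho -> 0 <= r -> 2 * fact_pow N (rho * r) <= a ->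
  cintegrable mu G -> chi_mul (box xi0 r) G = G ->
  (forall al : {ffun 'I_d -> 'I_N}, cint mu (fun xi => G xi * monomial x0 xi0 al xi) = 0) ->
  box x0 rho x ->
  normc (osc 1 G x) <= 2 * fact_pow N (rho * r) * (2 + a) ^+ d * fine (nint mu G).
Proof.
move=> rho0 r0 epsa iG GE mom xb; have [mG Gfin] := iG.
have eps0 : 0 <= 2 * fact_pow N (rho * r).
  by rewrite mulr_ge0// divr_ge0// exprn_ge0// mulr_ge0.
pose tau j xi : R := (x ord0 j - x0 ord0 j) * (xi ord0 j - xi0 ord0 j).
pose P xi := \prod_(j < d) expi (tau j xi).
pose P' xi := \prod_(j < d) expi_taylor N (tau j xi).
(* Distributing the product over the sums gives one term per choice of an exponent in each
   coordinate; in every term [x] and [xi] are separated. *)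
have P'E xi : expi (dotp x0 xi) * P' xi =
    \sum_(al : {ffun 'I_d -> 'I_N}) (\prod_(j < d)
      (expi ((al j)%:R * (pi / 2)) * (((al j)`!)%:R^-1)%:C *
       ((x ord0 j - x0 ord0 j) ^+ al j)%:C)) * monomial x0 xi0 al xi.
  rewrite /P' /expi_taylor bigA_distr_bigA mulr_sumr; apply: eq_bigr => al _.
  rewrite /monomial mulrCA; congr (_ * _); rewrite -big_split; apply: eq_bigr => j _ /=.
  by rewrite -[RHS]mulrA real_complexM real_complexX /tau exprMn.
have zero : cint mu (fun xi => G xi * (expi (dotp x0 xi) * P' xi)) = 0.
  pose F := fun (n : 'I_#|{ffun 'I_d -> 'I_N}|) xi =>
    (\prod_(j < d) (expi ((enum_val n j)%:R * (pi / 2)) * (((enum_val n j)`!)%:R^-1)%:C *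
       ((x ord0 j - x0 ord0 j) ^+ enum_val n j)%:C)) *
      (G xi * monomial x0 xi0 (enum_val n) xi).
  rewrite (_ : (fun xi => _) = (fun xi => \sum_(n < #|{ffun 'I_d -> 'I_N}|) F n xi)); last first.
    apply/funext => xi; rewrite P'E mulr_sumr (reindex (@enum_val _ {ffun 'I_d -> 'I_N}))/=; last first.
      by apply: onW_bij; exact: enum_val_bij.
    by apply: eq_bigr => n _; rewrite /F mulrCA.
  rewrite cint_sum; last by move=> n; apply: cintegrableZ; exact: (cintegrable_monomial _ _ r0 iG GE).
  apply: big1 => n _; rewrite /F cintZ; last exact: (cintegrable_monomial _ _ r0 iG GE).
  by rewrite mom mulr0.
have mtau j : measurable_fun setT (tau j).
  apply: measurable_funM => //; apply: measurable_funB => //.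
  exact: measurable_coord_rV.
have mP : cmeasurable P by apply: cmeasurable_prod => j; exact: cmeasurable_expi.
have mP' : cmeasurable P'.
  apply: cmeasurable_prod => j; apply: cmeasurable_sum => n.
  apply: cmeasurableM; first exact: cmeasurable_cst.
  under eq_fun do rewrite real_complexX.
  by apply: cmeasurable_real; exact: measurable_funX.
have me : cmeasurable (fun xi => expi (dotp x0 xi)).
  have := @cmeasurable_kernel1 R d 1 x0.
  by congr cmeasurable; apply/funext => xi; rewrite mul1r dotpC.
set E := 2 * fact_pow N (rho * r) * (2 + a) ^+ d.
have E0 : 0 <= E by rewrite mulr_ge0// exprn_ge0// addr_ge0//; exact: le_trans epsa.
have rem xi : G xi = 0 \/ normc (expi (dotp x0 xi) * (P xi - P' xi)) <= E.
  have [->|xib] := chi_mul_box_eq0 xi GE; [by left|right].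
  rewrite Normc.normcM normc_expi mul1r; apply: prod_approx_le => //.
    by move=> j; exact: normc_expi.
  move=> j; apply: le_trans (expi_taylor_le _ _) _; rewrite ler_pM2l//.
  rewrite /fact_pow ler_pM2r ?invr_gt0 ?ltr0n ?fact_gt0//.
  apply: lerXn2r; rewrite ?nnegrE ?mulr_ge0// /tau normrM.
  by apply: ler_pM.
(* [dotp x xi] is the sum of [dotp x0 xi], of the terms [(x - x0) * xi0] and of the [tau j xi]. The
   middle part is constant in [xi] and contributes a factor of modulus 1. *)
have phase : osc 1 G x = expi (\sum_(j < d) (x ord0 j - x0 ord0 j) * xi0 ord0 j) *
    cint mu (fun xi => G xi * (expi (dotp x0 xi) * (P xi - P' xi))).
  have i1 : cintegrable mu (fun xi => G xi * (expi (dotp x0 xi) * P xi)).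
    apply: (@cintegrable_bounded_mul _ _ _ _ 1) => //; first exact: cmeasurableM.
    move=> xi; rewrite Normc.normcM normc_expi mul1r normc_prod.
    by rewrite big1// => j _; rewrite normc_expi.
  have i2 : cintegrable mu (fun xi => G xi * (expi (dotp x0 xi) * (P xi - P' xi))).
    apply: (@cintegrable_mul _ _ _ _ E) => //.
    by apply: cmeasurableM => //; exact: cmeasurableB.
  have -> : cint mu (fun xi => G xi * (expi (dotp x0 xi) * (P xi - P' xi))) =
      cint mu (fun xi => G xi * (expi (dotp x0 xi) * P xi)).
    have i3 : cintegrable mu (fun xi => G xi * (expi (dotp x0 xi) * P' xi)).
      rewrite (_ : (fun xi => _) = (fun xi => G xi * (expi (dotp x0 xi) * P xi) +
        (-1) * (G xi * (expi (dotp x0 xi) * (P xi - P' xi))))).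
        by apply: cintegrableD => //; exact: cintegrableZ.
      by apply/funext => xi; ring.
    rewrite -[RHS]subr0 -[X in _ - X]zero -cintB//.
    by apply: eq_cint => xi; ring.
  rewrite -cintZ// /osc; apply: eq_cint => xi; rewrite mulrCA; congr (_ * _).
  rewrite /P -expi_sum -!expiD; congr expi.
  rewrite mul1r /dotp -!big_split/=; apply: eq_bigr => j _; rewrite /tau; ring.
rewrite phase Normc.normcM normc_expi mul1r -lee_fin EFinM.
rewrite fineK; last by rewrite ge0_fin_numE ?nint_ge0.
have mR : cmeasurable (fun xi => expi (dotp x0 xi) * (P xi - P' xi)).
  by apply: cmeasurableM; [exact: me|exact: cmeasurableB].
apply: le_trans (nint_mul_le mu mG mR rem E0).
by apply: normc_cint_le; exact: (cintegrable_mul iG mR rem E0).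
Qed.

(** [local_bessel] bounds the transforms of the truncations, whose distance to [g] over the box
    tends to 0. Writing [g] as a transform minus an error doubles the constant. *)
Lemma fourierL2_bessel a r f g : fourierL2 f g -> 0 < r ->
  fine (sqnormL2 (chi_mul (box a r) g)) <= 2 * bessel * fine (sqnormL2 f).
Proof.
move=> [fL gL /cvgL2P cv] r0; have mb := measurable_box a r.
have xL := L2_chi_mul mb gL.
apply/ler_addgt0Pr => e e0.
have [N HN] := cv _ (divr_gt0 e0 (ltr0n R 2)); have H := HN N (leqnn N).
have fnL := L2_cutoff N fL; have ifn := cintegrable_cutoff N fL.
have mF : cmeasurable (osc (-1) (cutoff f N)) by apply: cmeasurable_osc; case: ifn.
have mD : cmeasurable (fun x => osc (-1) (cutoff f N) x - g x).
  by apply: cmeasurableB => //; exact: L2_cmeasurable.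
rewrite fourierE in H.
have DL : L2 (fun x => osc (-1) (cutoff f N) x - g x).
  by apply: L2_mk => //; apply: lt_trans H _; rewrite ltry.
have mC : cmeasurable (chi_mul (box a r) (osc (-1) (cutoff f N))).
  exact: cmeasurable_chi_mul.
have mCD : cmeasurable (fun x => (-1) * chi_mul (box a r) (fun x => osc (-1) (cutoff f N) x - g x) x).
  by apply: cmeasurableM; [exact: cmeasurable_cst|exact: cmeasurable_chi_mul].
have h1 : (sqnormL2 (chi_mul (box a r) (osc (-1) (cutoff f N))) <=
    (bessel * fine (sqnormL2 f))%:E)%E.
  have s1 : (-1 : R) ^+ 2 = 1 by rewrite sqrrN expr1n.
  apply: le_trans (local_bessel a s1 r0 ifn) _.
  rewrite EFinM (fineK (sqnormL2_fin fL)); apply: lee_wpmul2l.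
    by rewrite lee_fin ltW// bessel_gt0.
  apply: le_sqnormL2; [exact: L2_cmeasurable|exact: L2_cmeasurable|].
  by move=> x; exact: normc_chi_mul_le.
have h2 : (sqnormL2 (fun x => ((-1) * chi_mul (box a r) (fun x => (osc (-1) (cutoff f N) x - g x)%R) x)%R) <=
    (e / 2)%:E)%E.
  apply: le_trans (ltW H); apply: le_sqnormL2 => //.
  by move=> x; rewrite mulN1r normcN; exact: normc_chi_mul_le.
have h := sqnormL2D mC mCD.
rewrite (_ : (fun x => _ + _) = chi_mul (box a r) g) in h; last first.
  by apply/funext => x; rewrite /chi_mul; ring.
rewrite -lee_fin (fineK (sqnormL2_fin xL)); apply: (le_trans h).
have -> : ((2 * bessel * fine (sqnormL2 f) + e)%:E =
    2%:E * (bessel * fine (sqnormL2 f))%:E + 2%:E * (e / 2)%:E)%E.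
  by rewrite -!EFinM -EFinD; congr EFin; field.
by apply: leeD; apply: lee_wpmul2l; rewrite ?lee_fin.
Qed.

End moments.

(** * Two bounds on the norm of [P_Q B_S f] *)

Section time_band_estimates.
Context {R : realType} {d : nat}.
Notation V := 'rV[R]_d.
Notation mu := (@lebesgue_rV R d).
Notation invk := (@invk R d).
Notation bessel := (@bessel R d).
Variables (Q S : set V) (x0 xi0 : V) (rho r : R).
Hypotheses (QB : Q `<=` box x0 rho) (SB : S `<=` box xi0 r).
Hypotheses (rho0 : 0 <= rho) (r0 : 0 <= r).
Implicit Types (f g v : V -> R[i]).

(** A representative of [B_S f] defined at every point, when [g] is the transform of [f]. *)
Definition band_limit g : V -> R[i] := fun x => invk%:C * osc 1 (chi_mul S g) x.

Lemma normc_chi_mul_subset (A B : set V) f x : A `<=` B ->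
  normc (chi_mul A f x) <= normc (chi_mul B f x).
Proof.
move=> AB; rewrite /chi_mul !Normc.normcM; apply: ler_wpM2r; first exact: normc_ge0.
rewrite !normcR !indicE; have [xA|_] := boolP (x \in A); last by rewrite normr0.
by rewrite (mem_set (AB _ (set_mem xA))).
Qed.

Lemma sqnormL2_chi_mul_fourier f g : fourierL2 f g -> L2 (chi_mul S g) ->
  fine (sqnormL2 (chi_mul S g)) <= 2 * bessel * fine (sqnormL2 f).
Proof.
(* The Bessel bound wants a positive radius, while [r] is only known to be nonnegative. *)
move=> fg SgL; have r1 : 0 < r + 1 by rewrite ltr_wpDl.
have [_ gL _] := fg.
apply: le_trans (fourierL2_bessel xi0 fg r1).
have bL : L2 (chi_mul (box xi0 (r + 1)) g) by apply: L2_chi_mul => //; exact: measurable_box.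
apply: fine_le; [exact: sqnormL2_fin|exact: sqnormL2_fin|].
apply: le_sqnormL2; [exact: L2_cmeasurable|exact: L2_cmeasurable|].
move=> x; apply: normc_chi_mul_subset => y /SB yb i.
by apply: le_trans (yb i) _; rewrite lerDl.
Qed.

Section fixed_function.
Variables (f g v : V -> R[i]).
Hypotheses (fg : fourierL2 f g) (SgL : L2 (chi_mul S g)) (vL : L2 v).
Hypothesis vE : {ae mu, forall x, v x = chi_mul Q (band_limit g) x}.

(** The Bessel bound is applied twice: over the box around [S] to the transform of [f], then over
    the box around [Q] to the inverse transform. Only the first involves a limit, hence a single
    factor 2. *)
Lemma sqnormL2_time_band_le :
  fine (sqnormL2 v) <= 2 * (invk * bessel) ^+ 2 * fine (sqnormL2 f).
Proof.
have GE := chi_mul_box_box g SB.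
have [iG _] := cintegrable_box r0 SgL GE.
have rho1 : 0 < rho + 1 by rewrite ltr_wpDl.
have mo : cmeasurable (osc 1 (chi_mul S g)) by apply: cmeasurable_osc; case: iG.
have mb := measurable_box x0 (rho + 1).
have mc : cmeasurable (chi_mul (box x0 (rho + 1)) (osc 1 (chi_mul S g))).
  exact: cmeasurable_chi_mul.
have h1 : (sqnormL2 v <=
    sqnormL2 (fun x => (invk%:C * chi_mul (box x0 (rho + 1)) (osc 1 (chi_mul S g)) x)%R))%E.
  apply: ae_le_sqnormL2; first exact: L2_cmeasurable.
    by apply: cmeasurableM; [exact: cmeasurable_cst|].
  apply: filterS vE => x ->.
  rewrite (_ : _ * chi_mul _ _ _ = chi_mul (box x0 (rho + 1)) (band_limit g) x); last first.
    by rewrite /band_limit /chi_mul mulrCA.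
  apply: normc_chi_mul_subset => y /QB yb i.
  by apply: le_trans (yb i) _; rewrite lerDl.
have h2 := local_bessel x0 (expr1n R 2) rho1 iG.
rewrite sqnormL2Z// in h1.
have k0 : 0 <= invk by exact: ltW (@invk_gt0 R d).
have b0 : 0 <= bessel by exact: ltW (@bessel_gt0 R d).
have h3 : (sqnormL2 v <= (invk ^+ 2 * (bessel * fine (sqnormL2 (chi_mul S g))))%:E)%E.
  apply: (le_trans h1); rewrite normcR real_normK ?num_real// [leRHS]EFinM.
  apply: lee_wpmul2l; first by rewrite lee_fin sqr_ge0.
  by rewrite EFinM (fineK (sqnormL2_fin SgL)).
rewrite -(fineK (sqnormL2_fin vL)) lee_fin in h3.
apply: (le_trans h3).
rewrite (_ : 2 * (invk * bessel) ^+ 2 * fine (sqnormL2 f) =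
  invk ^+ 2 * (bessel * (2 * bessel * fine (sqnormL2 f)))); last by ring.
apply: ler_wpM2l; first exact: sqr_ge0.
by apply: ler_wpM2l => //; exact: sqnormL2_chi_mul_fourier.
Qed.

(** The pointwise bound of [osc_moments_le] is squared and multiplied by the volume
    [(2 * rho) ^+ d], and Cauchy-Schwarz over the box around [S] adds [(2 * r) ^+ d]. The radii thus
    enter through [rho * r] only. *)
Lemma sqnormL2_time_band_moments_le N (a : R) :
  2 * fact_pow N (rho * r) <= a ->
  (forall al : {ffun 'I_d -> 'I_N},
    cint mu (fun xi => chi_mul S g xi * monomial x0 xi0 al xi) = 0) ->
  fine (sqnormL2 v) <= 2 * invk ^+ 2 * bessel * (4 * (rho * r)) ^+ d *
    (2 * fact_pow N (rho * r) * (2 + a) ^+ d) ^+ 2 * fine (sqnormL2 f).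
Proof.
move=> epsa mom; set E := 2 * fact_pow N (rho * r) * (2 + a) ^+ d.
have GE := chi_mul_box_box g SB.
have [iG nG] := cintegrable_box r0 SgL GE.
set n := fine (nint mu (chi_mul S g)) in nG.
have n0 : 0 <= n by rewrite fine_ge0// nint_ge0.
have k0 : 0 <= invk by exact: ltW (@invk_gt0 R d).
have mb := measurable_box x0 rho.
have a0 : 0 <= a.
  by apply: le_trans epsa; rewrite mulr_ge0// divr_ge0// exprn_ge0// mulr_ge0.
have E0 : 0 <= E.
  by rewrite mulr_ge0// ?exprn_ge0 ?addr_ge0// mulr_ge0// divr_ge0// exprn_ge0// mulr_ge0.
pose e (x : V) : R[i] := (\1_(box x0 rho) x)%:C.
have me : cmeasurable e by apply: cmeasurable_real; exact: measurable_indic.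
have sqe : sqnormL2 e = ((2 * rho) ^+ d)%:E.
  rewrite -(box_measure x0 rho0).
  have <- : (\int[mu]_x (\1_(box x0 rho) x)%:E = mu (box x0 rho))%E.
    by rewrite integral_indic ?setIT.
  apply: eq_integral => x _; rewrite /e normcR indicE.
  by case: (_ \in _); rewrite ?normr1 ?normr0 ?expr1n ?expr0n.
have h1 : (sqnormL2 v <= sqnormL2 (fun x => ((invk * (E * n))%:C * e x)%R))%E.
  apply: ae_le_sqnormL2; first exact: L2_cmeasurable.
    by apply: cmeasurableM; [exact: cmeasurable_cst|].
  apply: filterS vE => x ->; rewrite /chi_mul !Normc.normcM !normcR.
  rewrite /e /band_limit indicE.
  have [xQ|_] := boolP (x \in Q); last first.
    by rewrite normr0 mul0r mulr_ge0 ?normc_ge0.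
  have xb := QB (set_mem xQ).
  rewrite normr1 mul1r indicE mem_set// normr1 mulr1.
  rewrite (ger0_norm k0) (ger0_norm (mulr_ge0 k0 (mulr_ge0 E0 n0))).
  by apply: ler_wpM2l => //; exact: (osc_moments_le rho0 r0 epsa iG GE mom xb).
rewrite sqnormL2Z// sqe normcR real_normK ?num_real// -EFinM in h1.
rewrite -(fineK (sqnormL2_fin vL)) lee_fin in h1.
apply: (le_trans h1).
have h2 := sqnormL2_chi_mul_fourier fg SgL.
have h3 : n ^+ 2 <= (2 * r) ^+ d * (2 * bessel * fine (sqnormL2 f)).
  by apply: le_trans nG _; apply: ler_wpM2l => //; rewrite exprn_ge0// mulr_ge0.
rewrite (_ : (invk * (E * n)) ^+ 2 * (2 * rho) ^+ d =
  (2 * rho) ^+ d * (invk ^+ 2 * E ^+ 2) * n ^+ 2); last by ring.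
have -> : (4 * (rho * r)) ^+ d = (2 * rho) ^+ d * (2 * r) ^+ d.
  by rewrite -exprMn; congr (_ ^+ d); ring.
rewrite (_ : _ * fine (sqnormL2 f) = (2 * rho) ^+ d * (invk ^+ 2 * E ^+ 2) *
  ((2 * r) ^+ d * (2 * bessel * fine (sqnormL2 f)))); last by ring.
apply: ler_wpM2l => //; apply: mulr_ge0; first by rewrite exprn_ge0// mulr_ge0.
by apply: mulr_ge0; exact: sqr_ge0.
Qed.

End fixed_function.
End time_band_estimates.

Lemma exists_left_kernel (F : fieldType) m n (A : 'M[F]_(m, n)) : (n < m)%N ->
  exists c : 'I_m -> F, (exists i, c i != 0) /\
    forall j, \sum_(i < m) c i * A i j = 0.
Proof.
move=> nm; have : kermx A != 0.
  rewrite kermx_eq0 /row_free neq_ltn; apply/orP; left.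
  exact: leq_ltn_trans (rank_leq_col A) nm.
move=> /matrix0Pn[i [j cij]]; exists (fun l => kermx A i l); split; first by exists j.
by move=> l; have := mulmx_ker A => /matrixP/(_ i l); rewrite [LHS]mxE [RHS]mxE.
Qed.

(** * Gram matrices of combinations of eigenfunctions *)

Section gram.
Context {R : realType} {d : nat}.
Notation V := 'rV[R]_d.
Notation mu := (@lebesgue_rV R d).

(* The hypothesis on [W] makes [(t i - t j) * ip (F i) (F j)] vanish, so that
   [(t i - lam) * ip (F i) (F j)] is the Gram matrix of the functions
   [sqrt (t i - lam) * F i]. *)
Lemma gram_ge m (t : 'I_m -> R) (F W : 'I_m -> V -> R[i]) (lam : R) :
  (forall i, L2 (F i)) -> (forall i, L2 (W i)) ->
  (forall i j, (t i)%:C * ip (F i) (F j) = ip (W i) (W j)) ->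
  (forall i, lam <= t i) ->
  lam * fine (sqnormL2 (fun x => \sum_(i < m) F i x)) <=
    fine (sqnormL2 (fun x => \sum_(i < m) W i x)) /\
  forall t0, fine (sqnormL2 (fun x => \sum_(i < m) (t i == t0)%:R * F i x)) <=
    fine (sqnormL2 (fun x => \sum_(i < m) F i x)).
Proof.
move=> FL WL FW lamt; pose p i j := ip (F i) (F j).
(* Conjugating the hypothesis for [j] and [i] and comparing it with the one for [i] and [j] gives
   [t j * p i j = t i * p i j]. *)
have pt i j : p i j = 0 \/ t i = t j.
  have e1 : (t j)%:C * p i j = (t i)%:C * p i j.
    have := congr1 cj (FW j i); rewrite cjM cjR -(ipJ (FL j) (FL i)) -(ipJ (WL j) (WL i)).
    by rewrite -FW.
  have [->|pn0] := eqVneq (p i j) 0; [by left|right].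
  by have := mulIf pn0 e1 => /complexI ->.
have sqE (w : 'I_m -> R) :
    (fine (sqnormL2 (fun x => \sum_(i < m) (w i)%:C * F i x)))%:C =
    \sum_(i < m) \sum_(j < m) (w i)%:C * (w j)%:C * p i j.
  have wL i : L2 (fun x => (w i)%:C * F i x) by exact: L2Z.
  rewrite -ip_self; last exact: (L2_sum wL).
  rewrite (ip_sum wL wL); apply: eq_bigr => i _; apply: eq_bigr => j _.
  rewrite ipZl// (ipJ (wL j) (FL i)) ipZl// cjM cjR -(ipJ (FL j) (FL i)).
  by rewrite mulrA.
have sq1 : (fine (sqnormL2 (fun x => \sum_(i < m) F i x)))%:C =
    \sum_(i < m) \sum_(j < m) p i j.
  by rewrite -ip_self; [rewrite ip_sum|exact: L2_sum].
have sqW : (fine (sqnormL2 (fun x => \sum_(i < m) W i x)))%:C =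
    \sum_(i < m) \sum_(j < m) (t i)%:C * p i j.
  rewrite -ip_self; last exact: L2_sum.
  by rewrite ip_sum//; apply: eq_bigr => i _; apply: eq_bigr => j _; rewrite FW.
have sq0 (w : 'I_m -> R) : 0 <= fine (sqnormL2 (fun x => \sum_(i < m) (w i)%:C * F i x)).
  by rewrite fine_ge0// sqnormL2_ge0.
split.
  pose s i := Num.sqrt (t i - lam).
  rewrite -subr_ge0; suff -> : fine (sqnormL2 (fun x => \sum_(i < m) W i x)) -
      lam * fine (sqnormL2 (fun x => \sum_(i < m) F i x)) =
      fine (sqnormL2 (fun x => \sum_(i < m) (s i)%:C * F i x)) by exact: sq0.
  apply: complexI; rewrite sqE rmorphB rmorphM/= sqW sq1 mulr_sumr -sumrB.
  apply: eq_bigr => i _; rewrite mulr_sumr -sumrB; apply: eq_bigr => j _.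
  have [->|tij] := pt i j; first by rewrite !mulr0 subr0.
  rewrite -mulrBl; congr (_ * _); rewrite /s -tij real_complexM -expr2 sqr_sqrtr ?subr_ge0//.
  by rewrite rmorphB.
(* Pythagoras: the terms with [t i = t0] are orthogonal to the others, whose sum has the weights
   [w']. *)
move=> t0; pose w i : R := (t i == t0)%:R; pose w' i : R := 1 - w i.
rewrite -subr_ge0; suff -> : fine (sqnormL2 (fun x => \sum_(i < m) F i x)) -
    fine (sqnormL2 (fun x => \sum_(i < m) (t i == t0)%:R * F i x)) =
    fine (sqnormL2 (fun x => \sum_(i < m) (w' i)%:C * F i x)) by exact: sq0.
rewrite (_ : (fun x => \sum_(i < m) (t i == t0)%:R * F i x) =
    (fun x => \sum_(i < m) (w i)%:C * F i x)); last first.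
  by apply/funext => x; apply: eq_bigr => i _; rewrite /w; case: (_ == _).
apply: complexI; rewrite sqE rmorphB/= sqE sq1 -sumrB.
apply: eq_bigr => i _; rewrite -sumrB; apply: eq_bigr => j _.
have [->|tij] := pt i j; first by rewrite !mulr0 subr0.
rewrite /w' /w tij; case: (_ == _).
  by rewrite subrr real_complexM mulr1 mul1r subrr !mul0r.
by rewrite subr0 real_complexM mulr1 !mul0r subr0 mul1r.
Qed.

End gram.

(** * Bounds on the eigenvalues *)

Section eigenvalue_bounds.
Context {R : realType} {d : nat}.
Notation V := 'rV[R]_d.
Notation mu := (@lebesgue_rV R d).
Notation invk := (@invk R d).
Notation bessel := (@bessel R d).

(** Carries a basis of [E] along a bijection onto the positions at which the eigenvalue is listed,
    so that each index gets its own eigenfunction. Freeness is stated for combinations over an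
    initial segment, with coefficients supported in [A]. *)
Lemma has_dim_card_basis (E : set (V -> R[i])) n (A : set nat) :
  has_dim E n -> (A #= `I_n)%card ->
  exists b : nat -> V -> R[i], (forall j, A j -> E (b j)) /\
    forall m (c : 'I_m -> R[i]), (forall j : 'I_m, ~ A j -> c j = 0) ->
      {ae mu, forall x, \sum_(j < m) c j * b j x = 0} -> forall j, c j = 0.
Proof.
move=> [e [eE efree _]] /card_set_bijP[f [ffun finj _]].
pose b j := if insub (f j) is Some i then e i else (fun _ => 0).
have bE j (Aj : A j) : b j = e (Ordinal (ffun _ Aj : (f j < n)%N)).
  rewrite /b; case: insubP => [i fj ij|]; last by rewrite (ffun _ Aj : (f j < n)%N).
  by congr e; apply: val_inj.
exists b; split=> [j Aj|m c cA ae0 j].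
  by rewrite (bE _ Aj).
have [Aj|/cA//] := pselect (A j).
(* The coefficients regrouped along [f]; by injectivity on [A] at most one term of each sum
   survives. *)
pose c' (i : 'I_n) := \sum_(l < m) (f l == i :> nat)%:R * c l.
have c'0 : forall i, c' i = 0.
  apply: efree; apply: filterS ae0 => x h0; rewrite -[RHS]h0.
  transitivity (\sum_(l < m) \sum_(i < n) (f l == i :> nat)%:R * c l * e i x).
    rewrite [RHS]exchange_big; apply: eq_bigr => i _.
    by rewrite /c' mulr_suml.
  apply: eq_bigr => l _; have [Al|/cA->] := pselect (A l); last first.
    by rewrite mul0r; apply: big1 => i _; rewrite mulr0 mul0r.
  rewrite (bE _ Al) (bigD1 (Ordinal (ffun _ Al : (f l < n)%N)))//= eqxx mul1r.
  rewrite big1 ?addr0// => i il; rewrite (_ : _ == _ = false) ?mul0r//.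
  by apply/negbTE; apply: contra il => /eqP fl; apply/eqP/val_inj.
have := c'0 (Ordinal (ffun _ Aj : (f j < n)%N)).
rewrite /c' (bigD1 j)//= eqxx mul1r big1 ?addr0// => l lj.
have [Al|/cA->] := pselect (A l); last by rewrite mulr0.
rewrite (_ : _ == _ = false) ?mul0r//; apply/negbTE; apply: contra lj => /eqP flj.
by apply/eqP/val_inj; apply: finj => //; exact: mem_set.
Qed.

Variables (Q S : set V) (x0 xi0 : V) (rho r : R).
Hypotheses (QB : Q `<=` box x0 rho) (SB : S `<=` box xi0 r).
Hypotheses (rho0 : 0 <= rho) (r0 : 0 <= r).
Variable lam : nat -> R.
Hypothesis eig : eigenvalues_BPB Q S lam.
Variable k : nat.
Hypothesis lamk0 : 0 < lam k.

Let m := k.+1.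

Let eigenfunctions : exists e u v g : 'I_m -> V -> R[i],
  (forall j, [/\ fourierL2 (e j) (g j), inv_fourierL2 (chi_mul S (g j)) (u j),
    opP Q (u j) (v j) & opB S (v j) (fun x => (lam j)%:C * e j x)]) /\
  forall t (c : 'I_m -> R[i]), (forall j : 'I_m, lam j <> t -> c j = 0) -> 0 < t ->
    {ae mu, forall x, \sum_(j < m) c j * e j x = 0} -> forall j, c j = 0.
Proof.
have [_ lamni lameig] := eig.
(* One choice for each value [t], not for each index: all indices sharing an eigenvalue must draw
   from the same basis to remain independent. *)
have /choice[B BP] : forall t : R, exists b : nat -> V -> R[i], 0 < t ->
    (forall j, lam j = t -> eigenspace_BPB Q S t (b j)) /\
    forall m (c : 'I_m -> R[i]), (forall j : 'I_m, ~ lam j = t -> c j = 0) ->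
      {ae mu, forall x, \sum_(j < m) c j * b j x = 0} -> forall j, c j = 0.
  move=> t; have [t0|t0] := pselect (0 < t); last by exists (fun _ _ => 0).
  have [n [hd hc]] := lameig t t0.
  by have [b [b1 b2]] := has_dim_card_basis hd hc; exists b.
have lj0 (j : 'I_m) : 0 < lam j.
  by apply: lt_le_trans lamk0 _; apply: lamni; rewrite -ltnS.
pose e (j : 'I_m) := B (lam j) j.
have /choice[p pP] : forall j : 'I_m, exists p : (V -> R[i]) * (V -> R[i]) * (V -> R[i]),
    [/\ fourierL2 (e j) p.2, inv_fourierL2 (chi_mul S p.2) p.1.1,
      opP Q p.1.1 p.1.2 & opB S p.1.2 (fun x => (lam j)%:C * e j x)].
  move=> j; have [h _] := BP _ (lj0 j).
  have [u [v [[g [h1 h2]] h3 h4]]] := h j erefl.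
  by exists (u, v, g).
exists e, (fun j => (p j).1.1), (fun j => (p j).1.2), (fun j => (p j).2); split => //.
move=> t c ct t0 ae0; have [_ h] := BP t t0; apply: h => //.
apply: filterS ae0 => x h0; rewrite -[RHS]h0; apply: eq_bigr => j _.
have [<-//|/ct->] := pselect (lam j = t); by rewrite !mul0r.
Qed.

(** The lower half of a min-max argument on the span of the first [k + 1] eigenfunctions; each bound
    on [lam k] then reduces to a choice of coefficients. *)
Let eigen_combination : exists e v g : 'I_m -> V -> R[i],
  (forall j, [/\ fourierL2 (e j) (g j), L2 (chi_mul S (g j)) & L2 (v j)]) /\
  forall c : 'I_m -> R[i], (exists j, c j != 0) ->
    [/\ {ae mu, forall x, \sum_(j < m) c j * v j x =
          chi_mul Q (band_limit S (fun x => \sum_(j < m) c j * g j x)) x},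
        0 < fine (sqnormL2 (fun x => \sum_(j < m) c j * e j x)) &
        lam k * fine (sqnormL2 (fun x => \sum_(j < m) c j * e j x)) <=
        fine (sqnormL2 (fun x => \sum_(j < m) c j * v j x))].
Proof.
have [e [u [v [g [H indep]]]]] := eigenfunctions.
have [_ lamni _] := eig.
have lj0 (j : 'I_m) : 0 < lam j.
  by apply: lt_le_trans lamk0 _; apply: lamni; rewrite -ltnS.
have eL j : L2 (e j) by case: (H j) => -[].
have uL j : L2 (u j) by case: (H j) => _ [].
have vL j : L2 (v j) by case: (H j) => _ _ [].
have SgL j : L2 (chi_mul S (g j)) by case: (H j) => _ [].
have iG j : cintegrable mu (chi_mul S (g j)).
  by have [] := cintegrable_box r0 (SgL j) (chi_mul_box_box (g j) SB).
have vE j : {ae mu, forall x, v j x = chi_mul Q (u j) x} by case: (H j) => _ _ [].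
have uE j : {ae mu, forall x, u j x = invk%:C * osc 1 (chi_mul S (g j)) x}.
  by case: (H j) => _ iu _ _; exact: inv_fourierL2_box iu (chi_mul_box_box _ SB) r0.
exists e, v, g; split; first by move=> j; split => //; case: (H j).
have vu j l : ip (v j) (u l) = ip (v j) (v l).
  have [m1 _] := cintegrable_ip (vL j) (uL l); have [m2 _] := cintegrable_ip (vL j) (vL l).
  apply: ae_eq_cint => //; apply: filterS2 (vE j) (vE l) => x -> ->.
  by rewrite /chi_mul indicE; case: (_ \in _); rewrite ?mul1r ?mul0r.
(* [lam j * e j] is [B_S] applied to [v j]. Symmetry moves [B_S] onto [e l] and produces [u l],
   which may be replaced by [v l] because [v j] vanishes outside [Q]. *)
have rel (j l : 'I_m) : (lam j)%:C * ip (e j) (e l) = ip (v j) (v l).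
  have [_ _ _ Bj] := H j; have [Fl Il _ _] := H l.
  have Bl : opB S (e l) (u l) by exists (g l).
  by rewrite -vu -(opB_sym SB r0 Bj Bl) ipZl.
move=> c [j0 cj0].
pose F j x := c j * e j x; pose W j x := c j * v j x.
have FL j : L2 (F j) by exact: L2Z.
have WL j : L2 (W j) by exact: L2Z.
have ipZ2 (a b : R[i]) (h h' : V -> R[i]) : L2 h -> L2 h' ->
    ip (fun x => a * h x) (fun x => b * h' x) = a * cj b * ip h h'.
  move=> hL hL'; have bL := L2Z b hL'.
  by rewrite ipZl// (ipJ bL hL) ipZl// cjM -(ipJ hL' hL) mulrA.
have FW (i j : 'I_m) : (lam i)%:C * ip (F i) (F j) = ip (W i) (W j).
  by rewrite /F /W !ipZ2// mulrCA rel.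
have lamle (j : 'I_m) : lam k <= lam j by apply: lamni; rewrite -ltnS.
have [G1 G2] := gram_ge (t := fun j : 'I_m => lam j) FL WL FW lamle.
split => //.
- have all_v : {ae mu, forall x, forall j, v j x =
      chi_mul Q (fun x => invk%:C * osc 1 (chi_mul S (g j)) x) x}.
    apply: filter_forall => j; apply: filterS2 (vE j) (uE j) => x -> ux.
    by rewrite /chi_mul ux.
  apply: filterS all_v => x vx; rewrite /chi_mul /band_limit.
  under eq_bigr do rewrite vx /chi_mul.
  rewrite (_ : osc 1 _ x = \sum_(j < m) c j * osc 1 (chi_mul S (g j)) x).
    by rewrite !mulr_sumr; apply: eq_bigr => j _; rewrite mulrCA; congr (_ * _); rewrite mulrCA.
  rewrite /osc; under [RHS]eq_bigr => j _.
    rewrite -cintZ; last exact: cintegrable_osc.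
    over.
  rewrite -cint_sum; last by move=> j; apply: cintegrableZ; exact: cintegrable_osc.
  apply: eq_cint => y; rewrite /chi_mul mulr_sumr mulr_suml; apply: eq_bigr => j _.
  by ring.
(* It suffices that the component in one eigenspace be nonzero. For the eigenvalue of an index with
   nonzero coefficient, independence inside the eigenspace shows it. *)
- apply: lt_le_trans (G2 (lam j0)).
  pose c' (j : 'I_m) : R[i] := (lam j == lam j0)%:R * c j.
  have L2c : L2 (fun x => \sum_(i < m) (lam i == lam j0)%:R * F i x).
    by apply: L2_sum => i; exact: L2Z.
  rewrite lt_neqAle fine_ge0 ?sqnormL2_ge0// andbT eq_sym.
  apply: contra cj0 => /eqP sq0.
  have sq0e : sqnormL2 (fun x => \sum_(i < m) (lam i == lam j0)%:R * F i x) = 0%E.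
    by rewrite -(fineK (sqnormL2_fin L2c)) sq0.
  have := sqnormL2_eq0 (L2_cmeasurable L2c) sq0e => ae0.
  suff : c' j0 = 0 by rewrite /c' eqxx mul1r => ->.
  apply: (indep (lam j0) c') => //.
    by move=> j /eqP/negbTE jj; rewrite /c' jj mul0r.
  apply: filterS ae0 => x h0; rewrite -[RHS]h0; apply: eq_bigr => j _.
  by rewrite /c' /F mulrA.
Qed.

Lemma eigenvalue_le : lam k <= 2 * (invk * bessel) ^+ 2.
Proof.
have [e [v [g [H C]]]] := eigen_combination.
have c0 : exists j : 'I_m, (fun _ => 1 : R[i]) j != 0 by exists ord0; rewrite oner_neq0.
have [vE f0 h] := C (fun _ => 1) c0.
have fg : fourierL2 (fun x => \sum_(j < m) 1 * e j x) (fun x => \sum_(j < m) 1 * g j x).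
  by apply: (fourierL2_sum (fun=> 1)) => j; case: (H j).
have vL : L2 (fun x => \sum_(j < m) 1 * v j x).
  by apply: L2_sum => j; apply: L2Z; case: (H j).
have SgL : L2 (chi_mul S (fun x => \sum_(j < m) 1 * g j x)).
  rewrite (_ : chi_mul _ _ = (fun x => \sum_(j < m) 1 * chi_mul S (g j) x)).
    by apply: L2_sum => j; apply: L2Z; case: (H j).
  by apply/funext => x; rewrite /chi_mul mulr_sumr; apply: eq_bigr => j _; rewrite mulrCA.
have := le_trans h (sqnormL2_time_band_le QB SB rho0 r0 fg SgL vL vE).
by rewrite ler_pM2r.
Qed.

Lemma eigenvalue_moments_le N (a : R) : (N ^ d <= k)%N ->
  2 * fact_pow N (rho * r) <= a ->
  lam k <= 2 * invk ^+ 2 * bessel * (4 * (rho * r)) ^+ d *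
    (2 * fact_pow N (rho * r) * (2 + a) ^+ d) ^+ 2.
Proof.
move=> Nk epsa; have [e [v [g [H C]]]] := eigen_combination.
have GE j := chi_mul_box_box (g j) SB.
have iG j : cintegrable mu (chi_mul S (g j)).
  by have [_ SgL _] := H j; have [] := cintegrable_box r0 SgL (GE j).
pose A : 'M[R[i]]_(m, #|{ffun 'I_d -> 'I_N}|) := \matrix_(j, n)
  cint mu (fun xi => chi_mul S (g j) xi * monomial x0 xi0 (enum_val n) xi).
have [|c [c0 cA]] := exists_left_kernel A.
  by rewrite card_ffun !card_ord ltnS.
have [vE f0 h] := C c c0.
have fg : fourierL2 (fun x => \sum_(j < m) c j * e j x) (fun x => \sum_(j < m) c j * g j x).
  by apply: fourierL2_sum => j; case: (H j).
have vL : L2 (fun x => \sum_(j < m) c j * v j x).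
  by apply: L2_sum => j; apply: L2Z; case: (H j).
have SgE : chi_mul S (fun x => \sum_(j < m) c j * g j x) =
    (fun x => \sum_(j < m) c j * chi_mul S (g j) x).
  by apply/funext => x; rewrite /chi_mul mulr_sumr; apply: eq_bigr => j _; rewrite mulrCA.
have SgL : L2 (chi_mul S (fun x => \sum_(j < m) c j * g j x)).
  by rewrite SgE; apply: L2_sum => j; apply: L2Z; case: (H j).
have mom (al : {ffun 'I_d -> 'I_N}) : cint mu (fun xi =>
    chi_mul S (fun x => \sum_(j < m) c j * g j x) xi * monomial x0 xi0 al xi) = 0.
  rewrite -[RHS](cA (enum_rank al)) SgE.
  have iM j := cintegrable_monomial x0 al r0 (iG j) (GE j).
  under [RHS]eq_bigr => j _.
    rewrite mxE enum_rankK -cintZ; last exact: iM.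
    over.
  rewrite -cint_sum; last by move=> j; exact: cintegrableZ.
  by apply: eq_cint => xi; rewrite mulr_suml; apply: eq_bigr => j _; rewrite mulrA.
have := le_trans h (sqnormL2_time_band_moments_le QB SB rho0 r0 fg SgL vL vE epsa mom).
by rewrite ler_pM2r.
Qed.

End eigenvalue_bounds.

(** * Elementary inequalities behind the constants *)

Section constants.
Context {R : realType}.

Lemma fact_pow_le_expR N (x : R) : 0 <= x -> fact_pow N x <= expR x.
Proof.
move=> x0; case: N => [|N].
  by rewrite /fact_pow expr0 fact0 divr1 -[X in X <= _]expR0 ler_expR.
by apply: le_trans (expR_ge1Dxn N x0); rewrite lerDr.
Qed.

(* The choice [t = e] in [x ^ N / N! <= t ^ (- N) * exp (t x)]. *)
Lemma fact_pow_le_geometric N (x : R) : 0 <= x ->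
  fact_pow N x <= expR (expR 1 * x) * expR (- N%:R).
Proof.
move=> x0; rewrite expRN ler_pdivlMr ?expR_gt0//.
have -> : fact_pow N x * expR N%:R = fact_pow N (expR 1 * x).
  rewrite /fact_pow exprMn -expRM_natr mul1r mulrAC; congr (_ / _).
  by rewrite mulrC.
by apply: fact_pow_le_expR; rewrite mulr_ge0// expR_ge0.
Qed.

Lemma root_lt (d k N : nat) : (1 <= d)%N -> (k < N.+1 ^ d)%N ->
  (k%:R : R) `^ d%:R^-1 <= N.+1%:R.
Proof.
move=> d1 kN; have d0 : (d%:R : R) != 0 by rewrite pnatr_eq0 -lt0n.
have -> : (N.+1%:R : R) = (N.+1 ^ d)%:R `^ d%:R^-1.
  by rewrite natrX -powR_mulrn// -powRrM divff// powRr1.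
apply: ge0_ler_powR; rewrite ?nnegrE ?invr_ge0 ?ler0n//.
by rewrite ler_nat ltnW.
Qed.

(* The prefactor [B] is traded for a smaller rate by interpolating between the
   two bounds, so that the constant in front does not depend on it. *)
Lemma interpolate_exp_bound (M B lam x : R) : 0 < M -> 0 <= B -> 0 <= x ->
  lam <= M -> lam <= M * B * expR (- x) ->
  lam <= M * expR 1 * expR (- (1 + B)^-1 * x).
Proof.
move=> M0 B0 x0 lamM lamB; set L := 1 + B.
have L1 : 1 <= L by rewrite lerDl.
have L0 : 0 < L by exact: lt_le_trans L1.
(* If [x <= L], the exponent [1 - x / L] is nonnegative and the bound [M] is enough. Otherwise
   [B <= expR L], and [L - x <= 1 - x / L] because the difference is [(x - L) * (L - 1) / L]. *)
rewrite -mulrA -expRD; have [xL|xL] := leP x L.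
  apply: le_trans lamM _; apply: ler_peMr; first exact: ltW.
  by rewrite -[X in X <= _]expR0 ler_expR mulNr subr_ge0 ler_pdivrMl// mulr1.
apply: le_trans lamB _; rewrite -mulrA ler_pM2l//.
have BL : B <= expR L.
  by apply: le_trans (expR_ge1Dx L); rewrite /L; lra.
apply: le_trans (ler_wpM2r (expR_ge0 _) BL) _; rewrite -expRD ler_expR.
rewrite -subr_ge0 (_ : _ - _ = (x - L) * (L - 1) / L); last by field; rewrite gt_eqF.
by apply: divr_ge0; [rewrite mulr_ge0 ?subr_ge0// ltW|exact: ltW].
Qed.

End constants.

(** * Enclosing boxes, choice of the constants and conclusion *)

(** Centred at a point of [Q], with the full diameter as radius. Compactness bounds the set of
    distances, without which its [sup] would be a default value. *)
Lemma compact_subset_box (R : realType) (d : nat) (Q : set 'rV[R]_d) :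
  compact Q -> Q !=set0 -> exists x0, Q `<=` box x0 (diam_oo Q) /\ 0 <= diam_oo Q.
Proof.
move=> cQ [x0 Qx0]; have [M [_ HM]] := compact_bounded cQ.
have QM x : Q x -> `|x| <= M + 1 by apply: HM; rewrite ltrDl.
have ub : has_ubound [set `|x - y| | x in Q & y in Q].
  exists ((M + 1) + (M + 1)) => _ [x Qx [y Qy <-]].
  by apply: le_trans (ler_normB _ _) _; apply: lerD; exact: QM.
have D x y : Q x -> Q y -> `|x - y| <= diam_oo Q.
  by move=> Qx Qy; apply: ub_le_sup => //; exists x => //; exists y.
have D0 : 0 <= diam_oo Q by apply: le_trans (D _ _ Qx0 Qx0).
exists x0; split => // x Qx i; have := D _ _ Qx Qx0.
by rewrite normr_rV_le// => /forallP/(_ i); rewrite !mxE.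
Qed.

Theorem corollary1p5 (R : realType) (d : nat) (d_ge1 : (1 <= d)%N) :
  exists C : R, 0 < C /\
  exists c : R -> R, (forall Delta : R, 0 < Delta -> 0 < c Delta) /\
  forall (Q S : set 'rV[R]_d),
    compact Q -> compact S ->
    (0 < lebesgue_rV d Q)%E -> (0 < lebesgue_rV d S)%E ->
  forall lam : nat -> R, eigenvalues_BPB Q S lam ->
  forall k : nat, (1 <= k)%N ->
    lam k <= C * expR (- c (diam_oo Q * diam_oo S) * k%:R `^ d%:R^-1).
Proof.
pose K : R := @bessel R d; pose kap : R := @invk R d.
have K0 : 0 < K by exact: bessel_gt0.
have kap0 : 0 < kap by exact: invk_gt0.
(* [kap * K] is [8^d]. *)
pose M := 2 * (kap * K) ^+ 2.
have M0 : 0 < M by rewrite mulr_gt0// exprn_gt0// mulr_gt0.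
(* [a D] bounds [2 * fact_pow N D] for all [N] at once, and [a D * expR (- N%:R)] is the sharper
   bound. [B D] is what remains of the moment estimate after division by [M]; its [expR 1] pays for
   passing from [N] to [k^(1/d) - 1]. *)
pose a D : R := 2 * expR (expR 1 * D).
pose B D : R := (4 * D) ^+ d * (a D * (2 + a D) ^+ d) ^+ 2 * expR 1 / K.
have B0 D : 0 <= D -> 0 <= B D.
  move=> D0; apply: divr_ge0; last exact: ltW.
  apply: mulr_ge0; last exact: expR_ge0.
  by apply: mulr_ge0; [rewrite exprn_ge0// mulr_ge0|exact: sqr_ge0].
exists (M * expR 1); split; first by rewrite mulr_gt0// expR_gt0.
exists (fun D => (1 + B D)^-1); split.
  by move=> D D0; rewrite invr_gt0 ltr_pwDl// B0// ltW.
move=> Q S cQ cS Q0 S0 lam eig k k1.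
have nonempty (A : set 'rV[R]_d) : (0 < lebesgue_rV d A)%E -> A !=set0.
  by move=> A0; apply/set0P; apply: contraTneq A0 => ->; rewrite measure0 ltxx.
have [x0 [QB rho0]] := compact_subset_box cQ (nonempty _ Q0).
have [xi0 [SB r0]] := compact_subset_box cS (nonempty _ S0).
set rho := diam_oo Q in QB rho0 *; set r := diam_oo S in SB r0 *.
have D0 : 0 <= rho * r by exact: mulr_ge0.
set D := rho * r in D0 *; set x := k%:R `^ _.
have [lam_ge0 _ _] := eig.
(* A zero may be mere padding of the list, with no eigenfunction behind it; the bound is then
   trivial. *)
have := lam_ge0 k; rewrite le_eqVlt => /predU1P[<-|lamk0].
  by rewrite mulr_ge0 ?expR_ge0// mulr_ge0 ?expR_ge0// ltW.
apply: interpolate_exp_bound;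
  [exact: M0|exact: B0|exact: powR_ge0|exact: (eigenvalue_le QB SB rho0 r0 eig lamk0)|].
(* The largest admissible [N]; it exists because [n <= n ^ d] when [d] is positive. Maximality gives
   [k < (N + 1)^d], hence [x <= N + 1]. *)
have [N NP Nmax] : exists2 N, (N ^ d <= k)%N & forall n, (n ^ d <= k)%N -> (n <= N)%N.
  have bnd n : (n ^ d <= k)%N -> (n <= k)%N.
    apply: leq_trans; case: n => // n; rewrite -[X in (X <= _)%N]expn1.
    exact: leq_pexp2l.
  have ex : exists n, (n ^ d <= k)%N by exists 1%N; rewrite exp1n.
  by case: (ex_maxnP ex bnd) => N NP Nmax; exists N.
have kN : (k < N.+1 ^ d)%N by rewrite ltnNge; apply/negP => /Nmax; rewrite ltnn.
have xN : x <= N.+1%:R by exact: root_lt.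
pose E : R := expR (- N%:R).
have E0 : 0 <= E by exact: expR_ge0.
have E1 : E <= 1 by rewrite -[X in _ <= X]expR0 ler_expR oppr_le0.
have a0 : 0 <= a D by rewrite mulr_ge0// expR_ge0.
have eps : 2 * fact_pow N D <= a D * E.
  by rewrite /a -mulrA ler_pM2l//; exact: fact_pow_le_geometric.
have epsa : 2 * fact_pow N D <= a D by apply: le_trans eps _; rewrite ler_piMr.
have eps0 : 0 <= 2 * fact_pow N D by rewrite mulr_ge0// divr_ge0// exprn_ge0.
apply: le_trans (eigenvalue_moments_le QB SB rho0 r0 eig lamk0 NP epsa) _.
(* One of the two factors [E] already gives the rate 1 expected by [interpolate_exp_bound]; the
   other is bounded by 1. *)
have EX : E ^+ 2 <= expR 1 * expR (- x).
  apply: (@le_trans _ _ E); first by rewrite expr2 ler_piMr.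
  by rewrite -expRD ler_expR; rewrite -natr1 in xN; lra.
have q0 : 0 <= (2 + a D) ^+ d by rewrite exprn_ge0// addr_ge0.
have h : (2 * fact_pow N D * (2 + a D) ^+ d) ^+ 2 <=
    (a D * (2 + a D) ^+ d) ^+ 2 * (expR 1 * expR (- x)).
  apply: (@le_trans _ _ ((a D * (2 + a D) ^+ d) ^+ 2 * E ^+ 2)); last first.
    by apply: ler_wpM2l => //; exact: sqr_ge0.
  rewrite -exprMn ler_pXn2r ?nnegrE//; last 2 first.
  - exact: mulr_ge0.
  - by rewrite !mulr_ge0.
  by rewrite (mulrAC (a D)); apply: ler_wpM2r.
have -> : M * B D * expR (- x) = 2 * kap ^+ 2 * K * (4 * D) ^+ d *
    ((a D * (2 + a D) ^+ d) ^+ 2 * (expR 1 * expR (- x))).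
  by rewrite /M /B; field; rewrite gt_eqF.
apply: ler_wpM2l h.
apply: mulr_ge0; last by rewrite exprn_ge0// mulr_ge0.
by apply: mulr_ge0; [apply: mulr_ge0 => //; exact: sqr_ge0|exact: ltW].
Qed.
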